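(* Let $(\beta_n)_{n\ge 1}$ be a sequence of positive real numbers such that the limits $$\lim_{n\to\infty} n\beta_n = 2c\in[0,\infty),\qquad \lim_{n\to\infty} -\frac1n\log(\beta_n)=\xi\in[0,\infty]$$ exist. For each $n$, let $(\lambda_1,\dots,\lambda_n)$ be a random vector with joint Lebesgue density on $\mathbb{R}^n$ $$f_{\beta_n,n}(\lambda_1,\dots,\lambda_n)=Z\prod_{1\le i<j\le n}|\lambda_i-\lambda_j|^{\beta_n}\, e^{-\sum_{i=1}^n \frac{n\beta_n\lambda_i^2}{2}},$$ where $Z>0$ is the normalizing constant (depending on $n$ and $\beta_n$), let $(w_1,\dots,w_n)$ be independent of $(\lambda_1,\dots,\lambda_n)$ and Dirichlet distributed on the unit simplex with all parameters equal to $\beta_n/2$, and define the random probability measure $$\mu_n=\sum_{k=1}^n w_k\,\delta_{\sqrt{\beta_n}\,\lambda_k}.$$ Then the sequence $(\mu_n)_{n\ge1}$ satisfies a large deviation principle in $\mathcal M_1(\mathbb R)$ with speed $n$ and good rate function $\mathcal I:\mathcal M_1(\mathbb R)\to[0,\infty]$ given as follows. If $\mu$ has countable (finite or countably infinite) support $\operatorname{supp}(\mu)$, then $$\mathcal I(\mu)=(|\operatorname{supp}(\mu)|-1)\cdot\xi+\frac12\sum_{\lambda\in\operatorname{supp}(\mu)}\lambda^2,$$ where in the case of infinitely many support points and $\xi=0$, or if $\mu$ has a single support point and $\xi=\infty$, the product $\infty\cdot 0$ or $0\cdot\infty$, respectively, is interpreted as $0$. If the support of $\mu$ is uncountable, then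 $\mathcal I(\mu)=+\infty$.
   Context: $\mathcal M_1(\mathbb R)$ is the space of Borel probability measures on $\mathbb R$ with the weak topology and the corresponding Borel $\sigma$-algebra. The support $\operatorname{supp}(\mu)$ is the usual (closed) topological support, and $|\operatorname{supp}(\mu)|\in\mathbb N\cup\{\infty\}$ is its number of points. The Dirichlet distribution on the unit simplex with all parameters equal to $\beta_n/2$ is the law of $(w_1,\dots,w_n)$, where $w_n=1-w_1-\dots-w_{n-1}$ and $(w_1,\dots,w_{n-1})$ has Lebesgue density $\frac{\Gamma(n\beta_n/2)}{\Gamma(\beta_n/2)^n}\big[w_1\cdots w_{n-1}(1-w_1-\dots-w_{n-1})\big]^{\beta_n/2-1}$ on the set where $w_1,\dots,w_{n-1}>0$ and $w_1+\dots+w_{n-1}<1$ (for $n=1$, $w_1=1$). A sequence $(X_n)$ of random elements of a topological space $\mathcal X$ satisfies a large deviation principle (LDP) with speed $n$ and rate function $\mathcal I:\mathcal X\to[0,\infty]$ (lower semicontinuous) if $\limsup_{n}\frac1n\log P(X_n\in F)\le-\inf_{x\in F}\mathcal I(x)$ for all closed $F$ and $\liminf_n\frac1n\log P(X_n\in G)\ge-\inf_{x\in G}\mathcal I(x)$ for all open $G$. The rate function is good if all sublevel sets $\{\mathcal I\le M\}$, $M\in[0,\infty)$, are compact. *)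

(* Defs.v *)
From HB Require Import structures.
From mathcomp Require Import all_boot all_order all_algebra.
From mathcomp Require Import all_classical all_reals all_analysis.

Set Implicit Arguments.
Unset Strict Implicit.
Unset Printing Implicit Defensive.

Import Order.TTheory GRing.Theory Num.Theory.
Import numFieldNormedType.Exports.

Local Open Scope classical_set_scope.
Local Open Scope ring_scope.

Section cons_measure.
Context (R : realType) (n : nat).
Variable m : {sigma_finite_measure set (n.-tuple R) -> \bar R}.

Definition cons_pair (p : measurableTypeR R * n.-tuple R) : n.+1.-tuple R :=
  [tuple of p.1 :: p.2].

Lemma measurable_cons_pair : measurable_fun [set: _] cons_pair.
Proof.
apply: (@measurable_cons _ _ _ R (fun p => p.1) n (fun p => p.2)).
  exact: (@measurable_fst _ _ (measurableTypeR R)).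
exact: measurable_snd.
Qed.

Definition cons_measure : set (n.+1.-tuple R) -> \bar R :=
  pushforward (@lebesgue_measure R \x m)%E cons_pair.

Let cons_measure0 : cons_measure set0 = 0%E.
Proof. by rewrite /cons_measure /pushforward preimage_set0 measure0. Qed.

Let cons_measure_ge0 A : (0 <= cons_measure A)%E.
Proof. by rewrite /cons_measure /pushforward; exact: measure_ge0. Qed.

Let cons_measure_sigma_additive : semi_sigma_additive cons_measure.
Proof.
move=> F mF tF mUF.
have mpre A : measurable A -> measurable (cons_pair @^-1` A).
  by move=> mA; rewrite -[X in measurable X]setTI; exact: measurable_cons_pair.
rewrite /cons_measure /pushforward preimage_bigcup.
apply: measure_semi_sigma_additive => [k||]; first exact: mpre.
- apply/trivIsetP => i j _ _ ij; rewrite -preimage_setI.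
  by move/trivIsetP : tF => /(_ _ _ _ _ ij) ->//; rewrite preimage_set0.
- by rewrite -preimage_bigcup; exact: mpre.
Qed.

HB.instance Definition _ := isMeasure.Build _ _ _
  cons_measure cons_measure0 cons_measure_ge0 cons_measure_sigma_additive.

Let cons_measure_sigma_finite : sigma_finite [set: n.+1.-tuple R] cons_measure.
Proof.
have /sigma_finiteP[F [FT ndF Ffin]] :=
  sigma_finiteT (@lebesgue_measure R : {sigma_finite_measure set (measurableTypeR R) -> \bar R}).
have /sigma_finiteP[G [GT ndG Gfin]] := sigma_finiteT m.
pose uncons (t : n.+1.-tuple R) : measurableTypeR R * n.-tuple R :=
  (thead t, [tuple of behead t]).
have munc : measurable_fun [set: _] uncons.
  apply: measurable_fun_pair.
    exact: (measurable_tnth (T := R) (ord0 : 'I_n.+1)).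
  exact: measurable_behead.
have consK : cancel cons_pair uncons.
  move=> [x t]; rewrite /uncons /cons_pair /= theadE; congr pair.
  exact/val_inj.
have preK (B : set (measurableTypeR R * n.-tuple R)) :
    cons_pair @^-1` (uncons @^-1` B) = B.
  rewrite -comp_preimage (_ : uncons \o cons_pair = id)//.
  by apply/funext => p; exact: consK.
exists (fun k => uncons @^-1` (F k `*` G k)).
  rewrite -preimage_bigcup (_ : \bigcup_k _ = setT) ?preimage_setT//.
  apply/seteqP; split => // -[x t] _.
  have [i _ Fix] : (\bigcup_i F i) x by rewrite -FT.
  have [j _ Gjt] : (\bigcup_i G i) t by rewrite -GT.
  exists (maxn i j) => //; split => /=.
    by move: x Fix; exact/subsetPset/ndF/leq_maxl.
  by move: t Gjt; exact/subsetPset/ndG/leq_maxr.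
move=> k; have [mF Foo] := Ffin k; have [mG Goo] := Gfin k.
have mFG : measurable (F k `*` G k) by exact: measurableX.
split; first by rewrite -[X in measurable X]setTI; exact: munc.
rewrite /cons_measure /pushforward preK product_measure1E//.
by rewrite lte_mul_pinfty// ge0_fin_numE.
Qed.

HB.instance Definition _ :=
  @Measure_isSigmaFinite.Build _ _ _ cons_measure cons_measure_sigma_finite.

End cons_measure.

Fixpoint lebesgue_tuple (R : realType) (n : nat) :
    {sigma_finite_measure set (n.-tuple R) -> \bar R} :=
  match n with
  | 0 => dirac [tuple]
  | k.+1 => cons_measure (lebesgue_tuple R k)
  end.

Section laws.
Context (R : realType).

Definition has_density d (T : measurableType d) (P : probability T R) n
    (X : {mfun T >-> n.-tuple R}) (f : n.-tuple R -> R) :=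
  forall A, measurable A ->
    distribution P X A = (\int[lebesgue_tuple R n]_(x in A) (f x)%:E)%E.

Definition beta_ensemble_density (Z b : R) n (x : n.-tuple R) : R :=
  Z * (\prod_(i < n) \prod_(j < n | (i < j)%N)
         `|tnth x i - tnth x j| `^ b)
    * expR (- \sum_(i < n) (n%:R * b * tnth x i ^+ 2) / 2).

Definition Gamma (a : R) : R :=
  \int[lebesgue_measure]_(t in `]0, +oo[) (t `^ (a - 1) * expR (- t)).

(* Density of the first [k] coordinates of the Dirichlet distribution with
   [k.+1] parameters all equal to [a]. *)
Definition dirichlet_density (a : R) k (u : k.-tuple R) : R :=
  let v := 1 - \sum_(i < k) tnth u i in
  if [forall i, 0 < tnth u i] && (0 < v) then
    Gamma (k.+1%:R * a) / Gamma a ^+ k.+1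
      * ((\prod_(i < k) tnth u i) * v) `^ (a - 1)
  else 0.

Definition simplex_last k (u : k.-tuple R) : k.+1.-tuple R :=
  [tuple of rcons u (1 - \sum_(i < k) tnth u i)].

(* The value for [n = 0], where the simplex is empty, is irrelevant. *)
Definition dirichlet_law (a : R) n : set (n.-tuple R) -> \bar R :=
  match n return set (n.-tuple R) -> \bar R with
  | 0 => fun=> 0%E
  | k.+1 => fun A => (\int[lebesgue_tuple R k]_(u in @simplex_last k @^-1` A)
                        (dirichlet_density a u)%:E)%E
  end.

Definition has_dirichlet_law d (T : measurableType d) (P : probability T R) n
    (W : {mfun T >-> n.-tuple R}) (a : R) :=
  forall A, measurable A -> distribution P W A = dirichlet_law a A.

Definition independent d d1 d2 (T : measurableType d)
    (T1 : measurableType d1) (T2 : measurableType d2) (P : probability T R)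
    (X : {mfun T >-> T1}) (Y : {mfun T >-> T2}) :=
  forall A B, measurable A -> measurable B ->
    P (X @^-1` A `&` Y @^-1` B) = (P (X @^-1` A) * P (Y @^-1` B))%E.

End laws.

Definition bounded_continuous (R : realType) :=
  {f : R -> R | continuous f /\ exists M : R, forall x, `|f x| <= M}.

Definition mean (R : realType) (mu : probability R R) :
    {ptws bounded_continuous R -> R} :=
  fun f => \int[mu]_x sval f x.

(* The coarsest topology for which mu |-> \int f dmu is continuous for every
   bounded continuous f.  Elements of [probability R R] are set functions on
   all subsets of R; two of them agreeing on Borel sets are topologically
   indistinguishable here. *)
Definition M1 (R : realType) := initial_topology (@mean R).

Section weighted_dirac.
Context (R : realType) (n : nat).
Implicit Types w x : n.-tuple R.

Definition weighted_atom w x (k : nat) : {measure set R -> \bar R} :=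
  mscale (`|nth 0 w k|)%:nng (dirac (nth 0 x k)).

(* Absolute values and normalization make this a probability measure for every
   [w]; neither has any effect on the simplex, see [weighted_diracE]. *)
Definition weighted_dirac w x : M1 R :=
  mnormalize (msum (weighted_atom w x) n) (dirac (0 : R)).

Lemma weighted_diracE w x (A : set R) :
  (forall k, 0 <= tnth w k) -> \sum_(k < n) tnth w k = 1 ->
  (weighted_dirac w x : probability R R) A =
    (\sum_(k < n) (tnth w k)%:E * \d_(tnth x k) A)%E.
Proof.
move=> w0 w1.
have E B : msum (weighted_atom w x) n B =
    (\sum_(k < n) (tnth w k)%:E * \d_(tnth x k) B)%E.
  rewrite /msum; apply: eq_bigr => k _.
  by rewrite /= /mscale/= -!tnth_nth ger0_norm.
have E1 : msum (weighted_atom w x) n [set: R] = 1%E.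
  by rewrite E; under eq_bigr do rewrite diracT mule1; rewrite sumEFin w1.
have N (m : {measure set R -> \bar R}) (P : probability R R) :
    m setT = 1%E -> mnormalize m P A = m A.
  by move=> m1; rewrite /mnormalize m1 onee_eq0/= invr1 mule1.
by rewrite -E; exact: N.
Qed.

End weighted_dirac.

Section ldp.
Context (R : realType) (X : ptopologicalType).
Local Open Scope ereal_scope.

Definition rate_function (I : X -> \bar R) :=
  (forall x, 0 <= I x) /\ lower_semicontinuous I.

Definition good_rate_function (I : X -> \bar R) :=
  rate_function I /\
  forall M : R, (0 <= M)%R -> compact [set x | I x <= M%:E].

Definition borel := g_sigma_algebraType (@open X).

Context (d : nat -> measure_display) (T : forall n, measurableType (d n)).
Context (P : forall n, probability (T n) R) (Y : forall n, T n -> X).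

Definition random_elements :=
  forall n, (0 < n)%N -> measurable_fun [set: T n] (@Y n : T n -> borel).

Definition log_prob (A : set X) (n : nat) : \bar R :=
  (n%:R^-1)%:E * lne (P n (@Y n @^-1` A)).

Definition ldp_speed_n (I : X -> \bar R) :=
  [/\ random_elements,
      rate_function I,
      forall F, closed F -> limn_esup (log_prob F) <= - ereal_inf (I @` F) &
      forall G, open G -> - ereal_inf (I @` G) <= limn_einf (log_prob G)].

End ldp.

Section rate.
Context (R : realType).

Definition supp (mu : probability R R) : set R :=
  [set x | forall U, open U -> U x -> (0 < mu U)%E].

(* The library's conventions [0 * +oo = +oo * 0 = 0] are the ones required. *)
Definition ldp_rate (xi : \bar R) (mu : M1 R) : \bar R :=
  if `[< countable (supp mu) >] then
    ((counting (supp mu) - 1) * xi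
       + (2^-1)%:E * \esum_(x in supp mu) (x ^+ 2)%:E)%E
  else +oo%E.

End rate.

(* Main.v *)
Require Import Defs.
From HB Require Import structures.
From mathcomp Require Import all_boot all_order all_algebra.
From mathcomp Require Import all_classical all_reals all_analysis.
From mathcomp Require Import measurable_realfun.
From mathcomp Require Import perm.
From mathcomp Require Import ring lra zify.

Import Order.TTheory GRing.Theory Num.Theory.
Import numFieldNormedType.Exports.

Local Open Scope classical_set_scope.
Local Open Scope ring_scope.

Set Implicit Arguments.
Unset Strict Implicit.
Unset Printing Implicit Defensive.

Section fibers.
Context {R : realType}.
Local Notation leb := (@lebesgue_measure R).

Definition ins n (i : nat) (x : R) (t : n.-tuple R) : n.+1.-tuple R :=
  [tuple if (j < i)%N then nth 0 t j else if j == i :> nat then x else nth 0 t j.-1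
   | j < n.+1].

Definition upd n (i : 'I_n) (x : R) (y : n.-tuple R) : n.-tuple R :=
  [tuple if j == i then x else tnth y j | j < n].

Lemma tnth_upd n (i j : 'I_n) x y :
  tnth (upd i x y) j = if j == i then x else tnth y j.
Proof. by rewrite tnth_mktuple. Qed.

Lemma insE n (i : 'I_n.+1) x t : ins i x t = upd i x (ins i 0 t).
Proof.
apply: eq_from_tnth => j; rewrite tnth_upd !tnth_mktuple -val_eqE /=.
by case: (ltngtP j i).
Qed.

Lemma ins_cons n i x y (t : n.-tuple R) :
  ins i.+1 x [tuple of y :: t] = [tuple of y :: ins i x t].
Proof.
apply: eq_from_tnth => j; rewrite tnth_mktuple.
case: (unliftP ord0 j) => [k ->|->] /=.
  rewrite [RHS]tnthS tnth_mktuple /= /bump /= add1n ltnS eqSS.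
  by case: ltngtP => // /ltn_predK <-.
by rewrite (tnth_nth 0).
Qed.

Lemma ins0 n x (t : n.-tuple R) : ins 0 x t = [tuple of x :: t].
Proof.
apply: eq_from_tnth => j; rewrite tnth_mktuple ltn0.
case: (unliftP ord0 j) => [k ->|->] /=; first by rewrite [RHS]tnthS (tnth_nth 0).
by rewrite [RHS](tnth_nth 0).
Qed.

Lemma measurable_tuple_fun d (T : measurableType d) n (f : T -> n.-tuple R) :
  (forall i, measurable_fun setT (fun t => tnth (f t) i)) -> measurable_fun setT f.
Proof. by move=> h; apply/measurable_fun_tnthP. Qed.

Lemma measurable_nth_tuple n (j : nat) :
  measurable_fun setT (fun t : n.-tuple R => nth 0 t j : R).
Proof.
have [jn|nj] := ltnP j n.
  rewrite (_ : (fun _ => _) = fun t : n.-tuple R => tnth t (Ordinal jn)).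
    exact: measurable_tnth.
  by apply/funext => t; rewrite (tnth_nth 0).
rewrite (_ : (fun _ => _) = cst 0); first exact: measurable_cst.
by apply/funext => t; rewrite nth_default ?size_tuple.
Qed.

Lemma measurable_ins n i :
  measurable_fun setT (fun p : measurableTypeR R * n.-tuple R => ins i p.1 p.2).
Proof.
apply: measurable_tuple_fun => j.
under eq_fun do rewrite tnth_mktuple.
case: (j < i)%N; first exact: (measurableT_comp (measurable_nth_tuple _) measurable_snd).
case: (j == i :> nat); first exact: (@measurable_fst _ _ (measurableTypeR R)).
exact: (measurableT_comp (measurable_nth_tuple _) measurable_snd).
Qed.

Lemma measurable_ins_r n i x : measurable_fun setT (@ins n i x).
Proof.
apply: measurable_tuple_fun => j; under eq_fun do rewrite tnth_mktuple.
case: (j < i)%N; first exact: measurable_nth_tuple.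
case: (j == i :> nat); [exact: measurable_cst|exact: measurable_nth_tuple].
Qed.

Lemma measurable_upd n (i : 'I_n) y : measurable_fun setT (fun x : R => upd i x y).
Proof.
apply: measurable_tuple_fun => j; under eq_fun do rewrite tnth_upd.
by case: (j == i); [exact: measurable_id|exact: measurable_cst].
Qed.

Local Open Scope ereal_scope.

Lemma measurable_ins_comp n i (f : n.+1.-tuple R -> \bar R) :
  measurable_fun setT f ->
  measurable_fun setT (fun p : measurableTypeR R * n.-tuple R => f (ins i p.1 p.2)).
Proof. by move=> mf; apply: (measurableT_comp mf); exact: measurable_ins. Qed.

Lemma integral_ins n i (f : n.+1.-tuple R -> \bar R) :
  (i <= n)%N -> measurable_fun setT f -> (forall x, 0 <= f x) ->
  \int[lebesgue_tuple R n.+1]_t f t =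
  \int[lebesgue_tuple R n]_t \int[leb]_x f (ins i x t).
Proof.
elim: i n f => [|i ih] n f lein mf f0.
  rewrite [LHS](ge0_integral_pushforward (@measurable_cons_pair R n)) //; last first.
  rewrite preimage_setT [LHS](_ : _ = \int[leb \x lebesgue_tuple R n]_p f (ins 0 p.1 p.2)); last first.
    by apply: eq_integral => p _; rewrite /= ins0.
  rewrite fubini_tonelli1 //; last first.
    exact: measurable_ins_comp.
  rewrite fubini_tonelli //; exact: measurable_ins_comp.
case: n f lein mf f0 => [|n] f lein mf f0; first by [].

rewrite [LHS](ge0_integral_pushforward (@measurable_cons_pair R n.+1)) // preimage_setT.
rewrite fubini_tonelli1; last 2 first.
- by apply: (measurableT_comp mf); exact: measurable_cons_pair.
- by move=> p; exact: f0.
rewrite [RHS](ge0_integral_pushforward (@measurable_cons_pair R n)) //; last 2 first.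
- have := @measurable_fun_fubini_tonelli_G _ _ (measurableTypeR R) (n.+1.-tuple R) R
    lebesgue_measure (fun p => f (ins i.+1 p.1 p.2)) (measurable_ins_comp _ mf) (fun=> f0 _).
  by [].
- by move=> t _; exact: integral_ge0.
rewrite preimage_setT fubini_tonelli1 //; last 2 first.
- have h := @measurable_fun_fubini_tonelli_G _ _ (measurableTypeR R) (n.+1.-tuple R) R
    lebesgue_measure (fun p => f (ins i.+1 p.1 p.2)) (measurable_ins_comp _ mf) (fun=> f0 _).
  exact: (measurableT_comp h (@measurable_cons_pair R n)).
- by move=> t; exact: integral_ge0.
apply: eq_integral => y _; rewrite /fubini_F.
rewrite (ih n (fun t => f (cons_pair (y, t)))) //.
- apply: eq_integral => t _ /=; apply: eq_integral => x _.
  by rewrite /cons_pair/= ins_cons.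
- have mc : measurable_fun setT (fun t => @cons_pair R n.+1 (y, t)).
    by apply: measurable_cons => //=; exact: measurable_cst.
  exact: (measurableT_comp mf mc).
Qed.

(* fiberwise comparison *)
Lemma fiber_le n (i : 'I_n) (f g : n.-tuple R -> \bar R) :
  measurable_fun setT f -> measurable_fun setT g ->
  (forall y, 0 <= f y) -> (forall y, 0 <= g y) ->
  (forall y, \int[leb]_x f (upd i x y) <= \int[leb]_x g (upd i x y)) ->
  \int[lebesgue_tuple R n]_y f y <= \int[lebesgue_tuple R n]_y g y.
Proof.
case: n i f g => [[]//|n] i f g mf mg f0 g0 fg.
have lein : (i <= n)%N by rewrite -ltnS.
have mi h : measurable_fun [set: n.+1.-tuple R] h -> (forall y, 0 <= h y) ->
  measurable_fun setT (fun t => \int[leb]_x h (ins i x t)).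
  move=> mh h0.
  exact: (@measurable_fun_fubini_tonelli_G _ _ (measurableTypeR R) (n.-tuple R) R
    lebesgue_measure (fun p => h (ins i p.1 p.2)) (measurable_ins_comp _ mh) (fun=> h0 _)).
rewrite !(integral_ins lein) //.
apply: ge0_le_integral => //.
- by move=> t _; exact: integral_ge0.
- exact: mi.
- exact: mi.
- move=> t _.
  under eq_integral do rewrite insE.
  by under [leRHS]eq_integral do rewrite insE.
Qed.

End fibers.

Section fiber_sets.
Context {R : realType}.
Local Notation leb := (@lebesgue_measure R).
Local Open Scope ereal_scope.

Lemma measurable_fiber n (i : 'I_n) y (A : set (n.-tuple R)) : measurable A ->
  measurable [set x : R | A (upd i x y)].
Proof. by move=> mA; rewrite -[X in measurable X]setTI; exact: measurable_upd. Qed.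

Lemma fiber_set_le n (i : 'I_n) (rho : n.-tuple R -> R) (A B : set (n.-tuple R)) (q : R) :
  measurable_fun setT rho -> (forall y, 0 <= rho y)%R ->
  measurable A -> measurable B -> (0 <= q)%R ->
  (forall y, \int[leb]_(x in [set x | A (upd i x y)]) (rho (upd i x y))%:E <=
     q%:E * \int[leb]_(x in [set x | B (upd i x y)]) (rho (upd i x y))%:E) ->
  \int[lebesgue_tuple R n]_(y in A) (rho y)%:E <=
     q%:E * \int[lebesgue_tuple R n]_(y in B) (rho y)%:E.
Proof.
move=> mrho rho0 mA mB q0 H.
have mr (E : set (n.-tuple R)) : measurable E ->
    measurable_fun setT ((fun y => (rho y)%:E) \_ E).
  by move=> mE; apply/(measurable_restrictT _ mE)/measurable_EFinP; exact: measurable_funTS.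
have r0 (E : set (n.-tuple R)) y : 0 <= ((fun y => (rho y)%:E) \_ E) y.
  by apply: erestrict_ge0 => // z _; rewrite lee_fin.
rewrite [X in X <= _]integral_mkcond [X in _ <= _ * X]integral_mkcond.
rewrite -ge0_integralZl //; last exact: mr.
apply: (fiber_le (i := i)) => //.
- exact: mr.
- by apply: measurable_funeM; exact: mr.
- by move=> y; rewrite mule_ge0.
- move=> y; rewrite ge0_integralZl_EFin //; last first.
    exact: (measurableT_comp (mr _ mB) (measurable_upd i y)).
  have E1 (E : set (n.-tuple R)) : \int[leb]_x ((fun y => (rho y)%:E) \_ E) (upd i x y) =
      \int[leb]_(x in [set x | E (upd i x y)]) (rho (upd i x y))%:E.
    by rewrite [RHS]integral_mkcond; apply: eq_integral => x _; rewrite !patchE.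
  by rewrite !E1; exact: H.
Qed.

End fiber_sets.

Section one_dim_gauss.
Context {R : realType}.
Local Notation leb := (@lebesgue_measure R).

Lemma remove_balls (I : set R) (ys : seq R) (rho : R) : 0 <= rho -> measurable I ->
  (leb I <= leb (I `&` [set x | all (fun y => (rho <= `|x - y|)%R) ys]) +
     ((size ys)%:R * (2 * rho))%:E)%E.
Proof.
move=> rho0; elim: ys I => [|y ys ih] I mI.
  by rewrite mul0r adde0 le_measure // ?inE // (_ : I `&` _ = I) //; apply/seteqP; split => [x []|x].
have mB : measurable (ball y rho) by exact: measurable_ball.
have mD : measurable (I `\` ball y rho) by exact: measurableD.
apply: (@le_trans _ _ (leb (I `\` ball y rho) + (2 * rho)%:E)%E).
  have -> : (2 * rho)%:E = leb (ball y rho).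
    by rewrite lebesgue_measure_ball // mulr_natl.
  have := measureU2 leb mD mB; apply: le_trans; apply: le_measure; rewrite ?inE //.
    exact: measurableU.
  by move=> x Ix; have [xB|xB] := pselect (ball y rho x); [right|left].
apply: (@le_trans _ _ ((leb ((I `\` ball y rho) `&` [set x | all (fun y => (rho <= `|x - y|)%R) ys]) +
     ((size ys)%:R * (2 * rho))%:E) + (2 * rho)%:E)%E).
  by apply: leeD2r; exact: ih.
rewrite -addeA -EFinD /= (_ : (size ys).+1%:R * (2 * rho) = (size ys)%:R * (2 * rho) + 2 * rho); last by rewrite mulrSr; ring.
apply: leeD2r; rewrite le_eqVlt; apply/orP; left; apply/eqP.
congr (leb _); apply/seteqP; split => [x [[Ix nb] al]|x [Ix /andP[h al]]].
  split => //; apply/andP; split => //.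
  by rewrite leNgt; apply/negP => h; apply: nb; rewrite /ball /= distrC.
by split => //; split => //; rewrite /ball /= distrC; apply/negP; rewrite -leNgt.
Qed.

Variables (n C : nat) (b : R) (ys : seq R).
Hypotheses (n0 : (0 < n)%N) (b0 : 0 < b) (bC : (size ys)%:R * b <= C%:R) (szn : (size ys < n)%N).
Local Notation s := (Num.sqrt b).

Definition cond_density (x : R) : R :=
  (\prod_(y <- ys) `|x - y| `^ b) * expR (- (n%:R * (s * x) ^+ 2 / 2)).
Definition cond_const : R := \prod_(y <- ys) (((1 + s * `|y|) / s) `^ b).

Let s0 : 0 < s. Proof. by rewrite sqrtr_gt0. Qed.

Lemma cond_const_gt0 : 0 < cond_const.
Proof.
rewrite /cond_const; elim/big_ind: _ => // [x y x0 y0|y _]; first exact: mulr_gt0.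
by rewrite powR_gt0 // divr_gt0 // ltr_pwDl // mulr_ge0 // ltW.
Qed.

Lemma cond_density_ge0 x : 0 <= cond_density x.
Proof. by rewrite mulr_ge0 ?expR_ge0 // prodr_ge0 // => y _; exact: powR_ge0. Qed.

Lemma prod_const_powR (a : R) : 1 <= a -> \prod_(y <- ys) (a `^ b) <= a ^+ C.
Proof.
move=> a1; have a0 : 0 < a by exact: lt_le_trans a1.
rewrite big_const_seq count_predT iter_mulr_1.
by rewrite -powR_mulrn ?powR_ge0 // -powR_mulrn ?(ltW a0) // -powRrM ler_powR // mulrC.
Qed.

Lemma cond_prod_ub x :
  \prod_(y <- ys) `|x - y| `^ b <= cond_const * (1 + s * `|x|) ^+ C.
Proof.
have h1 : 1 <= 1 + s * `|x| by rewrite lerDl mulr_ge0 // ltW.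
apply: (@le_trans _ _ (cond_const * \prod_(y <- ys) (1 + s * `|x|) `^ b)); last first.
  by rewrite ler_wpM2l ?(ltW cond_const_gt0) // prod_const_powR.
rewrite /cond_const -big_split /=; apply: ler_prod => y _; rewrite powR_ge0 /=.
have p1 : 0 <= s * `|y| by rewrite mulr_ge0 // ltW.
have p2 : 0 <= s * `|x| by rewrite mulr_ge0 // ltW.
have q1 : 0 <= (1 + s * `|y|) / s by rewrite divr_ge0 ?(ltW s0) // addr_ge0.
have q2 : 0 <= 1 + s * `|x| by rewrite addr_ge0.
rewrite -powRM // ge0_ler_powR ?(ltW b0) ?nnegrE ?mulr_ge0 //.
rewrite mulrAC ler_pdivlMr //; apply: le_trans (_ : (`|x| + `|y|) * s <= _).
  by rewrite ler_wpM2r ?(ltW s0) // ler_normB.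
by have := mulr_ge0 p1 p2; lra.
Qed.

Lemma cond_prod_lb x (eta : R) : 0 < eta -> all (fun y => eta <= s * `|x - y|) ys ->
  cond_const / (1 + (1 + s * `|x|) / eta) ^+ C <= \prod_(y <- ys) `|x - y| `^ b.
Proof.
move=> eta0 hall.
have p2 : 0 <= s * `|x| by rewrite mulr_ge0 // ltW.
set k := 1 + _ / eta.
have k1 : 1 <= k by rewrite lerDl divr_ge0 ?(ltW eta0) // addr_ge0.
have k0 : 0 < k by exact: lt_le_trans k1.
rewrite ler_pdivrMr ?exprn_gt0 //.
apply: (@le_trans _ _ ((\prod_(y <- ys) `|x - y| `^ b) * \prod_(y <- ys) (k `^ b))); last first.
  by rewrite ler_wpM2l ?prod_const_powR // prodr_ge0 // => y _; exact: powR_ge0.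
rewrite /cond_const -big_split /= big_seq [leRHS]big_seq; apply: ler_prod => y yin.
have /allP /(_ _ yin) hy := hall.
have p1 : 0 <= s * `|y| by rewrite mulr_ge0 // ltW.
have q1 : 0 <= (1 + s * `|y|) / s by rewrite divr_ge0 ?(ltW s0) // addr_ge0.
rewrite powR_ge0 /= -powRM ?(ltW k0) //.
rewrite ge0_ler_powR ?(ltW b0) ?nnegrE ?q1 ?mulr_ge0 ?(ltW k0) //.
rewrite ler_pdivrMr //.
have hs : s * `|y| <= s * `|x| + s * `|x - y|.
  rewrite -mulrDr ler_pM2l // -lerBlDl; apply: le_trans (lerB_dist _ _) _.
  by rewrite distrC.
rewrite (_ : _ * s = s * `|x - y| + (s * `|x - y|) / eta * (1 + s * `|x|)); last first.
  by rewrite /k; field; rewrite gt_eqF.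
have h1 : 1 <= s * `|x - y| / eta by rewrite ler_pdivlMr // mul1r.
have : 1 * (1 + s * `|x|) <= s * `|x - y| / eta * (1 + s * `|x|) by rewrite ler_wpM2r // addr_ge0.
lra.
Qed.

Lemma measurable_cond_density : measurable_fun setT cond_density.
Proof.
apply: measurable_funM.
  apply: measurable_prod => y _ /=.
  apply: (measurableT_comp (measurable_powR _)).
  by apply: (measurableT_comp (@normr_measurable R _)); exact: measurable_funB.
apply: (measurableT_comp (@measurable_expR R)); apply: measurableT_comp => //.
by apply: measurable_funM => //; apply: measurable_funM => //; apply: measurable_funX; exact: measurable_funM.
Qed.

End one_dim_gauss.

Section cond_integrals.
Context {R : realType}.
Local Notation leb := (@lebesgue_measure R).

Lemma measurable_away (ys : seq R) (rho : R) :
  measurable [set x : R | all (fun y => rho <= `|x - y|) ys].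
Proof.
elim: ys => [|y ys ih].
  by rewrite (_ : [set _ | _] = setT) //; apply/seteqP; split.
rewrite (_ : [set _ | _] = ~` ball y rho `&` [set x | all (fun y => rho <= `|x - y|) ys]).
  by apply: measurableI => //; apply: measurableC; exact: measurable_ball.
apply/seteqP; split => [x /= /andP[h ->]|x /= [h ->]]; rewrite ?andbT.
  by split => //; rewrite /ball /= distrC; apply/negP; rewrite -leNgt.
by rewrite leNgt; apply/negP => h'; apply: h; rewrite /ball /= distrC.
Qed.

Lemma integral_gauss (b : R) : 0 < b ->
  (\int[leb]_x (expR (- (b * x ^+ 2 / 4)))%:E = (2 * Num.sqrt pi / Num.sqrt b)%:E)%E.
Proof.
move=> b0; have s0 : 0 < Num.sqrt b by rewrite sqrtr_gt0.
pose sg : R := Num.sqrt 2 / Num.sqrt b.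
have sg2 : sg ^+ 2 = 2 / b by rewrite expr_div_n !sqr_sqrtr // ltW.
have sg0 : sg != 0 by rewrite gt_eqF // divr_gt0 // sqrtr_gt0.
have fE x : expR (- (b * x ^+ 2 / 4)) = (normal_peak sg)^-1 * normal_pdf 0 sg x.
  rewrite normal_pdfE // mulKf ?gt_eqF ?normal_peak_gt0 // /normal_fun sg2 subr0.
  by congr expR; field; rewrite gt_eqF.
under eq_integral do rewrite fE EFinM.
rewrite ge0_integralZl_EFin //; last 3 first.
- by move=> x _; rewrite lee_fin normal_pdf_ge0.
- by apply/measurable_EFinP; exact: measurable_normal_pdf.
- by rewrite invr_ge0 normal_peak_ge0.
rewrite integral_normal_pdf mule1 invrK sg2; congr EFin.
have p0 : 0 <= 2 * Num.sqrt pi / Num.sqrt b :> R by rewrite divr_ge0 // mulr_ge0 // sqrtr_ge0.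
rewrite -[RHS]ger0_norm // -sqrtr_sqr; congr Num.sqrt.
rewrite expr_div_n exprMn !sqr_sqrtr ?(ltW b0) ?(ltW (pi_gt0 _)) //.
by field; rewrite gt_eqF.
Qed.

Variables (n C : nat) (b : R) (ys : seq R).
Hypotheses (n0 : (0 < n)%N) (b0 : 0 < b) (bC : (size ys)%:R * b <= C%:R) (szn : (size ys < n)%N).
Local Notation s := (Num.sqrt b).
Let s0 : 0 < s. Proof. by rewrite sqrtr_gt0. Qed.
Local Notation phi := (cond_density n b ys).

Definition gauss_bound : R := expR (C%:R ^+ 2) * (2 * Num.sqrt pi).

Lemma gauss_bound_gt0 : 0 < gauss_bound.
Proof. by rewrite mulr_gt0 ?expR_gt0 // mulr_gt0 // sqrtr_gt0 pi_gt0. Qed.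

Lemma exprn_le_exp (u : R) : 0 <= u -> (1 + u) ^+ C <= expR (C%:R ^+ 2) * expR (u ^+ 2 / 4).
Proof.
move=> u0; apply: (@le_trans _ _ (expR u ^+ C)).
  by rewrite lerXn2r ?nnegrE ?expR_ge0 ?addr_ge0 // expR_ge1Dx.
rewrite -expRM_natl -expRD ler_expR.
by have := sqr_ge0 (u / 2 - C%:R); lra.
Qed.

Lemma int_cond_ub (r : R) : 0 <= r ->
  (\int[leb]_(x in [set x | (r <= `|s * x|)%R]) (phi x)%:E <=
   (cond_const b ys * (gauss_bound / s) * expR (- (n.-1%:R * r ^+ 2 / 2)))%:E)%E.
Proof.
move=> r0.
have mS : measurable [set x : R | r <= `|s * x|].
  rewrite (_ : [set _ | _] = (fun x => `|s * x|) @^-1` `[r, +oo[%classic); last first.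
    by apply/seteqP; split => x /=; rewrite in_itv /= andbT.
  rewrite -[X in measurable X]setTI.
  have : measurable_fun [set: R] (fun x : R => `|s * x|).
    by apply: (measurableT_comp (@normr_measurable R _)); exact: measurable_funM.
  by apply; [exact: measurableT|exact: measurable_itv].
pose c := cond_const b ys * expR (C%:R ^+ 2) * expR (- (n.-1%:R * r ^+ 2 / 2)).
have c0 : 0 <= c.
  by rewrite /c !mulr_ge0 ?expR_ge0 // ltW // cond_const_gt0.
have mg : measurable_fun setT (fun x : R => (expR (- (b * x ^+ 2 / 4)))%:E).
  apply/measurable_EFinP; apply: (measurableT_comp (@measurable_expR R)); apply: measurableT_comp => //.
  by apply: measurable_funM => //; apply: measurable_funM => //; exact: measurable_funX.
apply: (@le_trans _ _ (\int[leb]_(x in [set x | (r <= `|s * x|)%R]) (c%:E * (expR (- (b * x ^+ 2 / 4)))%:E))%E).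
  apply: ge0_le_integral => //.
  - by move=> x _; rewrite lee_fin cond_density_ge0.
  - by apply: measurable_funTS; apply/measurable_EFinP; exact: measurable_cond_density.
  - by apply: measurable_funTS; exact: measurable_funeM.
  move=> x /= rx; rewrite -EFinM lee_fin /cond_density.
  apply: le_trans (_ : cond_const b ys * (1 + s * `|x|) ^+ C * expR (- (n%:R * (s * x) ^+ 2 / 2)) <= _).
    by rewrite ler_wpM2r ?expR_ge0 // cond_prod_ub.
  have -> : c * expR (- (b * x ^+ 2 / 4)) = cond_const b ys * (expR (C%:R ^+ 2) *
      expR (- (n.-1%:R * r ^+ 2 / 2)) * expR (- (b * x ^+ 2 / 4))) by rewrite /c; ring.
  rewrite -[leLHS]mulrA ler_wpM2l ?(ltW (cond_const_gt0 _ _)) //.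
  apply: le_trans (_ : expR (C%:R ^+ 2) * expR ((s * `|x|) ^+ 2 / 4) * expR (- (n%:R * (s * x) ^+ 2 / 2)) <= _).
    by rewrite ler_wpM2r ?expR_ge0 // exprn_le_exp // mulr_ge0 // ltW.
  rewrite -!expRD ler_expR exprMn real_normK ?num_real // -exprMn.
  have -> : n%:R = n.-1%:R + 1 :> R by rewrite -[in LHS](prednK n0) -natr1.
  have -> : b * x ^+ 2 = (s * x) ^+ 2 by rewrite exprMn sqr_sqrtr // ltW.
  have : n.-1%:R * r ^+ 2 <= n.-1%:R * (s * x) ^+ 2.
    rewrite ler_wpM2l // -[(s * x) ^+ 2]real_normK ?num_real //.
    by rewrite lerXn2r ?nnegrE // (le_trans r0).
  by have := sqr_ge0 (s * x); lra.
rewrite ge0_integralZl_EFin //; last exact: measurable_funTS.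
apply: (@le_trans _ _ (c%:E * \int[leb]_x (expR (- (b * x ^+ 2 / 4)))%:E)%E).
  apply: lee_wpmul2l => //; apply: ge0_subset_integral => //.
rewrite integral_gauss // -EFinM lee_fin /c /gauss_bound le_eqVlt; apply/orP; left; apply/eqP; ring.
Qed.

Lemma int_cond_lb (al eps : R) : 0 < eps ->
  ((cond_const b ys * (eps / s) / (1 + (1 + (`|al| + eps)) * (2 * n%:R) / eps) ^+ C
    * expR (- (n%:R * (`|al| + eps) ^+ 2 / 2)))%:E <=
   \int[leb]_(x in [set x | (`|s * x - al| < eps)%R]) (phi x)%:E)%E.
Proof.
move=> e0; have e0' := ltW e0; have s0' := ltW s0.
have nR0 : 0 < n%:R :> R by rewrite ltr0n.
have IE : [set x : R | `|s * x - al| < eps] = ball (al / s) (eps / s).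
  have E x : (`|al / s - x| < eps / s) = (`|s * x - al| < eps).
    have -> : al / s - x = - ((s * x - al) / s) by field; rewrite gt_eqF.
    by rewrite normrN normrM normfV (ger0_norm s0') ltr_pM2r // invr_gt0.
  by apply/seteqP; split => x; rewrite /ball /= E.
set eta := eps / (2 * n%:R).
have eta0 : 0 < eta by rewrite divr_gt0 // mulr_gt0.
pose A := [set x : R | all (fun y => eta / s <= `|x - y|) ys].
pose J := ball (al / s) (eps / s) `&` A.
have mB : measurable (ball (al / s) (eps / s)) by exact: measurable_ball.
have mJ : measurable J by apply: measurableI => //; exact: measurable_away.
have mphi : measurable_fun setT (fun x => (phi x)%:E).
  by apply/measurable_EFinP; exact: measurable_cond_density.
have lJ : ((eps / s)%:E <= leb J)%E.
  have := @remove_balls R (ball (al / s) (eps / s)) ys (eta / s) (divr_ge0 (ltW eta0) s0') mB.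
  rewrite lebesgue_measure_ball ?divr_ge0 // -/A -/J => h.
  rewrite -(@leeD2rE _ ((size ys)%:R * (2 * (eta / s)))%:E) //; apply: le_trans h.
  rewrite -EFinD lee_fin -mulr_natr.
  have : (size ys)%:R * (2 * (eta / s)) <= n%:R * (2 * (eta / s)).
    by rewrite ler_wpM2r ?ler_nat ?(ltnW szn) // mulr_ge0 // divr_ge0 ?ltW.
  have -> : n%:R * (2 * (eta / s)) = eps / s.
    by rewrite /eta; field; rewrite !gt_eqF.
  lra.
set k := 1 + _ / eps.
have k1 : 1 <= k by rewrite lerDl divr_ge0 // mulr_ge0 ?mulr_ge0 // ?addr_ge0.
have k0 : 0 < k by exact: lt_le_trans k1.
pose c := cond_const b ys / k ^+ C * expR (- (n%:R * (`|al| + eps) ^+ 2 / 2)).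
have c0 : 0 <= c.
  by rewrite /c mulr_ge0 ?expR_ge0 // divr_ge0 ?exprn_ge0 ?(ltW k0) // ltW // cond_const_gt0.
rewrite IE; apply: (@le_trans _ _ (\int[leb]_(x in J) (phi x)%:E)%E); last first.
  apply: ge0_subset_integral => //; first exact: measurable_funTS.
    by move=> x _; rewrite lee_fin cond_density_ge0.
  by move=> x [].
apply: (@le_trans _ _ (\int[leb]_(x in J) c%:E)%E); last first.
  apply: ge0_le_integral => //; first exact: measurable_funTS.
  move=> x [Bx Ax]; rewrite lee_fin /c /cond_density.
  have sx : `|s * x| <= `|al| + eps.
    move: Bx; rewrite -IE /= => Bx.
    by rewrite -[s * x](subrK al) addrC (le_trans (ler_normD _ _)) // lerD2l ltW.
  apply: ler_pM; rewrite ?expR_ge0 ?divr_ge0 ?exprn_ge0 ?(ltW k0) ?(ltW (cond_const_gt0 _ _)) //.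
    apply: le_trans (cond_prod_lb b0 bC eta0 _); last first.
      by apply: sub_all Ax => y; rewrite ler_pdivrMr // mulrC.
    rewrite ler_wpM2l ?(ltW (cond_const_gt0 _ _)) // lef_pV2 ?posrE ?exprn_gt0 //; last first.
      by rewrite ltr_pwDl // divr_ge0 ?(ltW eta0) // addr_ge0 // mulr_ge0.
    rewrite lerXn2r ?nnegrE ?(ltW k0) //.
      by rewrite addr_ge0 // divr_ge0 ?(ltW eta0) // addr_ge0 // mulr_ge0.
    have -> : (1 + s * `|x|) / eta = (1 + s * `|x|) * (2 * n%:R) / eps.
      by rewrite /eta; field; rewrite !gt_eqF.
    rewrite /k lerD2l ler_wpM2r ?invr_ge0 // ler_wpM2r ?mulr_ge0 // lerD2l.
    by move: sx; rewrite normrM ger0_norm.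
  rewrite ler_expR lerN2 ler_pM2r // ler_pM2l // -[leLHS]real_normK ?num_real //.
  by rewrite lerXn2r ?nnegrE ?addr_ge0.
rewrite integral_cst //; apply: le_trans (lee_wpmul2l _ lJ); last by rewrite lee_fin.
rewrite -EFinM lee_fin /c le_eqVlt; apply/orP; left; apply/eqP; ring.
Qed.

End cond_integrals.

Section cond_ratios.
Context {R : realType}.
Local Notation leb := (@lebesgue_measure R).
Variables (n C : nat) (b : R) (ys : seq R).
Hypotheses (n0 : (0 < n)%N) (b0 : 0 < b) (bC : (size ys)%:R * b <= C%:R) (szn : (size ys < n)%N).
Local Notation s := (Num.sqrt b).
Local Notation phi := (cond_density n b ys).
Local Notation K := (gauss_bound C : R).

Definition far_cost : R := K * n%:R * (5 * n%:R ^+ 2) ^+ C * expR 1.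
Definition near_cost (al eps : R) : R :=
  eps / (1 + (1 + (`|al| + eps)) * (2 * n%:R) / eps) ^+ C
    * expR (- (n%:R * (`|al| + eps) ^+ 2 / 2)) / K.

Let s0 : 0 < s. Proof. by rewrite sqrtr_gt0. Qed.

Lemma far_cost_ge0 : 0 <= far_cost.
Proof.
by rewrite /far_cost !mulr_ge0 ?exprn_ge0 ?mulr_ge0 ?expR_ge0 // ?(ltW (gauss_bound_gt0 _)).
Qed.

Lemma near_cost_gt0 al eps : 0 < eps -> 0 < near_cost al eps.
Proof.
move=> e0; rewrite /near_cost divr_gt0 ?gauss_bound_gt0 // mulr_gt0 ?expR_gt0 // divr_gt0 // exprn_gt0 //.
by rewrite ltr_pwDl // divr_ge0 ?(ltW e0) // mulr_ge0 ?mulr_ge0 ?addr_ge0 // ltW.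
Qed.

Let mphi : measurable_fun setT (fun x => (phi x)%:E).
Proof. by apply/measurable_EFinP; exact: measurable_cond_density. Qed.

Let phi0 x : (0 <= (phi x)%:E)%E.
Proof. by rewrite lee_fin cond_density_ge0. Qed.

Lemma measurable_dist (al : R) : measurable_fun setT (fun x : R => `|s * x - al|).
Proof.
apply: (measurableT_comp (@normr_measurable R _)).
by apply: measurable_funB => //; exact: measurable_funM.
Qed.

Lemma measurable_far (r : R) : measurable [set x : R | r <= `|s * x|].
Proof.
rewrite (_ : [set _ | _] = (fun x => `|s * x - 0|) @^-1` `[r, +oo[%classic); last first.
  by apply/seteqP; split => x /=; rewrite in_itv /= andbT subr0.
rewrite -[X in measurable X]setTI.
by apply: (measurable_dist 0); [exact: measurableT|exact: measurable_itv].
Qed.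

Lemma measurable_near (al eps : R) : measurable [set x : R | `|s * x - al| < eps].
Proof.
rewrite (_ : [set _ | _] = (fun x => `|s * x - al|) @^-1` `]-oo, eps[%classic); last first.
  by apply/seteqP; split => x /=; rewrite in_itv /=.
rewrite -[X in measurable X]setTI.
by apply: measurable_dist; [exact: measurableT|exact: measurable_itv].
Qed.

Lemma cond_far (r : R) : 0 <= r ->
  (\int[leb]_(x in [set x | (r <= `|s * x|)%R]) (phi x)%:E <=
   (far_cost * expR (- (n.-1%:R * r ^+ 2 / 2)))%:E * \int[leb]_x (phi x)%:E)%E.
Proof.
move=> r0; have nR0 : 0 < n%:R :> R by rewrite ltr0n.
have n1 : 1 <= n%:R :> R by rewrite ler1n.
apply: le_trans (int_cond_ub n0 b0 bC r0) _.
have i0 : 0 < n%:R^-1 :> R by rewrite invr_gt0.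
have i1 : n%:R^-1 <= 1 :> R by rewrite invf_le1.
have := int_cond_lb n0 b0 bC szn 0 i0; rewrite normr0 add0r.
set L := (X in (X%:E <= _)%E) => hL.
have hL' : (L%:E <= \int[leb]_x (phi x)%:E)%E.
  apply: le_trans hL _; apply: ge0_subset_integral => //; first exact: measurable_near.
apply: le_trans (lee_wpmul2l _ hL'); last first.
  by rewrite lee_fin mulr_ge0 ?expR_ge0 ?far_cost_ge0.
rewrite -EFinM lee_fin [leRHS]mulrAC ler_wpM2r ?expR_ge0 // /L /far_cost.
set k := 1 + _.
have kE : k = 1 + 2 * n%:R ^+ 2 + 2 * n%:R by rewrite /k; field; rewrite gt_eqF.
have k1 : 1 <= k by rewrite kE -addrA lerDl addr_ge0 // mulr_ge0 // exprn_ge0.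
have k0 : 0 < k by exact: lt_le_trans k1.
have kle : k <= 5 * n%:R ^+ 2.
  have : 1 <= n%:R ^+ 2 :> R by rewrite exprn_ege1.
  have : n%:R <= n%:R ^+ 2 :> R by rewrite expr2 ler_peMl.
  by rewrite kE; lra.
set E := expR (- _).
have hE : 1 <= expR 1 * E.
  rewrite /E -expRD -[leLHS]expR0 ler_expR.
  have -> : n%:R * n%:R^-1 ^+ 2 / 2 = n%:R^-1 / 2 :> R by field; rewrite gt_eqF.
  lra.
have hC : 1 <= (5 * n%:R ^+ 2) ^+ C / k ^+ C.
  by rewrite ler_pdivlMr ?exprn_gt0 // mul1r lerXn2r ?nnegrE ?(ltW k0) // mulr_ge0.
have -> : K * n%:R * (5 * n%:R ^+ 2) ^+ C * expR 1 * (cond_const b ys * (n%:R^-1 / s) / k ^+ C * E)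
   = cond_const b ys * (K / s) * (((5 * n%:R ^+ 2) ^+ C / k ^+ C) * (expR 1 * E)).
  by field; rewrite !gt_eqF ?exprn_gt0.
rewrite ler_peMr //.
  by rewrite mulr_ge0 ?(ltW (cond_const_gt0 _ _)) // divr_ge0 ?(ltW s0) // ltW // gauss_bound_gt0.
by rewrite -[leLHS]mulr1 ler_pM.
Qed.

Lemma cond_near (al eps : R) : 0 < eps ->
  (\int[leb]_x (phi x)%:E <=
   (near_cost al eps)^-1%:E * \int[leb]_(x in [set x | (`|s * x - al| < eps)%R]) (phi x)%:E)%E.
Proof.
move=> e0; have nc0 := near_cost_gt0 al e0.
have := int_cond_ub n0 b0 bC (lexx 0).
rewrite (_ : [set x | _] = setT); last by apply/seteqP; split => x //= _.
rewrite expr0n /= mulr0 mul0r oppr0 expR0 mulr1 => hU.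
apply: le_trans hU _.
apply: le_trans (lee_wpmul2l _ (int_cond_lb n0 b0 bC szn al e0)); last first.
  by rewrite lee_fin invr_ge0 ltW.
rewrite -EFinM lee_fin /near_cost; set k := 1 + _; set E := expR _.
have k1 : 1 <= k.
  by rewrite lerDl divr_ge0 ?(ltW e0) // mulr_ge0 ?mulr_ge0 ?addr_ge0 // ltW.
have k0 : 0 < k by exact: lt_le_trans k1.
have E0 : 0 < E by exact: expR_gt0.
rewrite le_eqVlt; apply/orP; left; apply/eqP; field.
by rewrite !gt_eqF ?exprn_gt0 ?gauss_bound_gt0.
Qed.

End cond_ratios.

Section factor.
Context {R : realType}.
Variables (n : nat) (b Z : R).
Hypotheses (b0 : 0 < b) (Z0 : 0 <= Z).
Local Notation s := (Num.sqrt b).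

Lemma beta_density_upd (i : 'I_n) y : exists2 c : R, 0 <= c &
  forall x, beta_ensemble_density Z b (upd i x y) =
    c * cond_density n b [seq tnth y j | j <- enum 'I_n & j != i] x.
Proof.
pose c1 := \prod_(p < n | p != i) \prod_(q < n | (p < q)%N && (q != i)) `|tnth y p - tnth y q| `^ b.
pose c2 := \sum_(k < n | k != i) (n%:R * b * tnth y k ^+ 2) / 2.
exists (Z * c1 * expR (- c2)).
  rewrite mulr_ge0 ?expR_ge0 // mulr_ge0 //.
  by apply: prodr_ge0 => p _; apply: prodr_ge0 => q _; exact: powR_ge0.
move=> x; rewrite /beta_ensemble_density /cond_density.
have sE : \sum_(k < n) (n%:R * b * tnth (upd i x y) k ^+ 2) / 2 = n%:R * (s * x) ^+ 2 / 2 + c2.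
  rewrite (bigD1 i) //= tnth_upd eqxx; congr (_ + _).
    by rewrite exprMn sqr_sqrtr ?(ltW b0) //; ring.
  by apply: eq_bigr => k ki; rewrite tnth_upd (negbTE ki).
have sE' : (\sum_(k < n) (n%:R * b * tnth (upd i x y) k ^+ 2)) / 2 = n%:R * (s * x) ^+ 2 / 2 + c2.
  by rewrite mulr_suml.
have -> : expR (- \sum_(k < n) (n%:R * b * tnth (upd i x y) k ^+ 2) / 2) =
   expR (- (n%:R * (s * x) ^+ 2 / 2)) * expR (- c2).
  by rewrite sE opprD expRD.
have -> : \prod_(p < n) \prod_(q < n | (p < q)%N) `|tnth (upd i x y) p - tnth (upd i x y) q| `^ b
   = c1 * \prod_(j <- [seq tnth y j | j <- enum 'I_n & j != i]) `|x - j| `^ b.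
  rewrite big_map big_filter big_enum_cond /=.
  rewrite (bigD1 i) //=.
  have -> : \prod_(j < n | j != i) `|x - tnth y j| `^ b =
     (\prod_(j < n | (i < j)%N) `|x - tnth y j| `^ b) * (\prod_(j < n | j != i) (if (j < i)%N then `|x - tnth y j| `^ b else 1)).
    rewrite [X in X * _]big_mkcond [X in X * _](bigD1 i) //= ltnn mul1r -big_split /=.
    apply: eq_bigr => j; rewrite -val_eqE /=; case: ltngtP => //; by rewrite ?mul1r ?mulr1.
  rewrite mulrCA; congr (_ * _).
    apply: eq_bigr => q iq; rewrite !tnth_upd eqxx ifF //.
    by apply: contraTF iq => /eqP ->; rewrite ltnn.
  rewrite -big_split /=; apply: eq_bigr => p pi; case: ifPn => [lpi|]; last first.
    rewrite -leqNgt leq_eqVlt => /orP[/eqP/val_inj E|ip]; first by rewrite E eqxx in pi.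
    rewrite mulr1; apply: eq_big => q.
      by case: eqP => [->|]; rewrite ?andbT // andbF; apply/negbTE; rewrite -leqNgt ltnW.
    move=> pq; rewrite !tnth_upd (negbTE pi) ifF //.
    by apply: contraTF (ltn_trans ip pq) => /eqP ->; rewrite ltnn.
  rewrite (bigD1 i) //= mulrC !tnth_upd (negbTE pi) eqxx distrC; congr (_ * _).
  by apply: eq_bigr => q /andP[_ qi]; rewrite !tnth_upd (negbTE qi).
ring.
Qed.

Lemma size_others (i : 'I_n) (y : n.-tuple R) :
  size [seq tnth y j | j <- enum 'I_n & j != i] = n.-1.
Proof.
rewrite size_map size_filter.
have := count_predC (pred1 i) (enum 'I_n).
rewrite count_uniq_mem ?enum_uniq // mem_enum inE /= add1n size_enum_ord => h.
move/(congr1 predn): h => /= <-.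
by apply: eq_count.
Qed.

End factor.

Section tuple_events.
Context {R : realType}.

Lemma measurable_coord n (i : 'I_n) (D : set R) : measurable D ->
  measurable [set y : n.-tuple R | D (tnth y i)].
Proof. by move=> mD; rewrite -[X in measurable X]setTI; exact: measurable_tnth. Qed.

Lemma measurable_all n (S : seq 'I_n) (D : 'I_n -> set R) :
  (forall i, measurable (D i)) ->
  measurable [set y : n.-tuple R | forall i, i \in S -> D i (tnth y i)].
Proof.
move=> mD; elim: S => [|i S ih].
  by rewrite (_ : [set _ | _] = setT) //; apply/seteqP; split => // y _ i.
rewrite (_ : [set _ | _] = [set y : n.-tuple R | D i (tnth y i)] `&`
   [set y : n.-tuple R | forall i, i \in S -> D i (tnth y i)]).
  by apply: measurableI => //; exact: measurable_coord.
apply/seteqP; split => [y h|y [h1 h2] j].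
  by split=> [|j jS]; apply: h; rewrite inE ?eqxx ?jS ?orbT.
by rewrite inE => /predU1P[->//|]; exact: h2.
Qed.

End tuple_events.

Section positions.
Context {R : realType}.
Local Notation leb := (@lebesgue_measure R).
Variables (n C : nat) (b Z : R).
Hypotheses (n0 : (0 < n)%N) (b0 : 0 < b) (Z0 : 0 <= Z) (bC : n%:R * b <= C%:R).
Local Notation s := (Num.sqrt b).
Local Notation rho := (beta_ensemble_density Z b (n := n)).

Lemma beta_density_ge0 y : 0 <= rho y.
Proof.
rewrite /beta_ensemble_density mulr_ge0 ?expR_ge0 // mulr_ge0 //.
by apply: prodr_ge0 => i _; apply: prodr_ge0 => j _; exact: powR_ge0.
Qed.

Lemma measurable_beta_density : measurable_fun setT rho.
Proof.
apply: measurable_funM.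
  apply: measurable_funM => //; apply: measurable_prod => i _ /=.
  under eq_fun do rewrite big_mkcond.
  apply: measurable_prod => j _ /=; case: (i < j)%N => //.
  apply: (measurableT_comp (measurable_powR _)).
  apply: (measurableT_comp (@normr_measurable R _)).
  by apply: measurable_funB; exact: measurable_tnth.
apply: (measurableT_comp (@measurable_expR R)); apply: measurableT_comp => //.
apply: measurable_sum => i.
apply: measurable_funM => //; apply: measurable_funM => //; apply: measurable_funX.
exact: measurable_tnth.
Qed.

Let sz (i : 'I_n) (y : n.-tuple R) : (size [seq tnth y j | j <- enum 'I_n & j != i] < n)%N.
Proof. by rewrite size_others prednK. Qed.

Let szC (i : 'I_n) (y : n.-tuple R) : (size [seq tnth y j | j <- enum 'I_n & j != i])%:R * b <= C%:R.
Proof. by apply: le_trans bC; rewrite ler_wpM2r ?(ltW b0) // ler_nat ltnW. Qed.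

Lemma beta_resample (i : 'I_n) (A B : set (n.-tuple R)) (D E : set R) (q : R) :
  measurable A -> measurable B -> 0 <= q -> measurable D -> measurable E ->
  (forall ys : seq R, (size ys < n)%N -> (size ys)%:R * b <= C%:R ->
    (\int[leb]_(x in D) (cond_density n b ys x)%:E <=
     q%:E * \int[leb]_(x in E) (cond_density n b ys x)%:E)%E) ->
  (forall y, ([set x | A (upd i x y)] = D /\ [set x | B (upd i x y)] = E) \/
             [set x | A (upd i x y)] = set0) ->
  (\int[lebesgue_tuple R n]_(y in A) (rho y)%:E <=
     q%:E * \int[lebesgue_tuple R n]_(y in B) (rho y)%:E)%E.
Proof.
move=> mA mB q0 mD mE h AB.
apply: (fiber_set_le (i := i)) => //; [exact: measurable_beta_density|exact: beta_density_ge0|].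
move=> y; case: (AB y) => [[-> ->]|->]; last first.
  rewrite integral_set0 mule_ge0 //; apply: integral_ge0 => x _.
  by rewrite lee_fin beta_density_ge0.
have [c c0 cE] := beta_density_upd b0 Z0 i y.
under eq_integral do rewrite cE EFinM.
under [X in (_ <= _ * X)%E]eq_integral do rewrite cE EFinM.
have mc ys F : measurable F -> measurable_fun F (fun x => (cond_density n b ys x)%:E).
  by move=> mF; apply: measurable_funTS; apply/measurable_EFinP; exact: measurable_cond_density.
rewrite !ge0_integralZl_EFin //; try (by move=> x _; rewrite lee_fin cond_density_ge0);
  try exact: mc.
by rewrite muleCA; apply: lee_wpmul2l => //; apply: h.
Qed.

Lemma positions_far (S : seq 'I_n) (r : 'I_n -> R) : uniq S -> (forall i, 0 <= r i) ->
  (\int[lebesgue_tuple R n]_(y in [set y | forall i, i \in S -> (r i <= `|s * tnth y i|)%R]) (rho y)%:E <=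
   (\prod_(i <- S) (far_cost n C * expR (- (n.-1%:R * r i ^+ 2 / 2))))%:E *
     \int[lebesgue_tuple R n]_y (rho y)%:E)%E.
Proof.
move=> + r0; elim: S => [_|i S ih /= /andP[iS uS]].
  rewrite big_nil mul1e (_ : [set _ | _] = setT) //.
  by apply/seteqP; split => // y _ i; rewrite in_nil.
rewrite big_cons EFinM -muleA.
have mS (T : seq 'I_n) : measurable [set y : n.-tuple R | forall i, i \in T -> (r i <= `|s * tnth y i|)%R].
  by apply: (@measurable_all R n T (fun j => [set x : R | r j <= `|s * x|])) => j; exact: measurable_far.
have q0 : 0 <= far_cost n C * expR (- (n.-1%:R * r i ^+ 2 / 2)).
  by rewrite mulr_ge0 ?expR_ge0 // far_cost_ge0.
apply: le_trans (lee_wpmul2l _ (ih uS)); last by rewrite lee_fin.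
apply: (beta_resample (i := i) (D := [set x | r i <= `|s * x|]) (E := setT)) => //.
- exact: measurable_far.
- by move=> ys szys bys; exact: (cond_far n0 b0 bys szys).
move=> y; have [h|h] := pselect (forall j, j \in S -> r j <= `|s * tnth y j|); [left|right].
  have hx x j : j \in S -> r j <= `|s * tnth (upd i x y) j|.
    move=> jS; rewrite tnth_upd ifF ?h //.
    by apply: contraNF iS => /eqP <-.
  split; apply/seteqP; split => x //=; last by move=> _ j /hx.
    by move=> /(_ i); rewrite inE eqxx tnth_upd eqxx; exact.
  move=> rx j; rewrite inE => /predU1P[->|/hx //]; by rewrite tnth_upd eqxx.
apply/seteqP; split => x //= hx; apply: h => j jS.
have := hx j; rewrite inE jS orbT => /(_ isT); rewrite tnth_upd ifF //.
by apply: contraNF iS => /eqP <-.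
Qed.

Lemma positions_near (S : seq 'I_n) (al : 'I_n -> R) (eps : R) : uniq S -> 0 < eps ->
  (\int[lebesgue_tuple R n]_y (rho y)%:E <=
   (\prod_(i <- S) (near_cost n C (al i) eps)^-1)%:E *
  \int[lebesgue_tuple R n]_(y in [set y | forall i, i \in S -> (`|s * tnth y i - al i| < eps)%R]) (rho y)%:E)%E.
Proof.
move=> + e0; elim: S => [_|i S ih /= /andP[iS uS]].
  rewrite big_nil mul1e (_ : [set _ | _] = setT) //.
  by apply/seteqP; split => // y _ i; rewrite in_nil.
rewrite big_cons mulrC EFinM -muleA.
have mS (T : seq 'I_n) : measurable [set y : n.-tuple R | forall i, i \in T -> (`|s * tnth y i - al i| < eps)%R].
  by apply: (@measurable_all R n T (fun j => [set x : R | `|s * x - al j| < eps])) => j; exact: measurable_near.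
have q0 : 0 <= (near_cost n C (al i) eps)^-1.
  by rewrite invr_ge0 ltW // near_cost_gt0.
apply: le_trans (ih uS) _; apply: lee_wpmul2l.
  by rewrite lee_fin prodr_ge0 // => j _; rewrite invr_ge0 ltW // near_cost_gt0.
apply: (beta_resample (i := i) (D := setT) (E := [set x | `|s * x - al i| < eps])) => //.
- exact: measurable_near.
- by move=> ys szys bys; exact: (cond_near n0 b0 bys szys).
move=> y; have [h|h] := pselect (forall j, j \in S -> `|s * tnth y j - al j| < eps); [left|right].
  have hx x j : j \in S -> `|s * tnth (upd i x y) j - al j| < eps.
    move=> jS; rewrite tnth_upd ifF ?h //.
    by apply: contraNF iS => /eqP <-.
  split; apply/seteqP; split => x //=; first by move=> _ j /hx.
    by move=> /(_ i); rewrite inE eqxx tnth_upd eqxx; exact.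
  move=> rx j; rewrite inE => /predU1P[->|/hx //]; by rewrite tnth_upd eqxx.
apply/seteqP; split => x //= hx; apply: h => j jS.
have := hx j jS; rewrite tnth_upd ifF //.
by apply: contraNF iS => /eqP <-.
Qed.

End positions.

Section reflection.
Context {R : realType}.
Local Notation leb := (@lebesgue_measure R).

Lemma measurable_reflect (s : R) : measurable_fun setT (fun x : R => s - x).
Proof. exact: measurable_funB. Qed.

Lemma lebesgue_reflect (s : R) (A : set R) : measurable A ->
  pushforward leb ((fun x => s - x) : _ -> measurableTypeR R) A = leb A.
Proof.
move=> mA; pose mB := isMeasurableFun.Build _ _ (measurableTypeR R) (measurableTypeR R) _ (measurable_reflect s).
pose f : {mfun measurableTypeR R >-> measurableTypeR R} := HB.pack (fun x : R => s - x) mB.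
apply/esym; apply: (@lebesgue_measure_unique R (pushforward leb f)) => //= _ [[u v]] _ <-.
rewrite /pushforward /= (_ : _ @^-1` _ = `[s - v, s - u[%classic).
  rewrite !lebesgue_measure_itv /= !lte_fin ltrD2l ltrN2.
  by case: ifP => // _; rewrite -!EFinB; congr EFin; ring.
by apply/seteqP; split => x /=; rewrite !in_itv /= => /andP[? ?]; apply/andP; split; lra.
Qed.

Lemma integral_reflect (s : R) (f : R -> \bar R) : measurable_fun setT f ->
  (forall x, 0 <= f x)%E -> (\int[leb]_x f (s - x)%R = \int[leb]_x f x)%E.
Proof.
move=> mf f0.
have h := @ge0_integral_pushforward _ _ (measurableTypeR R) (measurableTypeR R) R _
  (measurable_reflect s) leb setT f measurableT mf (fun x _ => f0 x).
rewrite preimage_setT in h; rewrite -[LHS]h.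
by apply: eq_measure_integral => [|mr A mA _]; [exact: measurable_reflect|exact: lebesgue_reflect].
Qed.

End reflection.

Section beta_kernel.
Context {R : realType}.
Local Notation leb := (@lebesgue_measure R).
Variable a : R.
Hypotheses (a0 : 0 < a) (a1 : a < 1).

Lemma measurable_pow (D : set R) : measurable_fun D (fun x : R => (x `^ (a - 1))%:E).
Proof.
by apply: measurable_funTS; apply/measurable_EFinP; exact: measurable_powR.
Qed.

Lemma integral_pow_cc (e h : R) : 0 < e -> e < h ->
  (\int[leb]_(x in `[e, h]) (x `^ (a - 1))%:E = ((h `^ a - e `^ a) / a)%:E)%E.
Proof.
move=> e0 eh.
have ed x : e <= x -> is_derive x 1 (fun x : R => x `^ a) (a * x `^ (a - 1)).
  by move=> ex; apply: is_derive1_powR; exact: lt_le_trans ex.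
have cont (c x : R) : e <= x -> {for x, continuous (fun x : R => x `^ c)}.
  move=> ex; apply: differentiable_continuous; apply/derivable1_diffP.
  by apply: derivable_powR; rewrite in_itv /= andbT (lt_le_trans e0).
have E : (\int[leb]_(x in `[e, h]) (a * x `^ (a - 1))%:E = (h `^ a)%:E - (e `^ a)%:E)%E.
  apply: (@continuous_FTC2 R (fun x => a * x `^ (a - 1)) (fun x => x `^ a) e h) => //.
  - apply: continuous_in_subspaceT => x; rewrite inE /= in_itv /= => /andP[ex _].
    by apply: cvgM; [exact: cvg_cst|exact: cont].
  - split.
    + move=> x; rewrite in_itv /= => /andP[ex _].
      by apply: derivable_powR; rewrite in_itv /= andbT (lt_trans e0).
    + by apply: cvg_at_right_filter; apply: cont; exact: lexx.
    + by apply: cvg_at_left_filter; apply: cont; exact: ltW.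
  - move=> x; rewrite in_itv /= => /andP[ex _].
    by rewrite powR_derive1 // in_itv /= andbT (lt_trans e0).
have F : (\int[leb]_(x in `[e, h]) (a * x `^ (a - 1))%:E =
    a%:E * \int[leb]_(x in `[e, h]) (x `^ (a - 1))%:E)%E.
  under eq_integral do rewrite EFinM.
  rewrite ge0_integralZl_EFin ?(ltW a0) //; last exact: measurable_pow.
  by move=> x _; rewrite lee_fin powR_ge0.
rewrite F in E.
have : (a^-1%:E * (a%:E * \int[leb]_(x in `[e, h]) (x `^ (a - 1))%:E) =
   a^-1%:E * ((h `^ a)%:E - (e `^ a)%:E))%E by rewrite E.
by rewrite muleA -EFinM mulVf ?gt_eqF // mul1e => ->; rewrite -EFinB -EFinM mulrC.
Qed.

Lemma integral_pow_oc (h : R) : 0 < h ->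
  (\int[leb]_(x in `]0%R, h]) (x `^ (a - 1))%:E = (h `^ a / a)%:E)%E.
Proof.
move=> h0; pose e n : R := h * n.+2%:R^-1.
have e0 n : 0 < e n by rewrite mulr_gt0 // invr_gt0.
have eh n : e n < h by rewrite -[ltRHS]mulr1 ltr_pM2l // invf_lt1 // ltr1n.
have -> : `]0, h]%classic = \bigcup_n `[e n, h]%classic.
  apply/seteqP; split => [x|x [n _]] /=; rewrite !in_itv /= => /andP[x0 xh]; last first.
    by rewrite (lt_le_trans (e0 n)).
  have [n hn] : exists n : nat, h / x < n%:R.
    by exists (Num.truncn (h / x)).+1; apply: truncnS_gt.
  exists n => //; rewrite /= in_itv /= xh andbT /e ler_pdivrMr // -ler_pdivrMl // mulrC ltW //; apply: lt_le_trans hn _; rewrite ler_nat; lia.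
have c1 : (\int[leb]_(x in `[e n, h]) (x `^ (a - 1))%:E @[n --> \oo] -->
    \int[leb]_(x in \bigcup_n `[e n, h]%classic) (x `^ (a - 1))%:E)%E.
  apply: ge0_nondecreasing_set_cvg_integral => //.
  - move=> m n mn; apply/subsetPset => x /=; rewrite !in_itv /= => /andP[ex ->]; rewrite andbT.
    by apply: le_trans ex; rewrite ler_pM2l // lef_pV2 ?posrE // ler_nat !ltnS.
  - by move=> n; exact: measurable_pow.
  - by move=> n x _; rewrite lee_fin powR_ge0.
have c2 : (\int[leb]_(x in `[e n, h]) (x `^ (a - 1))%:E @[n --> \oo] --> (h `^ a / a)%:E)%E.
  under eq_fun do rewrite integral_pow_cc //.
  apply: cvg_EFin; first by near=> n.
  apply: cvgMl; rewrite -[X in _ --> X]subr0; apply: cvgB; first exact: cvg_cst.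
  have h2 : x `^ a @[x --> 0^'+] --> (0 : R) by exact: powR_cvg0.
  move/cvg_at_rightP : h2 => /(_ e); apply; split => //.
  rewrite -[X in _ --> X](mulr0 h); apply: cvgMr.
  by have := @cvg_harmonic R; rewrite -(@cvg_shiftS _ (@harmonic R)).
exact: (cvg_unique _ c1 c2).
Unshelve. all: by end_near. Qed.

End beta_kernel.

Section beta_kernel2.
Context {R : realType}.
Local Notation leb := (@lebesgue_measure R).
Variable a : R.
Hypotheses (a0 : 0 < a) (a1 : a < 1).

Definition kernel2 (s x : R) : R := (x * (s - x)) `^ (a - 1).

Lemma kernel2_ge0 s x : 0 <= kernel2 s x. Proof. exact: powR_ge0. Qed.

Lemma powR_ge0E (x c : R) : (0%R%:E <= (x `^ c)%:E)%E.
Proof. by rewrite lee_fin powR_ge0. Qed.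
Local Hint Resolve powR_ge0E : core.

Lemma kernel2_ge0E s x : (0%R%:E <= (kernel2 s x)%:E)%E.
Proof. by rewrite lee_fin kernel2_ge0. Qed.
Local Hint Resolve kernel2_ge0E : core.

Lemma measurable_kernel2 s (D : set R) : measurable_fun D (fun x : R => (kernel2 s x)%:E).
Proof.
apply: measurable_funTS; apply/measurable_EFinP.
apply: (measurableT_comp (measurable_powR _)).
by apply: measurable_funM => //; exact: measurable_funB.
Qed.

Lemma powRB1_ge1 (y : R) : 0 < y <= 1 -> 1 <= y `^ (a - 1).
Proof.
move=> y01; rewrite -[leLHS](powRr0 y); apply: ger_powR => //. rewrite subr_le0. exact: (ltW a1).
Qed.

Lemma powRB1_le_inv (y : R) : 0 < y <= 1 -> y `^ (a - 1) <= y^-1.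
Proof.
move=> /andP[y0 y1]; rewrite -powR_inv1 ?(ltW y0) //. apply: ger_powR; rewrite ?y0 //.
by rewrite lerBrDr addNr ltW.
Qed.

Lemma powRB1_anti (x y : R) : 0 < x -> x <= y -> y `^ (a - 1) <= x `^ (a - 1).
Proof.
move=> x0 xy; have y0 : 0 < y by exact: lt_le_trans xy.
have -> : a - 1 = - (1 - a) by ring.
rewrite !powRN lef_pV2 ?posrE ?powR_gt0 //.
by rewrite ge0_ler_powR ?nnegrE ?(ltW x0) ?(ltW y0) // subr_ge0 ltW.
Qed.

Lemma kernel2E s x : 0 < x < s -> kernel2 s x = x `^ (a - 1) * (s - x) `^ (a - 1).
Proof. by move=> /andP[x0 xs]; rewrite /kernel2 powRM // ?subr_ge0 ltW. Qed.

Lemma integral_pow_refl_le (s : R) : 0 < s ->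
  (\int[leb]_(x in `]0%R, s[) ((s - x) `^ (a - 1))%:E <= (s `^ a / a)%:E)%E.
Proof.
move=> s0; rewrite -integral_pow_oc //.
have E : (\int[leb]_(x in `]0%R, s[) ((s - x) `^ (a - 1))%:E =
          \int[leb]_(x in `]0%R, s[) (x `^ (a - 1))%:E)%E.
  rewrite integral_mkcond [RHS]integral_mkcond.
  rewrite -(@integral_reflect _ s ((fun x : R => (x `^ (a - 1))%:E) \_ `]0, s[)); last 2 first.
  - by apply/(measurable_restrictT _ (measurable_itv _)); exact: measurable_pow.
  - by move=> x; apply: erestrict_ge0 => z _; rewrite lee_fin powR_ge0.
  apply: eq_integral => x _; rewrite !patchE.
  suff -> : ((s - x) \in `]0, s[%classic) = (x \in `]0, s[%classic) by [].
  by apply/idP/idP; rewrite !inE /= !in_itv /= => /andP[? ?]; apply/andP; split; lra.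
rewrite E; apply: ge0_subset_integral => //.
- exact: measurable_pow.
- by apply: subset_itvl; rewrite bnd_simp.
Qed.

Lemma kernel2_total (s : R) : 0 < s -> s <= 1 ->
  (\int[leb]_(x in `]0%R, s[) (kernel2 s x)%:E <= (4 / (s * a))%:E)%E.
Proof.
move=> s0 s1.
have mp D : measurable_fun D (fun x : R => (x `^ (a - 1))%:E) by exact: measurable_pow.
have mr : measurable_fun `]0, s[ (fun x : R => ((s - x) `^ (a - 1))%:E).
  apply: measurable_funTS; apply/measurable_EFinP.
  by apply: (measurableT_comp (measurable_powR _)); exact: measurable_funB.
have c0 : 0 <= (s / 2) `^ (a - 1) by exact: powR_ge0.
apply: (@le_trans _ _ (\int[leb]_(x in `]0%R, s[)
   (((s / 2) `^ (a - 1))%:E * ((x `^ (a - 1))%:E + ((s - x) `^ (a - 1))%:E)))%E).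
  apply: ge0_le_integral => //.
  - exact: measurable_kernel2.
  - by apply: measurable_funeM; apply: emeasurable_funD => //; apply: mp.
  move=> x; rewrite /= in_itv /= => /andP[x0 xs].
  rewrite -EFinD -EFinM lee_fin kernel2E ?x0 // mulrDr.
  have sx0 : 0 < s - x by rewrite subr_gt0.
  have [xh|xh] := leP x (s / 2).
    rewrite -[leLHS]addr0 lerD //; last by rewrite mulr_ge0 ?powR_ge0.
    by rewrite mulrC ler_wpM2r ?powR_ge0 // powRB1_anti //; lra.
  rewrite -[leLHS]add0r lerD //; first by rewrite mulr_ge0 ?powR_ge0.
  by rewrite ler_wpM2r ?powR_ge0 // powRB1_anti //; lra.
have msum : measurable_fun `]0, s[ (fun x : R => ((x `^ (a - 1))%:E + ((s - x) `^ (a - 1))%:E)%E).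
  by apply: emeasurable_funD => //; exact: mp.
rewrite ge0_integralZl_EFin //; last by move=> x _; rewrite adde_ge0.
rewrite ge0_integralD //; last exact: mp.
have h1 : (\int[leb]_(x in `]0%R, s[) (x `^ (a - 1))%:E <= (s `^ a / a)%:E)%E.
  rewrite -integral_pow_oc //; apply: ge0_subset_integral => //.
    exact: mp.
  by apply: subset_itvl; rewrite bnd_simp.
apply: le_trans (lee_wpmul2l _ (leeD h1 (integral_pow_refl_le s0))) _ => //.
rewrite -EFinD -EFinM lee_fin.
have sa : s `^ a <= 1 by rewrite -(powRr0 s); apply: ger_powR; rewrite ?s0 // ltW.
have sh : (s / 2) `^ (a - 1) <= (s / 2)^-1 by apply: powRB1_le_inv; apply/andP; split; lra.
apply: (@le_trans _ _ ((s / 2)^-1 * (1 / a + 1 / a))).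
  rewrite ler_pM // ?addr_ge0 ?divr_ge0 ?powR_ge0 ?(ltW a0) //.
  by rewrite lerD // ler_wpM2r // invr_ge0 ltW.
by rewrite le_eqVlt; apply/orP; left; apply/eqP; field; rewrite !gt_eqF.
Qed.

Lemma kernel2_two (s dl : R) : 0 < dl -> s <= 1 ->
  (\int[leb]_(x in `]dl, (s - dl)%R[) (kernel2 s x)%:E <=
   (a / dl ^+ 3)%:E * \int[leb]_(x in `]0%R, (s - dl)%R[) (kernel2 s x)%:E)%E.
Proof.
move=> d0 s1.
have I0 : (0 <= \int[leb]_(x in `]0%R, (s - dl)%R[) (kernel2 s x)%:E)%E.
  by apply: integral_ge0 => x _; rewrite lee_fin kernel2_ge0.
have q0 : 0 <= a / dl ^+ 3 by rewrite divr_ge0 ?exprn_ge0 ?ltW.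
have [sd|sd] := leP (s - dl) dl.
  rewrite set_itv_ge ?integral_set0 ?mule_ge0 //.
  by rewrite bnd_simp -leNgt.
have dl1 : dl <= 1 by lra.
have lb : ((dl / a)%:E <= \int[leb]_(x in `]0%R, (s - dl)%R[) (kernel2 s x)%:E)%E.
  apply: (@le_trans _ _ (\int[leb]_(x in `]0%R, dl]) (x `^ (a - 1))%:E)%E).
    rewrite integral_pow_oc // lee_fin ler_wpM2r ?invr_ge0 ?(ltW a0) //.
    by apply: ger1_powR; rewrite ?d0 // ltW.
  apply: (@le_trans _ _ (\int[leb]_(x in `]0%R, dl]) (kernel2 s x)%:E)%E).
    apply: ge0_le_integral => //; [exact: measurable_pow|exact: measurable_kernel2|].
    move=> x; rewrite /= in_itv /= => /andP[x0 xd]; rewrite lee_fin kernel2E; last first.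
      by apply/andP; split; lra.
    by rewrite ler_peMr ?powR_ge0 // powRB1_ge1 //; apply/andP; split; lra.
  apply: ge0_subset_integral => //; first exact: measurable_kernel2.
  by apply: subset_itvl; rewrite bnd_simp.
apply: le_trans (lee_wpmul2l _ lb); last by rewrite lee_fin.
apply: (@le_trans _ _ (\int[leb]_(x in `]dl, (s - dl)%R[) ((dl ^+ 2)^-1)%:E)%E).
  apply: ge0_le_integral => //; first exact: measurable_kernel2.
  move=> x; rewrite /= in_itv /= => /andP[x0 xd]; rewrite lee_fin /kernel2.
  have h : dl ^+ 2 <= x * (s - x) by rewrite expr2 ler_pM ?(ltW d0) //; lra.
  have h0 : 0 < x * (s - x) by rewrite mulr_gt0 //; lra.
  apply: le_trans (powRB1_le_inv _) _.
    by rewrite h0 /= -[leRHS]mulr1 ler_pM //; lra.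
  by rewrite lef_pV2 // posrE exprn_gt0.
rewrite integral_cst //= lebesgue_measure_itv /= lte_fin sd -EFinB -!EFinM lee_fin.
have -> : a / dl ^+ 3 * (dl / a) = (dl ^+ 2)^-1 * 1 by field; rewrite !gt_eqF.
by rewrite ler_wpM2l ?invr_ge0 ?exprn_ge0 ?(ltW d0) //; lra.
Qed.

Lemma kernel2_split (s p eps : R) : 0 < eps -> eps <= p -> p < s -> s <= 1 ->
  (\int[leb]_(x in `]0%R, s[) (kernel2 s x)%:E <=
   (4 / (s * a * eps))%:E * \int[leb]_(x in `](p - eps)%R, p[) (kernel2 s x)%:E)%E.
Proof.
move=> e0 ep ps s1; have s0 : 0 < s by lra.
have lb : (eps%:E <= \int[leb]_(x in `](p - eps)%R, p[) (kernel2 s x)%:E)%E.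
  apply: (@le_trans _ _ (\int[leb]_(x in `](p - eps)%R, p[) 1%:E)%E).
    rewrite integral_cst //= lebesgue_measure_itv /= lte_fin ifT; last by lra.
    by rewrite -EFinB mul1e lee_fin; lra.
  apply: ge0_le_integral => //; first exact: measurable_kernel2.
  move=> x; rewrite /= in_itv /= => /andP[x0 xp]; rewrite lee_fin.
  have h0 : 0 < x * (s - x) by rewrite mulr_gt0 //; lra.
  by apply: powRB1_ge1; rewrite h0 /= -[leRHS]mulr1 ler_pM //; lra.
apply: le_trans (kernel2_total s0 s1) _.
apply: le_trans (lee_wpmul2l _ lb); last first.
  by rewrite lee_fin divr_ge0 // !mulr_ge0 // ltW.
by rewrite -EFinM lee_fin le_eqVlt; apply/orP; left; apply/eqP; field; rewrite !gt_eqF.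
Qed.

Lemma kernel2_shrink (s eta : R) (D : set R) : 0 < s -> s <= 1 -> 0 < eta -> eta <= 1 ->
  measurable D -> (forall x, D x -> 0 < x <= s / 2) ->
  (forall x y, D x -> 0 < y <= x -> D y) ->
  (\int[leb]_(x in D) (kernel2 s x)%:E <=
   (eta `^ (- (2 * a)))%:E * \int[leb]_(x in D `&` [set x | (x <= eta)%R]) (kernel2 s x)%:E)%E.
Proof.
move=> s0 s1 e0 e1 mD Ds Dd.
have mE : measurable [set x : R | x <= eta] by rewrite -set_itvE; exact: measurable_itv.
have mDE : measurable (D `&` [set x | x <= eta]) by exact: measurableI.
set t := eta `^ (- a).
have t1 : 1 <= t by rewrite /t -(powRr0 eta); apply: ger_powR; rewrite ?e0 ?e1 // oppr_le0 ltW.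
have q2 : eta `^ (- (2 * a)) = t ^+ 2.
  by rewrite -powR_mulrn ?powR_ge0 // -powRrM; congr powR; ring.
have q1 : 1 <= eta `^ (- (2 * a)) by rewrite q2 exprn_ege1.
set I := (X in (_ <= _ * X)%E).
have I0 : (0 <= I)%E by apply: integral_ge0 => x _; rewrite lee_fin kernel2_ge0.
have [[x0 [Dx0 x0e]]|Dle] := pselect (exists x, D x /\ eta < x); last first.
  have -> : (\int[leb]_(x in D) (kernel2 s x)%:E = I)%E.
    rewrite /I; congr (integral _ _ _); apply/seteqP; split => x; last by case.
    move=> Dx; split => //=; rewrite leNgt; apply/negP => ex; apply: Dle; by exists x.
  by rewrite -[leLHS]mul1e lee_wpmul2r // lee_fin.
have es : eta < s / 2 by have /andP[_ ?] := Ds _ Dx0; lra.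
pose c := s `^ (a - 1) * (eta `^ a / a).
have Ilb : (c%:E <= I)%E.
  apply: (@le_trans _ _ (\int[leb]_(x in `]0%R, eta]) ((s `^ (a - 1))%:E * (x `^ (a - 1))%:E))%E).
    rewrite ge0_integralZl_EFin ?powR_ge0 //; last exact: measurable_pow.
    by rewrite integral_pow_oc // -EFinM.
  apply: (@le_trans _ _ (\int[leb]_(x in `]0%R, eta]) (kernel2 s x)%:E)%E).
    apply: ge0_le_integral => //; [by move=> x _; rewrite mule_ge0| |exact: measurable_kernel2|].
      by apply: measurable_funeM; exact: measurable_pow.
    move=> x; rewrite /= in_itv /= => /andP[x0' xe]; rewrite -EFinM lee_fin kernel2E; last first.
      by apply/andP; split; lra.
    by rewrite mulrC ler_wpM2l ?powR_ge0 // powRB1_anti //; lra.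
  apply: ge0_subset_integral => //; first exact: measurable_kernel2.
  move=> x; rewrite /= in_itv /= => /andP[x0' xe]; split => //.
  by apply: (Dd x0) => //; rewrite x0' /=; lra.
have bad : (\int[leb]_(x in D `\` [set x | (x <= eta)%R]) (kernel2 s x)%:E <= (2 * (t - 1) * c)%:E)%E.
  apply: (@le_trans _ _ (\int[leb]_(x in `[eta, (s / 2)%R]) (kernel2 s x)%:E)%E).
    apply: ge0_subset_integral => //; [exact: measurableD|exact: measurable_kernel2|].
    move=> x [/Ds /andP[x0' xs] /= /negP]; rewrite -ltNge => ex; rewrite in_itv /= xs ltW //.
  apply: (@le_trans _ _ (\int[leb]_(x in `[eta, (s / 2)%R]) (((s / 2) `^ (a - 1))%:E * (x `^ (a - 1))%:E))%E).
    apply: ge0_le_integral => //; [exact: measurable_kernel2| |].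
      by apply: measurable_funeM; exact: measurable_pow.
    move=> x; rewrite /= in_itv /= => /andP[x0' xe]; rewrite -EFinM lee_fin kernel2E; last first.
      by apply/andP; split; lra.
    by rewrite mulrC ler_wpM2r ?powR_ge0 // powRB1_anti //; lra.
  rewrite ge0_integralZl_EFin ?powR_ge0 //; last exact: measurable_pow.
  rewrite integral_pow_cc // -EFinM lee_fin.
  have h1 : (s / 2) `^ (a - 1) <= 2 * s `^ (a - 1).
    rewrite powRM ?(ltW s0) // mulrC ler_wpM2r ?powR_ge0 //.
    by apply: le_trans (powRB1_le_inv _) _; rewrite ?invrK // invr_gt0 ltr0n invf_le1 // ler1n.
  have h2 : (s / 2) `^ a <= 1.
    by rewrite -[leRHS](powRr0 (s / 2)); apply: ger_powR; [apply/andP; split; lra|exact: ltW].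
  have h3 : 0 <= (s / 2) `^ a - eta `^ a.
    by rewrite subr_ge0 ge0_ler_powR ?nnegrE ?(ltW a0) ?(ltW e0) //; lra.
  have h4 : t * eta `^ a = 1 by rewrite /t powRN mulVf // gt_eqF // powR_gt0.
  apply: (@le_trans _ _ (2 * s `^ (a - 1) * ((1 - eta `^ a) / a))).
    rewrite ler_pM ?powR_ge0 // ?divr_ge0 ?(ltW a0) //.
    by rewrite ler_wpM2r ?invr_ge0 ?(ltW a0) // lerB.
  rewrite le_eqVlt; apply/orP; left; apply/eqP.
  have -> : 2 * (t - 1) * c = 2 * s `^ (a - 1) * ((t * eta `^ a - eta `^ a) / a) by rewrite /c; ring.
  by rewrite h4.
have -> : (\int[leb]_(x in D) (kernel2 s x)%:E =
   I + \int[leb]_(x in D `\` [set x | (x <= eta)%R]) (kernel2 s x)%:E)%E.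
  rewrite /I -ge0_integral_setU //; last 3 first.
  - exact: measurableD.
  - exact: measurable_kernel2.
  - by apply/disj_setPS => x [[_ /= h] [_ /= h']].
  congr (integral _ _ _); apply/seteqP; split => [x Dx|x [[]//|[]//]].
  by have [xe|xe] := pselect (x <= eta); [left|right].
apply: (@le_trans _ _ (I + (2 * (t - 1))%:E * I)%E).
  apply: leeD => //; apply: le_trans bad _; rewrite EFinM; apply: lee_wpmul2l => //.
  by rewrite lee_fin mulr_ge0 // subr_ge0.
rewrite -[X in (X + _)%E]mul1e -ge0_muleDl //; last by rewrite lee_fin mulr_ge0 // subr_ge0.
rewrite -EFinD q2; apply: lee_wpmul2r => //; rewrite lee_fin.
by have := sqr_ge0 (t - 1); lra.
Qed.

End beta_kernel2.

Section dirichlet_fibers.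
Context {R : realType}.
Local Notation leb := (@lebesgue_measure R).
Variables (a : R) (k : nat).
Hypotheses (a0 : 0 < a) (a1 : a < 1).
Local Notation n := k.+2.

Definition trade (i : 'I_k.+1) (w : n.-tuple R) (x : R) : n.-tuple R :=
  [tuple if j == lift ord_max i then x else
         if j == ord_max then tnth w (lift ord_max i) + tnth w ord_max - x else tnth w j | j < n].

Definition open_simplex : set (n.-tuple R) :=
  [set w | (forall j, 0 < tnth w j) /\ \sum_(j < n) tnth w j = 1].

Lemma tnth_simplex_lift m (u : m.-tuple R) i : tnth (simplex_last u) (lift ord_max i) = tnth u i.
Proof.
rewrite !(tnth_nth 0) /= nth_rcons size_tuple.
have -> : bump m i = i by rewrite /bump leqNgt ltn_ord.
by rewrite ltn_ord.
Qed.

Lemma tnth_simplex_last m (u : m.-tuple R) :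
  tnth (simplex_last u) ord_max = 1 - \sum_(i < m) tnth u i.
Proof. by rewrite (tnth_nth 0) /= nth_rcons size_tuple ltnn eqxx. Qed.

Lemma measurable_simplex_last m : measurable_fun setT (@simplex_last R m).
Proof.
apply: measurable_tuple_fun => j.
case: (unliftP ord_max j) => [i ->|->].
  under eq_fun do rewrite tnth_simplex_lift.
  exact: measurable_tnth.
under eq_fun do rewrite tnth_simplex_last.
apply: measurable_funB => //; apply: measurable_sum => i; exact: measurable_tnth.
Qed.

Lemma Gamma_ge0 (b : R) : 0 <= Gamma b.
Proof. by apply: Rintegral_ge0 => x _; rewrite mulr_ge0 ?powR_ge0 ?expR_ge0. Qed.

Lemma dirichlet_density_ge0 m (u : m.-tuple R) : 0 <= dirichlet_density a u.
Proof.
rewrite /dirichlet_density; case: ifP => // _.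
by rewrite mulr_ge0 ?powR_ge0 // divr_ge0 ?exprn_ge0 // Gamma_ge0.
Qed.

Lemma measurable_dirichlet_density m : measurable_fun setT (@dirichlet_density R a m).
Proof.
have mv : measurable_fun setT (fun u : m.-tuple R => 1 - \sum_(i < m) tnth u i).
  by apply: measurable_funB => //; apply: measurable_sum => i; exact: measurable_tnth.
apply: measurable_fun_ifT.
- apply: (@measurable_fun_bool _ _ _ _ true); rewrite setTI.
  rewrite (_ : _ @^-1` _ = [set u : m.-tuple R | forall i, i \in enum 'I_m -> `]0, +oo[%classic (tnth u i)]
     `&` (fun u : m.-tuple R => 1 - \sum_(i < m) tnth u i) @^-1` `]0, +oo[%classic).
    apply: measurableI.
      exact: (@measurable_all R m (enum 'I_m) (fun _ => `]0, +oo[%classic) (fun _ => measurable_itv _)).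
    by rewrite -[X in measurable X]setTI; apply: mv => //; exact: measurable_itv.
  apply/seteqP; split => [u /andP[/forallP h hv]|u [h hv]] /=.
    by split => [i _|]; rewrite /= in_itv /= andbT.
  move: hv; rewrite /= in_itv /= andbT => ->; rewrite andbT; apply/forallP => i.
  by have := h i; rewrite mem_enum => /(_ isT); rewrite /= in_itv /= andbT.
- apply: measurable_funM => //; apply: (measurableT_comp (measurable_powR _)).
  apply: measurable_funM => //; apply: measurable_prod => i _; exact: measurable_tnth.
- exact: measurable_cst.
Qed.

Lemma dirichlet_resample (i : 'I_k.+1) (A B : set (n.-tuple R)) (q : R) :
  measurable A -> measurable B -> 0 <= q ->
  (forall w s, open_simplex w -> s = tnth w (lift ord_max i) + tnth w ord_max ->
    0 < s -> s <= 1 ->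
    (\int[leb]_(x in `]0%R, s[ `&` [set x | A (trade i w x)]) (kernel2 a s x)%:E <=
     q%:E * \int[leb]_(x in `]0%R, s[ `&` [set x | B (trade i w x)]) (kernel2 a s x)%:E)%E) ->
  (dirichlet_law a A <= q%:E * dirichlet_law a B)%E.
Proof.
move=> mA mB q0 H.
have mp (E : set (n.-tuple R)) : measurable E -> measurable (@simplex_last R k.+1 @^-1` E).
  by move=> mE; rewrite -[X in measurable X]setTI; exact: measurable_simplex_last.
apply: (fiber_set_le (i := i) (rho := @dirichlet_density R a k.+1)) => //.
- exact: measurable_dirichlet_density.
- exact: dirichlet_density_ge0.
- exact: mp.
- exact: mp.
move=> y; pose s := 1 - \sum_(j < k.+1 | j != i) tnth y j.
have sumE x : \sum_(j < k.+1) tnth (upd i x y) j = x + (1 - s).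
  rewrite (bigD1 i) //= tnth_upd eqxx; congr (_ + _).
  by rewrite /s opprB addrC subrK; apply: eq_bigr => j ji; rewrite tnth_upd (negbTE ji).
have prodE x : \prod_(j < k.+1) tnth (upd i x y) j = x * \prod_(j < k.+1 | j != i) tnth y j.
  rewrite (bigD1 i) //= tnth_upd eqxx; congr (_ * _).
  by apply: eq_bigr => j ji; rewrite tnth_upd (negbTE ji).
have [[ypos s0]|ybad] := pselect ((forall j, j != i -> 0 < tnth y j) /\ 0 < s); last first.
  have z x : dirichlet_density a (upd i x y) = 0.
    rewrite /dirichlet_density ifF //; apply/negbTE/negP => /andP[/forallP h1].
    rewrite sumE => h2; apply: ybad; split.
      by move=> j ji; have := h1 j; rewrite tnth_upd (negbTE ji).
    by have := h1 i; rewrite tnth_upd eqxx; lra.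
  rewrite [X in (X <= _)%E]integral0_eq => [|x _]; last by rewrite z.
  by rewrite mule_ge0 //; apply: integral_ge0 => x _; rewrite z.
pose c := Gamma (k.+2%:R * a) / Gamma a ^+ k.+2 * (\prod_(j < k.+1 | j != i) tnth y j) `^ (a - 1).
have P0' : 0 <= \prod_(j < k.+1 | j != i) tnth y j by apply: prodr_ge0 => j /ypos /ltW.
have c0 : 0 <= c by rewrite mulr_ge0 ?powR_ge0 // divr_ge0 ?exprn_ge0 // Gamma_ge0.
have dE x : (dirichlet_density a (upd i x y))%:E =
    ((fun x => (c * kernel2 a s x)%:E) \_ `]0, s[) x.
  rewrite patchE /dirichlet_density sumE prodE; case: ifPn => [/andP[/forallP h1 h2]|h].
    have x0 : 0 < x by have := h1 i; rewrite tnth_upd eqxx.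
    rewrite mem_set /=; last by rewrite in_itv /= x0 /=; lra.
    congr EFin; rewrite /c /kernel2 -[RHS]mulrA; congr (_ * _).
    have -> : x * (\prod_(j < k.+1 | j != i) tnth y j) * (1 - (x + (1 - s))) =
       (\prod_(j < k.+1 | j != i) tnth y j) * (x * (s - x)) by ring.
    by rewrite powRM // mulr_ge0 ?ltW //; lra.
  rewrite memNset // => /=; rewrite in_itv /= => /andP[x0 xs]; move/negP: h; apply.
  apply/andP; split; last by lra.
  by apply/forallP => j; rewrite tnth_upd; case: eqP => // /eqP /ypos.
pose w := simplex_last (upd i (s / 2) y).
have wpos j : 0 < tnth w j.
  case: (unliftP ord_max j) => [l ->|->].
    by rewrite tnth_simplex_lift tnth_upd; case: eqP => [_|/eqP /ypos //]; lra.
  by rewrite tnth_simplex_last sumE; lra.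
have wsum : \sum_(j < n) tnth w j = 1.
  rewrite (bigD1_ord ord_max) //= tnth_simplex_last.
  by under eq_bigr do rewrite tnth_simplex_lift; rewrite subrK.
have sE : s = tnth w (lift ord_max i) + tnth w ord_max.
  by rewrite tnth_simplex_lift tnth_simplex_last sumE tnth_upd eqxx; lra.
have s1 : s <= 1.
  by rewrite /s lerBlDr lerDl; apply: sumr_ge0 => j /ypos /ltW.
have tE x : simplex_last (upd i x y) = trade i w x.
  apply: eq_from_tnth => j; rewrite tnth_mktuple -sE.
  case: (unliftP ord_max j) => [l ->|->]; last first.
    by rewrite tnth_simplex_last sumE (negbTE (neq_lift _ _)) eqxx; ring.
  rewrite tnth_simplex_lift tnth_upd (inj_eq lift_inj) [lift _ _ == ord_max]eq_sym (negbTE (neq_lift _ _)).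
  by case: eqP => // /eqP li; rewrite tnth_simplex_lift tnth_upd (negbTE li).
have F (E : set (n.-tuple R)) : measurable E ->
  (\int[leb]_(x in [set x | ((@simplex_last R k.+1) @^-1` E) (upd i x y)]) (dirichlet_density a (upd i x y))%:E =
   c%:E * \int[leb]_(x in `]0%R, s[ `&` [set x | E (trade i w x)]) (kernel2 a s x)%:E)%E.
  move=> mE; under eq_integral do rewrite dE.
  rewrite -integral_mkcondr setIC.
  have -> : [set x | ((@simplex_last R k.+1) @^-1` E) (upd i x y)] = [set x | E (trade i w x)].
    by apply/seteqP; split => x /=; rewrite tE.
  under eq_integral do rewrite EFinM.
  rewrite ge0_integralZl_EFin //.
  - apply: measurableI; first exact: measurable_itv.
    rewrite (_ : [set x | _] = [set x | ((@simplex_last R k.+1) @^-1` E) (upd i x y)]); last first.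
      by apply/seteqP; split => x /=; rewrite tE.
    by apply: measurable_fiber; exact: mp.
  - by move=> x _; rewrite lee_fin kernel2_ge0.
  - exact: measurable_kernel2.
rewrite !F // muleCA; apply: lee_wpmul2l => //.
by apply: H.
Qed.

End dirichlet_fibers.

Section dirichlet_events.
Context {R : realType}.
Local Notation leb := (@lebesgue_measure R).
Variables (a : R) (k : nat).
Hypotheses (a0 : 0 < a) (a1 : a < 1).
Local Notation n := k.+2.
Variable D : probability (n.-tuple R) R.
Hypothesis DE : forall A, measurable A -> D A = dirichlet_law a A.

Lemma trade_lift (i : 'I_k.+1) (w : n.-tuple R) x : tnth (trade i w x) (lift ord_max i) = x.
Proof. by rewrite tnth_mktuple eqxx. Qed.

Lemma trade_last (i : 'I_k.+1) (w : n.-tuple R) x :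
  tnth (trade i w x) ord_max = tnth w (lift ord_max i) + tnth w ord_max - x.
Proof. by rewrite tnth_mktuple (negbTE (neq_lift _ _)) eqxx. Qed.

Lemma trade_other (i j : 'I_k.+1) (w : n.-tuple R) x : j != i ->
  tnth (trade i w x) (lift ord_max j) = tnth w (lift ord_max j).
Proof.
move=> ji; rewrite tnth_mktuple (inj_eq lift_inj) (negbTE ji).
by rewrite eq_sym (negbTE (neq_lift _ _)).
Qed.

Lemma measurable_trade i (w : n.-tuple R) : measurable_fun setT (trade i w : R -> n.-tuple R).
Proof.
apply: measurable_tuple_fun => j; under eq_fun do rewrite tnth_mktuple.
case: (j == lift ord_max i); first exact: measurable_id.
case: (j == ord_max); last exact: measurable_cst.
by apply: measurable_funB; [exact: measurable_cst|exact: measurable_id].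
Qed.

Lemma measurable_trade_set i (w : n.-tuple R) A : measurable A ->
  measurable [set x : R | A (trade i w x)].
Proof. by move=> mA; rewrite -[X in measurable X]setTI; exact: measurable_trade. Qed.

Lemma law_resample (i : 'I_k.+1) (A B : set (n.-tuple R)) (q : R) :
  measurable A -> measurable B -> 0 <= q ->
  (forall w s, open_simplex w -> s = tnth w (lift ord_max i) + tnth w ord_max ->
    0 < s -> s <= 1 ->
    (\int[leb]_(x in `]0%R, s[ `&` [set x | A (trade i w x)]) (kernel2 a s x)%:E <=
     q%:E * \int[leb]_(x in `]0%R, s[ `&` [set x | B (trade i w x)]) (kernel2 a s x)%:E)%E) ->
  (D A <= q%:E * D B)%E.
Proof. by move=> mA mB q0 h; rewrite !DE //; exact: dirichlet_resample h. Qed.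

Lemma int_kernel_mono (s : R) (A B : set R) : measurable A -> measurable B -> A `<=` B ->
  (\int[leb]_(x in A) (kernel2 a s x)%:E <= \int[leb]_(x in B) (kernel2 a s x)%:E)%E.
Proof.
move=> mA mB AB; apply: ge0_subset_integral => //; first exact: measurable_kernel2.
by move=> x _; rewrite lee_fin kernel2_ge0.
Qed.

Lemma int_kernel_ge0 (s : R) (A : set R) : (0 <= \int[leb]_(x in A) (kernel2 a s x)%:E)%E.
Proof. by apply: integral_ge0 => x _; rewrite lee_fin kernel2_ge0. Qed.

Lemma measurable_fiber_trade i (w : n.-tuple R) s A : measurable A ->
  measurable (`]0, s[ `&` [set x : R | A (trade i w x)]).
Proof.
by move=> mA; apply: measurableI; [exact: measurable_itv|exact: measurable_trade_set].
Qed.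

Lemma measurable_open_simplex : measurable (@open_simplex R k).
Proof.
rewrite (_ : @open_simplex R k = [set w : n.-tuple R | forall j, j \in enum 'I_n -> `]0, +oo[%classic (tnth w j)]
   `&` (fun w : n.-tuple R => \sum_(j < n) tnth w j) @^-1` [set 1]).
  apply: measurableI.
    exact: (@measurable_all R n (enum 'I_n) (fun _ => `]0, +oo[%classic) (fun _ => measurable_itv _)).
  have ms : measurable_fun setT (fun w : n.-tuple R => \sum_(j < n) tnth w j).
    by apply: measurable_sum => j; exact: measurable_tnth.
  by rewrite -[X in measurable X]setTI; apply: ms => //; exact: measurable_set1.
apply/seteqP; split => [w [h1 h2]|w [h1 h2]]; split => //.
  by move=> j _; rewrite /= in_itv /= andbT.
by move=> j; have := h1 j; rewrite mem_enum /= in_itv /= andbT => /(_ isT).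
Qed.

Lemma trade_simplex i (w : n.-tuple R) x s : open_simplex w ->
  s = tnth w (lift ord_max i) + tnth w ord_max -> 0 < x < s -> open_simplex (trade i w x).
Proof.
move=> [wpos wsum] sE /andP[x0 xs]; split.
  move=> j; case: (unliftP ord_max j) => [l ->|->]; last by rewrite trade_last -sE subr_gt0.
  by have [->|li] := eqVneq l i; [rewrite trade_lift|rewrite trade_other].
have S (v : n.-tuple R) : \sum_(j < n) tnth v j = tnth v ord_max +
    (tnth v (lift ord_max i) + \sum_(l < k.+1 | l != i) tnth v (lift ord_max l)).
  by rewrite (bigD1_ord ord_max) //=; congr (_ + _); rewrite (bigD1 i).
move: wsum; rewrite !S trade_last trade_lift.
rewrite [in X in _ -> X](eq_bigr (fun l : 'I_k.+1 => tnth w (lift ord_max l))).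
  by move=> <-; ring.
by move=> l li; rewrite trade_other.
Qed.

Lemma law_simplex A : measurable A -> (D A <= D (A `&` @open_simplex R k))%E.
Proof.
move=> mA; have mAS : measurable (A `&` @open_simplex R k).
  by apply: measurableI => //; exact: measurable_open_simplex.
rewrite -[leRHS]mul1e; apply: (law_resample (i := ord0)) => // w s ws sE s0 s1.
rewrite mul1e; apply: int_kernel_mono; [exact: measurable_fiber_trade|exact: measurable_fiber_trade|].
move=> x [/= xs Ax]; split => //; split => //.
by apply: trade_simplex sE _ => //; move: xs; rewrite in_itv.
Qed.

Definition swapw (j : 'I_n) (w : n.-tuple R) : n.-tuple R :=
  [tuple tnth w (tperm j ord_max l) | l < n].

Lemma measurable_swapw j : measurable_fun setT (swapw j).
Proof.
by apply: measurable_tuple_fun => l; under eq_fun do rewrite tnth_mktuple; exact: measurable_tnth.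
Qed.

Lemma measurable_swapw_set j A : measurable A -> measurable (swapw j @^-1` A).
Proof. by move=> mA; rewrite -[X in measurable X]setTI; exact: measurable_swapw. Qed.

Lemma swapwK j : involutive (swapw j).
Proof. by move=> w; apply: eq_from_tnth => l; rewrite !tnth_mktuple tpermK. Qed.

Lemma swapw_trade i (w : n.-tuple R) x :
  swapw (lift ord_max i) (trade i w x) =
  trade i w (tnth w (lift ord_max i) + tnth w ord_max - x).
Proof.
apply: eq_from_tnth => l; rewrite tnth_mktuple.
case: (unliftP ord_max l) => [j ->|->]; last by rewrite tpermR trade_lift trade_last; ring.
have [->|ji] := eqVneq j i; first by rewrite tpermL trade_last trade_lift.
rewrite tpermD ?(inj_eq lift_inj) //; last by rewrite neq_lift.
  by rewrite !trade_other.
by rewrite eq_sym.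
Qed.

Lemma kernel2_sym s x : kernel2 a s (s - x) = kernel2 a s x.
Proof. by rewrite /kernel2; congr powR; ring. Qed.

Lemma law_swap_le i A : measurable A -> (D (swapw (lift ord_max i) @^-1` A) <= D A)%E.
Proof.
move=> mA; rewrite -[leRHS]mul1e; apply: (law_resample (i := i)) => //.
  exact: measurable_swapw_set.
move=> w s ws sE s0 s1; rewrite mul1e le_eqVlt; apply/orP; left; apply/eqP.
rewrite integral_mkcond [RHS]integral_mkcond.
rewrite -[RHS](@integral_reflect _ s); last 2 first.
- have mF : measurable (`]0, s[ `&` [set x : R | A (trade i w x)]).
    exact: measurable_fiber_trade.
  by apply/(measurable_restrictT _ mF); exact: measurable_kernel2.
- by move=> x; apply: erestrict_ge0 => z _; rewrite lee_fin kernel2_ge0.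
apply: eq_integral => x _; rewrite !patchE kernel2_sym.
congr (if _ then _ else _); apply/idP/idP; rewrite !inE /= !in_itv /= swapw_trade -sE.
  by move=> [/andP[? ?] h]; split => //; apply/andP; split; lra.
by move=> [/andP[? ?] h]; split => //; apply/andP; split; lra.
Qed.

Lemma law_swap j A : measurable A -> D (swapw j @^-1` A) = D A.
Proof.
move=> mA; case: (unliftP ord_max j) => [i ->|->]; last first.
  congr (D _); apply/seteqP; split => w /=; rewrite (_ : swapw _ w = w) //;
    by apply: eq_from_tnth => l; rewrite tnth_mktuple tperm1 perm1.
apply/eqP; rewrite eq_le law_swap_le //=.
have := law_swap_le i (measurable_swapw_set (lift ord_max i) mA).
rewrite (_ : swapw _ @^-1` (swapw _ @^-1` A) = A) //.
by apply/seteqP; split => w /=; rewrite swapwK.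
Qed.

End dirichlet_events.

Section dirichlet_bounds.
Context {R : realType}.
Local Notation leb := (@lebesgue_measure R).
Variables (a : R) (k : nat).
Hypotheses (a0 : 0 < a) (a1 : a < 1).
Local Notation n := k.+2.
Variable D : probability (n.-tuple R) R.
Hypothesis DE : forall A, measurable A -> D A = dirichlet_law a A.

Definition all_above (dl : R) (S : {set 'I_n}) : set (n.-tuple R) :=
  [set w | forall j, j \in S -> dl < tnth w j].

Lemma measurable_all_above dl S : measurable (all_above dl S).
Proof.
rewrite (_ : all_above _ _ = [set w : n.-tuple R | forall j, j \in enum S -> `]dl, +oo[%classic (tnth w j)]).
  exact: (@measurable_all R n (enum S) (fun _ => `]dl, +oo[%classic) (fun _ => measurable_itv _)).
apply/seteqP; split => w h j.
  by rewrite mem_enum /= in_itv /= andbT; exact: h.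
by have := h j; rewrite mem_enum /= in_itv /= andbT.
Qed.

Lemma all_above_swap dl S j : swapw j @^-1` (all_above dl S) = all_above dl (tperm j ord_max @: S).
Proof.
apply/seteqP; split => w h l.
  by case/imsetP => i iS ->; have := h i iS; rewrite tnth_mktuple.
by move=> lS; rewrite tnth_mktuple; apply: h; apply: imset_f.
Qed.

Lemma law_all_above_step dl (S : {set 'I_n}) (i : 'I_k.+1) : 0 < dl ->
  ord_max \in S -> lift ord_max i \in S ->
  (D (all_above dl S) <= (a / dl ^+ 3)%:E * D (all_above dl (S :\ lift ord_max i)))%E.
Proof.
move=> d0 mS iS.
have q0 : 0 <= a / dl ^+ 3 by rewrite divr_ge0 ?exprn_ge0 ?ltW.
apply: (law_resample DE (i := i)) => //; [exact: measurable_all_above|exact: measurable_all_above|].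
move=> w s ws sE s0 s1.
have [h|h] := pselect (forall j, lift ord_max j \in S -> j != i -> dl < tnth w (lift ord_max j)); last first.
  rewrite [X in `]0, s[ `&` X](_ : _ = set0).
    by rewrite setI0 integral_set0 mule_ge0 // int_kernel_ge0.
  apply/seteqP; split => x //= hx; apply: h => j jS ji.
  by rewrite -(trade_other w x ji); apply: hx.
rewrite (_ : `]0, s[ `&` [set x | all_above dl S (trade i w x)] = `]dl, (s - dl)[%classic); last first.
  apply/seteqP; split => x /=; rewrite !in_itv /=.
    move=> [_ hx]; have := hx _ iS; have := hx _ mS.
    by rewrite trade_last trade_lift -sE => ? ->; rewrite /=; lra.
  move=> /andP[dx xs]; split; first by apply/andP; split; lra.
  move=> j; case: (unliftP ord_max j) => [l -> lS|-> _]; last by rewrite trade_last -sE; lra.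
  by have [->|li] := eqVneq l i; [rewrite trade_lift|rewrite trade_other // h].
rewrite (_ : `]0, s[ `&` [set x | all_above dl (S :\ lift ord_max i) (trade i w x)] = `]0, (s - dl)[%classic); last first.
  apply/seteqP; split => x /=; rewrite !in_itv /=.
    move=> [/andP[x0 _] hx]; have := hx ord_max; rewrite !inE neq_lift mS => /(_ isT).
    by rewrite trade_last -sE => ?; rewrite x0 /=; lra.
  move=> /andP[dx xs]; split; first by apply/andP; split; lra.
  move=> j; rewrite !inE; case: (unliftP ord_max j) => [l -> /andP[li lS]|-> _]; last by rewrite trade_last -sE; lra.
  have li' : l != i by apply: contraNneq li => ->.
  by rewrite trade_other // h.
exact: kernel2_two.
Qed.

Lemma law_all_above dl m (S : {set 'I_n}) : 0 < dl -> #|S| = m.+1 ->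
  (D (all_above dl S) <= ((a / dl ^+ 3) ^+ m)%:E)%E.
Proof.
move=> d0; have q0 : 0 <= a / dl ^+ 3 by rewrite divr_ge0 ?exprn_ge0 ?ltW.
elim: m S => [|m ih] S cS; first by rewrite expr0; exact: probability_le1 (measurable_all_above _ _).
wlog mS : S cS / ord_max \in S => [hw|].
  have [mS|mS] := boolP (ord_max \in S); first exact: hw.
  have [j jS] : exists j, j \in S by apply/set0Pn; rewrite -card_gt0 cS.
  rewrite -(law_swap DE j (measurable_all_above dl S)) all_above_swap; apply: hw.
    by rewrite card_imset //; exact: perm_inj.
  by apply/imsetP; exists j; rewrite ?tpermL.
have [j] : exists j, j \in S :\ ord_max.
  by apply/set0Pn; rewrite -card_gt0; have := cardsD1 ord_max S; rewrite mS cS add1n => -[<-].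
case: (unliftP ord_max j) => [i ->|->]; rewrite !inE ?eqxx // => /andP[_ iS].
apply: le_trans (law_all_above_step d0 mS iS) _.
rewrite [X in (_ <= X%:E)%E]exprS [X in (_ <= X)%E]EFinM; apply: lee_wpmul2l => //; apply: ih.
by have := cardsD1 (lift ord_max i) S; rewrite iS cS add1n => -[<-].
Qed.

Definition max_last : set (n.-tuple R) := [set w | forall j, tnth w j <= tnth w ord_max].

Lemma measurable_max_last : measurable max_last.
Proof.
rewrite (_ : max_last = \bigcap_(j in [set: 'I_n]) ((fun w : n.-tuple R => tnth w ord_max - tnth w j) @^-1` `[0, +oo[%classic)).
  apply: fin_bigcap_measurable => // j _; rewrite -[X in measurable X]setTI.
  have mm : measurable_fun setT (fun w : n.-tuple R => tnth w ord_max - tnth w j).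
    by apply: measurable_funB; exact: measurable_tnth.
  by apply: mm => //; exact: measurable_itv.
apply/seteqP; split => [w h j _|w h j]; first by rewrite /= in_itv /= andbT subr_ge0.
by have := h j I; rewrite /= in_itv /= andbT subr_ge0.
Qed.

Lemma law_max_last : ((n%:R^-1)%:E <= D max_last)%E.
Proof.
pose A (m : nat) := swapw (inord m : 'I_n) @^-1` max_last.
have mA m : measurable (A m) by apply: measurable_swapw_set; exact: measurable_max_last.
have cover : [set: n.-tuple R] = \big[setU/set0]_(m < n) A m.
  apply/esym/seteqP; split => // w _; rewrite -bigcup_mkord.
  case: (@Order.TotalTheory.arg_maxP _ _ _ (ord0 : 'I_n) xpredT (tnth w) isT) => j _ hj.
  exists j; rewrite /= ?ltn_ord // /A => l /=.
  by rewrite !tnth_mktuple inord_val tpermR; exact: hj.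
have h1 : (1 <= \sum_(m < n) D (A m))%E.
  by rewrite -(@probability_setT _ _ _ D) {1}cover; exact: Boole_inequality.
have {}h1 : (1 <= n%:R%:E * D max_last)%E.
  apply: le_trans h1 _; rewrite le_eqVlt; apply/orP; left; apply/eqP.
  under eq_bigr do rewrite /A (law_swap DE _ measurable_max_last).
  by rewrite sumr_const card_ord mule_natl.
have n0 : 0 < n%:R :> R by rewrite ltr0n.
by rewrite -(@lee_pmul2l _ n%:R%:E) // -EFinM divff // gt_eqF.
Qed.

Definition small_others (eta : R) (S : seq 'I_k.+1) : set (n.-tuple R) :=
  max_last `&` [set w | forall j, j \in S -> tnth w (lift ord_max j) <= eta].

Lemma measurable_small_others eta S : measurable (small_others eta S).
Proof.
apply: measurableI; first exact: measurable_max_last.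
rewrite (_ : [set w | _] = [set w : n.-tuple R | forall j, j \in map (lift ord_max) S -> `]-oo, eta]%classic (tnth w j)]).
  exact: (@measurable_all R n _ (fun _ => `]-oo, eta]%classic) (fun _ => measurable_itv _)).
apply/seteqP; split => w h j.
  by case/mapP => i iS ->; rewrite /= in_itv /=; exact: h.
by move=> jS; have := h (lift ord_max j); rewrite (map_f _ jS) /= in_itv /=; exact.
Qed.

Lemma law_small_others_step eta (S : seq 'I_k.+1) i : 0 < eta -> eta <= 1 ->
  (D (small_others eta S) <= (eta `^ (- (2 * a)))%:E * D (small_others eta (i :: S)))%E.
Proof.
move=> e0 e1.
apply: (law_resample DE (i := i)); rewrite ?powR_ge0 //; try exact: measurable_small_others.
move=> w s ws sE s0 s1.
set E := `]0, s[ `&` [set x | small_others eta S (trade i w x)].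
have mE : measurable E by apply: measurable_fiber_trade; exact: measurable_small_others.
rewrite (_ : `]0, s[ `&` [set x | small_others eta (i :: S) (trade i w x)] = E `&` [set x | x <= eta]).
  apply: kernel2_shrink => //.
    move=> x [/= xs [hx _]]; move: xs; rewrite in_itv /= => /andP[-> _] /=.
    by have := hx (lift ord_max i); rewrite trade_lift trade_last -sE; lra.
  move=> x y [/= xs [hx hS]] /andP[y0 yx]; move: xs; rewrite in_itv /= => /andP[x0 xs].
  have xle := hx (lift ord_max i); rewrite trade_lift trade_last -sE in xle.
  split; first by rewrite /= in_itv /= y0 /=; lra.
  split => [j|j jS].
    rewrite trade_last -sE; case: (unliftP ord_max j) => [l ->|->]; last by rewrite trade_last -sE.
    have [->|li] := eqVneq l i; first by rewrite trade_lift; lra.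
    rewrite trade_other //; have := hx (lift ord_max l); rewrite trade_other // trade_last -sE; lra.
  have [ji|ji] := eqVneq j i.
    by have := hS j jS; rewrite ji !trade_lift; exact: le_trans.
  by rewrite trade_other // -(trade_other w x ji); exact: hS.
apply/seteqP; split => [x [xs [hx hS]]|x [[xs [hx hS]] /= xe]].
  split; last by have := hS i; rewrite inE eqxx trade_lift; exact.
  by split => //; split => // j jS; apply: hS; rewrite inE jS orbT.
split => //; split => // j; rewrite inE => /predU1P[->|]; [by rewrite trade_lift|exact: hS].
Qed.

Lemma law_small_others eta (S : seq 'I_k.+1) : 0 < eta -> eta <= 1 ->
  ((n%:R^-1)%:E <= ((eta `^ (- (2 * a))) ^+ size S)%:E * D (small_others eta S))%E.
Proof.
move=> e0 e1; elim: S => [|i S ih].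
  rewrite mul1e; apply: le_trans law_max_last _; rewrite le_eqVlt; apply/orP; left; apply/eqP.
  by congr (D _); apply/seteqP; split => [w h|w []//]; split.
apply: le_trans ih _; rewrite /= exprSr EFinM -muleA; apply: lee_wpmul2l.
  by rewrite lee_fin exprn_ge0 // powR_ge0.
exact: law_small_others_step.
Qed.

(* the first m weights are close to p, the last one carries the rest *)
Definition near_weights (p : nat -> R) (eps : R) (m : nat) : set (n.-tuple R) :=
  [set w | (forall j : 'I_k.+1, (j < m)%N -> p j - eps < tnth w (lift ord_max j) < p j)] `&`
  [set w | 1 - eps - \sum_(j < m) p j < tnth w ord_max].

Lemma measurable_near_weights p eps m : measurable (near_weights p eps m).
Proof.
apply: measurableI; last first.
  rewrite (_ : [set w | _] = [set w : n.-tuple R | `]1 - eps - \sum_(j < m) p j, +oo[%classic (tnth w ord_max)]).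
    by apply: measurable_coord; exact: measurable_itv.
  by apply/seteqP; split => w; rewrite /= in_itv /= andbT.
rewrite (_ : [set w | _] = [set w : n.-tuple R | forall j, j \in map (lift ord_max) [seq j : 'I_k.+1 <- enum 'I_k.+1 | (j < m)%N] ->
    `]p j - eps, p j[%classic (tnth w j)]).
  exact: (@measurable_all R n _ (fun j => `]p j - eps, p j[%classic) (fun _ => measurable_itv _)).
have liftE (j : 'I_k.+1) : lift ord_max j = j :> nat by rewrite /= /bump leqNgt ltn_ord.
apply/seteqP; split => w h j.
  by case/mapP => i; rewrite mem_filter => /andP[im _] ->; rewrite liftE /= in_itv /=; exact: h.
move=> jm; have := h (lift ord_max j); rewrite map_f; last by rewrite mem_filter jm mem_enum.
by move=> /(_ isT); rewrite liftE /= in_itv /=.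
Qed.

Lemma law_near_weights_step (p : nat -> R) (eps th : R) (m : nat) :
  0 < eps -> 0 < th -> (m < k.+1)%N -> eps <= p m -> th <= 1 - eps - \sum_(j < m.+1) p j ->
  (D (near_weights p eps m) <= (4 / (th * a * eps))%:E * D (near_weights p eps m.+1))%E.
Proof.
move=> e0 t0 mk ep thp; pose i : 'I_k.+1 := Ordinal mk.
have q0 : 0 <= 4 / (th * a * eps) by rewrite divr_ge0 // !mulr_ge0 // ltW.
apply: (law_resample DE (i := i)) => //; try exact: measurable_near_weights.
move=> w s ws sE s0 s1; rewrite big_ord_recr /= in thp.
have mF q : measurable (`]0, s[ `&` [set x | near_weights p eps q (trade i w x)]).
  by apply: measurable_fiber_trade; exact: measurable_near_weights.
have [[h hs]|h] := pselect ((forall j : 'I_k.+1, (j < m)%N -> p j - eps < tnth w (lift ord_max j) < p j) /\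
    1 - eps - \sum_(j < m) p j < s); last first.
  rewrite [X in (\int[_]_(_ in X) _ <= _)%E](_ : _ = set0).
    by rewrite integral_set0 mule_ge0 // int_kernel_ge0.
  apply/seteqP; split => x //= [xs [hx hl]]; apply: h; split.
    move=> j jm; rewrite -(@trade_other _ _ i j w x); first exact: hx.
    by apply: contraTneq jm => ->; rewrite ltnn.
  by move: xs hl; rewrite /= in_itv /= => /andP[x0 _]; rewrite trade_last -sE; lra.
apply: (@le_trans _ _ (\int[leb]_(x in `]0%R, s[) (kernel2 a s x)%:E)%E).
  by apply: int_kernel_mono => // x [].
have ps : p m < s by lra.
apply: le_trans (kernel2_split a0 a1 e0 ep ps s1) _.
have ths : th <= s by lra.
apply: (@le_trans _ _ ((4 / (th * a * eps))%:E * \int[leb]_(x in `](p m - eps)%R, (p m)[) (kernel2 a s x)%:E)%E).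
  apply: lee_wpmul2r; first exact: int_kernel_ge0.
  rewrite lee_fin ler_wpM2l // lef_pV2 ?posrE ?mulr_gt0 //.
  by rewrite ler_wpM2r ?(ltW e0) // ler_wpM2r ?(ltW a0).
apply: lee_wpmul2l => //; apply: int_kernel_mono => // x.
rewrite /= in_itv /= => /andP[x0 xp]; split; first by rewrite /= in_itv /=; apply/andP; split; lra.
split; last by rewrite /= big_ord_recr /= trade_last -sE; lra.
move=> j; rewrite ltnS leq_eqVlt => /predU1P[jm|jm].
  have -> : j = i by exact/val_inj.
  by rewrite trade_lift x0 /=.
rewrite trade_other; first exact: h.
by apply: contraTneq jm => ->; rewrite ltnn.
Qed.

Lemma law_near_weights (p : nat -> R) (eps th : R) (M : nat) :
  0 < eps -> eps < 1 -> 0 < th -> (M <= k.+1)%N -> (forall j, (j < M)%N -> eps <= p j) ->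
  th <= 1 - eps - \sum_(j < M) p j ->
  ((n%:R^-1)%:E <= (((eps / n%:R) `^ (- (2 * a))) ^+ k.+1 * (4 / (th * a * eps)) ^+ M)%:E *
     D (near_weights p eps M `&` @open_simplex R k))%E.
Proof.
move=> e0 e1 t0 Mk pe thp; have nn0 : 0 < n%:R :> R by rewrite ltr0n.
have q0 : 0 <= 4 / (th * a * eps) by rewrite divr_ge0 // !mulr_ge0 // ltW.
pose eta := eps / n%:R.
have eta0 : 0 < eta by rewrite divr_gt0.
have eta1 : eta <= 1.
  by rewrite ler_pdivrMr // mul1r (le_trans (ltW e1)) // ler1n.
apply: le_trans (law_small_others (enum 'I_k.+1) eta0 eta1) _.
rewrite size_enum_ord [X in (_ <= X * _)%E]EFinM -muleA; apply: lee_wpmul2l.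
  by rewrite lee_fin exprn_ge0 // powR_ge0.
have h0 : (D (small_others eta (enum 'I_k.+1)) <= D (near_weights p eps 0))%E.
  apply: le_trans (law_simplex DE (measurable_small_others _ _)) _.
  apply: le_measure; rewrite ?inE.
  - by apply: measurableI; [exact: measurable_small_others|exact: measurable_open_simplex].
  - exact: measurable_near_weights.
  move=> w [[_ h] [_ ws]]; split => //=; rewrite big_ord0 subr0.
  move: ws; rewrite (bigD1_ord ord_max) //= => ws.
  have : \sum_(j < k.+1) tnth w (lift ord_max j) <= \sum_(j < k.+1) eta.
    by apply: ler_sum => j _; apply: h; rewrite mem_enum.
  rewrite sumr_const card_ord -mulr_natr => hle.
  have : eta * k.+1%:R < eps.
    by rewrite /eta mulrAC ltr_pdivrMr // ltr_pM2l // ltr_nat.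
  lra.
apply: le_trans h0 _.
have hM m : (m <= M)%N -> (D (near_weights p eps 0) <= ((4 / (th * a * eps)) ^+ m)%:E * D (near_weights p eps m))%E.
  elim: m => [|m ih] mM; first by rewrite mul1e.
  apply: le_trans (ih (ltnW mM)) _; rewrite exprSr EFinM -muleA; apply: lee_wpmul2l.
    by rewrite lee_fin exprn_ge0.
  apply: law_near_weights_step => //; [exact: leq_trans Mk|exact: pe|].
  apply: le_trans thp _; rewrite lerD2l lerN2.
  rewrite -!(big_mkord xpredT p) [leRHS](@big_cat_nat _ _ _ m.+1) //= lerDl.
  rewrite big_nat_cond; apply: sumr_ge0 => j /andP[/andP[_ jM] _].
  by apply: le_trans (pe j jM); exact: ltW.
apply: le_trans (hM M (leqnn M)) _; apply: lee_wpmul2l; first by rewrite lee_fin exprn_ge0.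
exact: (law_simplex DE (measurable_near_weights _ _ _)).
Qed.

End dirichlet_bounds.

Section weak_topology_M1.
Context {R : realType}.
Local Notation bc := (bounded_continuous R).

Lemma initial_cvgP (S : choiceType) (T : topologicalType) (f : S -> T)
    (F : set_system S) (s : S) : Filter F ->
  F --> (s : initial_topology f) <-> f @ F --> f s.
Proof.
move=> FF; split=> [h|h].
  apply: (@cvg_comp _ _ _ (id : S -> initial_topology f) f) h _.
  exact: (@initial_continuous S T f s).
move=> A /= [_ [[B Bop <-] Bs sBA]].
have FB : F (f @^-1` B) by apply: h; apply: open_nbhs_nbhs.
exact: filterS sBA FB.
Qed.

Lemma prod_cvgP (I : Type) (T : I -> topologicalType) (F : set_system (prod_topology T))
    (f : prod_topology T) : Filter F ->
  F --> f <-> forall i, (fun g : prod_topology T => g i) @ F --> f i.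
Proof.
move=> FF; split=> [/cvg_sup h i|h].
  exact: (proj1 (@initial_cvgP _ (T i) (fun g : forall i, T i => g i) F f FF) (h i)).
apply/cvg_sup => i.
exact: (proj2 (@initial_cvgP _ (T i) (fun g : forall i, T i => g i) F f FF) (h i)).
Qed.

Lemma M1_cvgP (F : set_system (M1 R)) (mu : M1 R) : Filter F ->
  F --> mu <-> forall f : bc, mean nu f @[nu --> F] --> mean mu f.
Proof.
move=> FF; split.
  by move/(@initial_cvgP _ _ (@mean R) F mu FF)/prod_cvgP => h f; exact: h.
by move=> h; apply/(@initial_cvgP _ _ (@mean R) F mu FF)/prod_cvgP.
Qed.

Lemma bc_measurable (f : bc) : measurable_fun setT (sval f).
Proof. by apply: continuous_measurable_fun; exact: (proj1 (svalP f)). Qed.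

Lemma bc_bound (f : bc) : exists2 M, 0 < M & forall x, `|sval f x| <= M.
Proof.
have [_ [M hM]] := svalP f; exists (Num.max M 1) => [|x]; first by rewrite lt_max ltr01 orbT.
by rewrite le_max hM.
Qed.

Lemma bc_integrable (f : bc) (mu : probability R R) : mu.-integrable setT (EFin \o sval f).
Proof.
have [M M0 hM] := bc_bound f.
apply: (@le_integrable _ _ _ mu setT _ _ (cst M%:E)) => //.
- by apply/measurable_EFinP; exact: bc_measurable.
- by move=> x _ /=; rewrite lee_fin (le_trans (hM x)) // ler_norm.
- by apply: finite_measure_integrable_cst.
Qed.

Lemma mean_EFin (f : bc) (mu : M1 R) :
  (mean mu f)%:E = (\int[(mu : probability R R)]_x (sval f x)%:E)%E.
Proof.
rewrite /mean /Rintegral fineK //; exact: (integrable_fin_num _ (bc_integrable f mu)).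
Qed.

(* shifting by a constant to get a nonnegative integrand *)
Lemma mean_shift (f : bc) (mu : M1 R) (c : R) :
  (\int[(mu : probability R R)]_x (sval f x + c)%:E)%E = (mean mu f + c)%:E.
Proof.
under eq_integral do rewrite EFinD.
rewrite integralD //; [|exact: bc_integrable|exact: finite_measure_integrable_cst].
by rewrite integral_cst // [X in (_ * X)%E]probability_setT mule1 EFinD mean_EFin.
Qed.

Definition atom (w l : nat -> R) (k : nat) : {measure set R -> \bar R} :=
  mscale (`|w k|)%:nng (dirac (l k)).

Lemma mean_atoms_approx (mu : M1 R) (f : bc) (N : nat) (w l : nat -> R)
    (rho : {measure set R -> \bar R}) (r e : R) :
  (forall k, 0 <= w k) ->
  (forall A, measurable A -> (mu : probability R R) A =
     (\sum_(k < N) (w k)%:E * \d_(l k) A + rho A)%E) ->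
  rho [set x | r < `|x|] = 0%E ->
  (forall x, `|x| <= r -> `|sval f x - sval f 0| <= e) ->
  `|mean mu f - sval f 0 - \sum_(k < N) w k * (sval f (l k) - sval f 0)| <= e * (1 - \sum_(k < N) w k).
Proof.
move=> w0 muE rho0 fe; have [M M0 hM] := bc_bound f.
pose f0 := sval f 0; pose h x := sval f x + M.
have h0 x : (0 <= (h x)%:E)%E.
  by rewrite lee_fin /h; have := hM x; rewrite ler_norml => /andP[]; lra.
have mh : measurable_fun setT (fun x => (h x)%:E).
  by apply/measurable_EFinP; apply: measurable_funD => //; exact: bc_measurable.
pose at_ := atom w l.
have muE' A : measurable A -> (mu : probability R R) A = measure_add (msum at_ N) rho A.
  move=> mA; rewrite muE // measure_addE /msum; congr (_ + _)%E; apply: eq_bigr => k _.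
  by rewrite /at_ /atom /= /mscale /= ger0_norm.
pose t := 1 - \sum_(k < N) w k.
have rhoT : rho setT = t%:E.
  have := muE setT measurableT; rewrite [X in X = _ -> _]probability_setT.
  under eq_bigr do rewrite diracT mule1.
  rewrite sumEFin /t; case: (rho setT) => [z| |] //= -[->]; congr EFin; ring.
have t0 : 0 <= t by rewrite -lee_fin -rhoT.
have hmu : (\int[(mu : probability R R)]_x (h x)%:E =
   (\sum_(k < N) w k * h (l k))%:E + \int[rho]_x (h x)%:E)%E.
  rewrite (@eq_measure_integral _ _ _ setT (measure_add (msum at_ N) rho)); last by move=> A mA _; exact: muE'.
  rewrite ge0_integral_measure_add // ge0_integral_measure_sum //; congr (_ + _)%E.
  rewrite -sumEFin; apply: eq_bigr => k _.
  rewrite ge0_integral_mscale // integral_dirac // diracT mul1e -EFinM /=.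
  by rewrite ger0_norm.
have mr : measurable [set x : R | r < `|x|].
  rewrite (_ : [set _ | _] = (fun x : R => `|x|) @^-1` `]r, +oo[%classic).
    rewrite -[X in measurable X]setTI; apply: (@normr_measurable R setT) => //; exact: measurable_itv.
  by apply/seteqP; split => x /=; rewrite in_itv /= andbT.
pose D := ~` [set x : R | r < `|x|].
have mD : measurable D by exact: measurableC.
have DU : D `|` [set x : R | r < `|x|] = setT by exact: setvU.
have rhoD : rho D = t%:E.
  rewrite -rhoT -DU measureU //; last exact: setICl.
  by rewrite [X in (_ + X)%E](_ : _ = 0%E) ?adde0 //; exact: rho0.
have hrho : (\int[rho]_x (h x)%:E = \int[rho]_(x in D) (h x)%:E)%E.
  rewrite -[in LHS]DU.
  rewrite ge0_integral_setU //.
  - rewrite [X in (_ + X)%E](_ : _ = 0%E) ?adde0 //.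
    apply: null_set_integral => //; first exact: measurable_funTS.
  - exact: measurable_funTS.
  - by apply/disj_setPS => x [].
have ub : (\int[rho]_(x in D) (h x)%:E <= ((f0 + M + e) * t)%:E)%E.
  rewrite EFinM -rhoD -integral_cst //; apply: ge0_le_integral => //.
  - exact: measurable_funTS.
  - move=> x /negP; rewrite -leNgt => /fe; rewrite ler_norml => /andP[_ hx].
    by rewrite lee_fin /h -/f0 in hx *; lra.
have lb : (((f0 + M - e) * t)%:E <= \int[rho]_(x in D) (h x)%:E)%E.
  have [c0|c0] := leP 0 (f0 + M - e); last first.
    apply: (@le_trans _ _ 0%E); last by apply: integral_ge0.
    by rewrite lee_fin mulr_le0_ge0 // ltW.
  rewrite EFinM -rhoD -integral_cst //; apply: ge0_le_integral => //.
  - exact: measurable_funTS.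
  - move=> x /negP; rewrite -leNgt => /fe; rewrite ler_norml => /andP[hx _].
    by rewrite lee_fin /h -/f0 in hx *; lra.
move: hmu; rewrite hrho mean_shift => hmu.
have [X XE] : exists X, (\int[rho]_(x in D) (h x)%:E = X%:E)%E.
  move: ub lb; case: (\int[rho]_(x in D) _)%E => [X _ _| |]; [by exists X| |].
    by rewrite leye_eq.
  by rewrite leeNy_eq.
rewrite XE in ub lb hmu; rewrite !lee_fin in ub lb; case: hmu => hmu.
have -> : mean mu f - sval f 0 - \sum_(k < N) w k * (sval f (l k) - sval f 0) = X - (f0 + M) * t.
  have sE : \sum_(k < N) w k * h (l k) = \sum_(k < N) w k * (sval f (l k) - f0) + (f0 + M) * (\sum_(k < N) w k).
    by rewrite mulr_sumr -big_split /=; apply: eq_bigr => k _; rewrite /h; ring.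
  move: hmu; rewrite sE /t -/f0 => hmu.
  have -> : mean mu f = \sum_(k < N) w k * (sval f (l k) - f0) + (f0 + M) * (\sum_(k < N) w k) + X - M.
    by rewrite -hmu; ring.
  ring.
rewrite -/t; apply/ler_normlP; split; lra.
Qed.

End weak_topology_M1.

Lemma cvg_sum_ord (R : realType) (T : Type) (F : set_system T) (u : nat -> T -> R) (l : nat -> R) N :
  Filter F -> (forall k, u k @ F --> l k) ->
  (fun t => \sum_(k < N) u k t) @ F --> \sum_(k < N) l k.
Proof.
move=> FF ul; elim: N => [|N ih].
  by rewrite big_ord0; under eq_fun do rewrite big_ord0; exact: cvg_cst.
rewrite big_ord_recr; under eq_fun do rewrite big_ord_recr.
by apply: cvgD => //; exact: ul.
Qed.

Section compact_family.
Context {R : realType}.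
Local Notation bc := (bounded_continuous R).
Variable r : nat -> R.
Hypotheses (r0 : forall k, 0 <= r k) (rdec : forall m k, (m <= k)%N -> r k <= r m).

(* parameters: kk (k, true) is the k-th weight, kk (k, false) the k-th atom *)
Definition param := prod_topology (fun _ : nat * bool => R : topologicalType).
Implicit Types kk : param.

Definition wt kk (k : nat) : R := kk (k, true).
Definition loc kk (k : nat) : R := kk (k, false).

Definition param_ok : set param := [set kk |
  [/\ forall k, 0 <= wt kk k, forall k, `|loc kk k| <= r k &
      forall N, \sum_(k < N) wt kk k <= 1]].

Definition represents (mu : M1 R) (kk : param) := forall (f : bc) N e,
  (forall x, `|x| <= r N -> `|sval f x - sval f 0| <= e) ->
  `|mean mu f - sval f 0 - \sum_(k < N) wt kk k * (sval f (loc kk k) - sval f 0)| <= e.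

Definition shrinking : set (M1 R) := [set mu | exists2 kk, param_ok kk & represents mu kk].

Lemma osc_ge0 (f : bc) N (e : R) :
  (forall x, `|x| <= r N -> `|sval f x - sval f 0| <= e) -> 0 <= e.
Proof. by move=> h; have := h 0; rewrite normr0 subrr normr0; exact. Qed.

Lemma represents_measure (mu : M1 R) kk (tail : {measure set R -> \bar R}) :
  param_ok kk -> (forall A, measurable A -> (mu : probability R R) A =
    (\sum_(0 <= k <oo) (wt kk k)%:E * \d_(loc kk k) A + tail A)%E) ->
  (forall A : set R, ~ A 0%R -> measurable A -> tail A = 0%E) ->
  represents mu kk.
Proof.
move=> [w0 lr ws] muE tail0 f N e he; have e0 := osc_ge0 he.
pose w k := wt kk k; pose l k := loc kk k.
have wE A k : atom w l k A = ((wt kk k)%:E * \d_(loc kk k) A)%E.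
  by rewrite /atom /= /mscale /= ger0_norm // w0.
have mr : measurable [set x : R | r N < `|x|].
  rewrite (_ : [set _ | _] = (fun x : R => `|x|) @^-1` `]r N, +oo[%classic).
    rewrite -[X in measurable X]setTI; apply: (@normr_measurable R setT) => //; exact: measurable_itv.
  by apply/seteqP; split => x /=; rewrite in_itv /= andbT.
pose rho : {measure set R -> \bar R} := measure_add (mseries (atom w l) N) tail.
have rhoE A : rho A = (mseries (atom w l) N A + tail A)%E by exact: measure_addE.
have h := @mean_atoms_approx R mu f N w l rho (r N) e w0.
apply: le_trans (h _ _ he) _.
- move=> A mA; rewrite muE // rhoE /mseries.
  rewrite (@nneseries_split _ _ 0 N) ?add0n; last first.
    by move=> k _; rewrite mule_ge0 // lee_fin w0.
  rewrite big_mkord addeA; congr (_ + _ + _)%E.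
  by apply: eq_eseriesr => k _; rewrite wE.
- rewrite rhoE tail0 //= ?adde0; last by rewrite normr0 ltNge r0.
  rewrite /mseries eseries0 // => k Nk _; rewrite wE diracE memNset ?mule0 //=.
  by apply/negP; rewrite -leNgt (le_trans (lr k)) // rdec.
- rewrite -[leRHS]mulr1 ler_wpM2l // lerBlDr lerDl.
  by apply: sumr_ge0 => k _; exact: w0.
Qed.

Lemma param_measure kk : param_ok kk -> exists mu : M1 R, represents mu kk.
Proof.
move=> ok; have [w0 lr ws] := ok.
pose w k := wt kk k; pose l k := loc kk k.
pose S := (\sum_(0 <= k <oo) (w k)%:E)%E.
have S0 : (0 <= S)%E by apply: nneseries_ge0 => k _ _; rewrite lee_fin w0.
have S1 : (S <= 1)%E.
  apply: lime_le; first by apply: is_cvg_nneseries => k _ _; rewrite lee_fin w0.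
  by apply: nearW => N; rewrite sumEFin lee_fin big_mkord ws.
have [s sE] : exists s, S = s%:E by move: S0 S1; case: S => // s; exists s.
have s1 : s <= 1 by rewrite -lee_fin -sE.
pose tail := atom (fun=> 1 - s) (fun=> 0) 0%N.
have tE A : tail A = ((1 - s)%:E * \d_(0%R : R) A)%E.
  by rewrite /tail /atom /= /mscale /= ger0_norm // subr_ge0.
have wE A k : atom w l k A = ((wt kk k)%:E * \d_(loc kk k) A)%E.
  by rewrite /atom /= /mscale /= ger0_norm // w0.
pose m : {measure set R -> \bar R} := measure_add (mseries (atom w l) 0) tail.
have mE A : m A = (mseries (atom w l) 0 A + tail A)%E by exact: measure_addE.
have mT : m setT = 1%E.
  rewrite mE /mseries tE diracT mule1.
  under eq_eseriesr do rewrite wE diracT mule1.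
  by rewrite -/S sE -EFinD; congr EFin; ring.
pose mu : M1 R := mnormalize m (dirac (0 : R)).
exists mu; apply: (@represents_measure mu kk tail ok).
  move=> A mA.
  have -> : (mu : probability R R) A = m A.
    by rewrite /mu /= /mnormalize mT onee_eq0 /= invr1 mule1.
  rewrite mE /mseries; congr (_ + _)%E.
  by apply: eq_eseriesr => k _; rewrite wE.
by move=> A A0 mA; rewrite tE diracE memNset // mule0.
Qed.

Hypothesis rlim : r @ \oo --> 0.

Lemma osc_small (f : bc) (e : R) : 0 < e ->
  exists N, forall x, `|x| <= r N -> `|sval f x - sval f 0| <= e.
Proof.
move=> e0; have [cf _] := svalP f.
have /cvgrPdist_le /(_ e e0) := cf 0; rewrite nearE => -[d /= d0 hd].
have /cvgrPdist_lt /(_ d d0) [N _ hN] := rlim.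
exists N => x xN; rewrite distrC; apply: hd; rewrite /ball /= sub0r normrN.
by apply: le_lt_trans xN _; have := hN N (leqnn N); rewrite /= sub0r normrN ger0_norm.
Qed.

Lemma fmap_ultra (T U : Type) (F : set_system T) (g : T -> U) :
  UltraFilter F -> UltraFilter (g @ F).
Proof.
move=> FU; split; first exact: fmap_proper_filter.
move=> G PG FG; apply/seteqP; split => // A GA.
have [FA|FA] := in_ultra_setVsetC (g @^-1` A) FU; first exact: FA.
have GAc : G (~` A) by exact: FG.
have /filter_ex[x []] : G (A `&` ~` A) by exact: filterI.
by [].
Qed.

Lemma shrinking_compact : compact shrinking.
Proof.
rewrite compact_ultra => G GU GC.
have /choice[kap kapP] : forall mu, exists kk, shrinking mu -> param_ok kk /\ represents mu kk.
  move=> mu; have [[kk h1 h2]|h] := pselect (shrinking mu); first by exists kk.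
  by exists (fun=> 0) => /h.
have HU : UltraFilter (kap @ G) by exact: fmap_ultra.
pose box (i : nat * bool) : set R := if i.2 then `[0, 1]%classic else `[- r i.1, r i.1]%classic.
have cbox : compact ([set kk : param | forall i, box i (kk i)] : set param).
  apply: (@tychonoff _ (fun _ : nat * bool => R : topologicalType) box) => i.
  by rewrite /box; case: i.2; exact: segment_compact.
have Gok : G (kap @^-1` param_ok).
  by apply: (filterS _ GC) => mu /kapP[].
have Hok : (kap @ G) param_ok by exact: Gok.
have Hbox : (kap @ G) [set kk : param | forall i, box i (kk i)].
  apply: filterS Hok => kk [w0 lr ws] [k []]; rewrite /box /= in_itv /=.
    rewrite w0 /=; apply: le_trans (ws k.+1); rewrite big_ord_recr /= lerDr.
    by apply: sumr_ge0 => j _; exact: w0.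
  by rewrite -ler_norml lr.
rewrite compact_ultra in cbox.
have [ks [kbox Hks]] := cbox _ HU Hbox; rewrite /= in Hks.
have cvi i : (fun kk : param => kk i) @ (kap @ G) --> ks i.
  exact: (proj1 (prod_cvgP _ _) Hks i).
have kok : param_ok ks.
  split.
  - by move=> k; have := kbox (k, true); rewrite /box /= in_itv /= => /andP[].
  - by move=> k; have := kbox (k, false); rewrite /box /= in_itv /= -ler_norml.
  - move=> N.
    have cvN : (fun kk : param => \sum_(k < N) wt kk k) @ (kap @ G) --> \sum_(k < N) wt ks k.
      by apply: (@cvg_sum_ord _ _ _ (fun k kk => wt kk k) (wt ks)) => k; exact: cvi.
    by apply: (cvgr_to_le cvN); apply: filterS Hok => kk [].
have [nu nuR] := param_measure kok.
exists nu; split; first by exists ks.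
apply/M1_cvgP => f; apply/cvgrPdist_le => e e0.
have e3 : 0 < e / 3 by rewrite divr_gt0.
have [N hN] := osc_small f e3.
have cvs : (fun kk : param => \sum_(k < N) wt kk k * (sval f (loc kk k) - sval f 0)) @ (kap @ G)
   --> \sum_(k < N) wt ks k * (sval f (loc ks k) - sval f 0).
  apply: (@cvg_sum_ord _ _ _ (fun k kk => wt kk k * (sval f (loc kk k) - sval f 0)) (fun k => wt ks k * (sval f (loc ks k) - sval f 0))) => k.
  apply: cvgM; first exact: cvi.
  apply: cvgB; last exact: cvg_cst.
  exact: (cvg_comp _ (sval f) (cvi (k, false)) (proj1 (svalP f) _)).
have /cvgrPdist_le /(_ _ e3) near1 := cvs.
have near2 : G [set mu | `|\sum_(k < N) wt ks k * (sval f (loc ks k) - sval f 0) -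
    \sum_(k < N) wt (kap mu) k * (sval f (loc (kap mu) k) - sval f 0)| <= e / 3] by exact: near1.
apply: (filterS _ (filterI GC near2)) => mu [muC /= h1].
have [_ /(_ f N _ hN) h2] := kapP _ muC.
have h3 := nuR f N _ hN.
move: h1 h2 h3; rewrite !ler_norml => /andP[? ?] /andP[? ?] /andP[? ?].
by apply/andP; split; lra.
Qed.

Lemma shrinking_cvg (nu : nat -> M1 R) (mu : M1 R) :
  (forall n, shrinking (nu n)) -> nu @ \oo --> mu -> shrinking mu.
Proof.
move=> nuC cv; have := shrinking_compact; rewrite compact_ultra => cC.
have [G [GU sG]] := ultraFilterLemma (fmap_proper_filter nu eventually_filter).
have GC : G shrinking by apply: sG; exists 0%N => // n _; exact: nuC.
have [mu' [[kk ok rep] /= Gmu']] := cC _ GU GC.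
have Gmu : G --> mu by move=> A /cv hA; exact: sG.
have meanE f : mean mu f = mean mu' f.
  have c1 : (fun nu : M1 R => mean nu f) @ G --> mean mu f by exact: (proj1 (M1_cvgP _ _) Gmu).
  have c2 : (fun nu : M1 R => mean nu f) @ G --> mean mu' f by exact: (proj1 (M1_cvgP _ _) Gmu').
  exact: (cvg_unique _ c1 c2).
by exists kk => // f N e he; rewrite meanE; exact: rep.
Qed.

End compact_family.

Section finite_configurations.
Context {R : realType}.
Local Notation bc := (bounded_continuous R).

Lemma finite_shrinking (r : nat -> R) (n : nat) (w x : 'I_n -> R) (mu : M1 R) :
  (forall k, 0 <= r k) -> (forall m k, (m <= k)%N -> r k <= r m) ->
  (forall j, 0 <= w j) -> \sum_j w j = 1 ->
  (forall k, (#|[set j | (r k < `|x j|)%R]%SET| <= k)%N) ->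
  (forall A, measurable A -> (mu : probability R R) A = (\sum_j (w j)%:E * \d_(x j) A)%E) ->
  shrinking r mu.
Proof.
move=> r0 rdec w0 w1 hcount muE.
case: n w x w0 w1 hcount muE => [|n] w x w0 w1 hcount muE.
  by move: w1; rewrite big_ord0 => /eqP; rewrite eq_sym oner_eq0.
pose le_abs (i j : 'I_n.+1) := `|x j| <= `|x i|.
pose s := sort le_abs (enum 'I_n.+1).
have sps : perm_eq s (enum 'I_n.+1) by rewrite perm_sort.
have szs : size s = n.+1 by rewrite (perm_size sps) size_enum_ord.
have us : uniq s by rewrite (perm_uniq sps) enum_uniq.
have srt : sorted le_abs s.
  by apply: sort_sorted => i j; rewrite /le_abs; exact: le_total.
have tr : transitive le_abs by move=> a b c; rewrite /le_abs => h1 h2; exact: le_trans h1.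
pose kk : param := fun i => if (i.1 < n.+1)%N then (if i.2 then w (nth ord0 s i.1) else x (nth ord0 s i.1)) else 0.
have sumE (T : nmodType) (F : 'I_n.+1 -> T) : \sum_(k < n.+1) F (nth ord0 s k) = \sum_j F j.
  have -> : \sum_j F j = \sum_(j <- s) F j by rewrite (perm_big _ sps) big_enum.
  by rewrite [RHS](big_nth ord0) szs big_mkord.
have wtE k : wt kk k = if (k < n.+1)%N then w (nth ord0 s k) else 0 by [].
have locE k : loc kk k = if (k < n.+1)%N then x (nth ord0 s k) else 0 by [].
have wt0 k : 0 <= wt kk k by rewrite wtE; case: ifP.
have kok : param_ok r kk.
  split => [//|k|N].
  - rewrite locE; case: ifP => kn; last by rewrite normr0.
    rewrite leNgt; apply/negP => rk.
    have := hcount k; apply/negP; rewrite -ltnNge.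
    have sub : {subset take k.+1 s <= [set j | (r k < `|x j|)%R]%SET}.
      move=> j jt; rewrite inE; apply: lt_le_trans rk _.
      have [i ik ij] : exists2 i, (i < k.+1)%N & nth ord0 s i = j.
        have := jt; move/(nthP ord0) => [i]; rewrite size_take_min szs leq_min => /andP[ik _] <-.
        by exists i => //; rewrite nth_take.
      rewrite -ij; move: ik; rewrite ltnS leq_eqVlt => /predU1P[->//|ik].
      have := @sorted_ltn_nth _ le_abs tr ord0 s srt i k.
      by rewrite !inE szs => /(_ (ltn_trans ik kn) kn ik).
    have := uniq_leq_size (take_uniq k.+1 us) (s2 := enum [set j | (r k < `|x j|)%R]%SET).
    rewrite size_take_min szs -cardE (minn_idPl kn).
    by apply => j /sub; rewrite mem_enum.
  - apply: (@le_trans _ _ (\sum_(k < N + n.+1) wt kk k)).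
      by rewrite big_split_ord /= lerDl; apply: sumr_ge0 => k _.
    rewrite addnC big_split_ord /= [X in _ + X]big1 ?addr0; last first.
      by move=> k _; rewrite wtE ltnNge leq_addr.
    rewrite -w1 -[leRHS](sumE _ w) le_eqVlt; apply/orP; left; apply/eqP; apply: eq_bigr => k _.
    by rewrite wtE /= ltn_ord.
exists kk => //; apply: (@represents_measure R r r0 rdec mu kk mzero) => //.
move=> A mA; rewrite /mzero adde0 muE // (@nneseries_split _ _ 0 n.+1) ?add0n; last first.
  by move=> k _; rewrite mule_ge0 // lee_fin.
rewrite [X in (_ + X)%E]eseries0 ?adde0; last first.
  by move=> k nk _; rewrite wtE ltnNge nk mul0e.
rewrite big_mkord -(sumE _ (fun j => ((w j)%:E * \d_(x j) A)%E)).
by apply: eq_bigr => k _; rewrite wtE locE ltn_ord.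
Qed.

(* probability measures agreeing with a weighted sum of atoms *)
Lemma mean_atoms n (w x : 'I_n -> R) (mu : M1 R) (f : bc) :
  (forall j, 0 <= w j) ->
  (forall A, measurable A -> (mu : probability R R) A = (\sum_j (w j)%:E * \d_(x j) A)%E) ->
  mean mu f = \sum_j w j * sval f (x j).
Proof.
move=> w0 muE.
have w1 : \sum_j w j = 1.
  have := muE setT measurableT; rewrite [X in X = _ -> _]probability_setT.
  by under eq_bigr do rewrite diracT mule1; rewrite sumEFin => -[].
case: n w x w0 muE w1 => [|n] w x w0 muE w1.
  by move: w1; rewrite big_ord0 => /eqP; rewrite eq_sym oner_eq0.
pose w' k := w (inord k); pose x' k := x (inord k).
have := @mean_atoms_approx R mu f n.+1 w' x' mzero (-1) 0.
rewrite mul0r normr_le0 => h.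
have {h} : mean mu f - sval f 0 - \sum_(k < n.+1) w' k * (sval f (x' k) - sval f 0) == 0.
  apply: h => //; last by move=> z hz; have := le_trans (normr_ge0 z) hz; rewrite lerNr oppr0 ler10.
    by move=> k; exact: w0.
  move=> A mA; rewrite muE // /mzero adde0; apply: eq_bigr => k _.
  by rewrite /w' /x' inord_val.
rewrite subr_eq0 => /eqP h.
have -> : mean mu f = \sum_(k < n.+1) w' k * (sval f (x' k) - sval f 0) + sval f 0 by rewrite -h subrK.
rewrite -[X in _ + X]mul1r -w1 mulr_suml -big_split /=; apply: eq_bigr => k _.
by rewrite /w' /x' inord_val; ring.
Qed.

Lemma weighted_dirac_mean n (w x : n.-tuple R) (f : bc) : 0 < \sum_(k < n) `|tnth w k| ->
  mean (weighted_dirac w x) f = (\sum_(k < n) `|tnth w k| * sval f (tnth x k)) / \sum_(k < n) `|tnth w k|.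
Proof.
move=> W0; set W := \sum_(k < n) _ in W0 *.
have E B : msum (weighted_atom w x) n B = (\sum_(k < n) (`|tnth w k|)%:E * \d_(tnth x k) B)%E.
  by rewrite /msum; apply: eq_bigr => k _; rewrite /= /mscale /= -!tnth_nth.
have ET : msum (weighted_atom w x) n setT = W%:E.
  by rewrite E; under eq_bigr do rewrite diracT mule1; rewrite sumEFin.
rewrite (@mean_atoms n (fun k => `|tnth w k| / W) (fun k => tnth x k)).
- by rewrite mulr_suml; apply: eq_bigr => k _; rewrite mulrAC.
- by move=> j; rewrite divr_ge0 // ltW.
- move=> A mA.
  have NE (m : {measure set R -> \bar R}) (P : probability R R) :
      m setT = W%:E -> mnormalize m P A = (m A * W^-1%:E)%E.
    by move=> mW; rewrite /mnormalize mW eqe gt_eqF.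
  transitivity (msum (weighted_atom w x) n A * W^-1%:E)%E; first exact: NE.
  rewrite E muleC ge0_sume_distrr; last by move=> k _; rewrite mule_ge0.
  by apply: eq_bigr => k _; rewrite muleA -EFinM [in RHS]mulrC.
Qed.

End finite_configurations.

Section support.
Context {R : realType}.
Local Notation bc := (bounded_continuous R).
Implicit Types mu : probability R R.

Lemma supp_compl_null mu : mu (~` supp mu) = 0%E /\ measurable (supp mu).
Proof.
have clS : closed (supp mu).
  rewrite -[supp mu]setCK; apply: open_closedC; rewrite openE => x /= /existsNP[U].
  move=> /not_implyP[oU /not_implyP[Ux mU]].
  rewrite /interior; apply: (filterS _ (open_nbhs_nbhs (conj oU Ux))) => y Uy /= /(_ U oU Uy).
  by [].
have mS : measurable (supp mu) by exact: closed_measurable.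
split => //.
pose B (q : rat * rat) : set R := `](ratr q.1), (ratr q.2)[%classic.
pose Z := \bigcup_(q in [set q | mu (B q) = 0%E]) B q.
have ZE : ~` supp mu `<=` Z.
  move=> x /= /existsNP[U] /not_implyP[oU /not_implyP[Ux /negP mU]].
  have mU0 : mu U = 0%E.
    by apply/eqP; rewrite eq_le measure_ge0 andbT leNgt.
  have [e e0 he] : exists2 e : R, 0 < e & forall y, `|x - y| < e -> U y.
    have : nbhs x U by exact: open_nbhs_nbhs.
    by rewrite -nbhs_ballE => -[e /= e0 he]; exists e.
  have [q1 hq1] : exists q : rat, ratr q \in `]x - e, x[ by apply: rat_in_itvoo; lra.
  have [q2 hq2] : exists q : rat, ratr q \in `]x, x + e[ by apply: rat_in_itvoo; lra.
  move: hq1 hq2; rewrite !in_itv /= => /andP[? ?] /andP[? ?].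
  exists (q1, q2); last by rewrite /B /= in_itv /=; apply/andP.
  apply/eqP; rewrite /= eq_le measure_ge0 andbT -mU0; apply: le_measure; rewrite ?inE //.
  - exact: measurable_itv.
  - exact: open_measurable.
  move=> y; rewrite /B /= in_itv /= => /andP[? ?]; apply: he.
  by apply/ltr_normlP; split; lra.
have Z0 : mu.-negligible Z.
  pose F k := if choice.unpickle k is Some q then (if mu (B q) == 0%E then B q else set0) else set0.
  have FN k : mu.-negligible (F k).
    rewrite /F; case: choice.unpickle => [q|]; last exact: negligible_set0.
    by case: eqP => [q0|_]; [apply/negligibleP => //; exact: measurable_itv|exact: negligible_set0].
  apply: negligibleS (negligible_bigcup FN) => x [q /= q0 xq].
  have [k kq] : exists k, choice.unpickle k = Some q by exists (choice.pickle q); exact: choice.pickleK.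
  exists k; [exact: I|rewrite /F kq].
  by case: eqP => [_|/(_ q0)].
apply/negligibleP; first exact: measurableC.
exact: negligibleS Z0.
Qed.

Lemma supp_meets mu (U : set R) : open U -> (0 < mu U)%E -> exists2 x, U x & supp mu x.
Proof.
move=> oU mU; apply/not_exists2P => h.
have [N mS] := supp_compl_null mu.
have : (mu U <= mu (~` supp mu))%E.
  apply: le_measure; rewrite ?inE; [exact: open_measurable|exact: measurableC|].
  by move=> x Ux Sx; case: (h x).
by rewrite N leNgt mU.
Qed.

Lemma supp_neq0 mu : supp mu !=set0.
Proof.
have [x _ h] : exists2 x, setT x & supp mu x; last by exists x.
by apply: supp_meets; [exact: openT|rewrite probability_setT lte01].
Qed.

Definition bump_fun (c e : R) (x : R) : R := Num.max 0 (1 - `|x - c| / e).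

Lemma bump_continuous c e : continuous (bump_fun c e).
Proof.
move=> x; apply: (@continuous_max _ _ (cst 0) (fun x => 1 - `|x - c| / e)); first exact: cvg_cst.
apply: cvgB; first exact: cvg_cst.
apply: cvgMl; apply: cvg_norm; apply: cvgB; [exact: cvg_id|exact: cvg_cst].
Qed.

Lemma bump_ge0 c e x : 0 <= bump_fun c e x. Proof. by rewrite le_max lexx. Qed.

Lemma bump_le1 c e x : 0 < e -> bump_fun c e x <= 1.
Proof. by move=> e0; rewrite ge_max ler01 /= lerBlDr lerDl divr_ge0 // ltW. Qed.

Lemma bump_bounded c e : 0 < e -> exists M : R, forall x, `|bump_fun c e x| <= M.
Proof. by move=> e0; exists 1 => x; rewrite ger0_norm ?bump_ge0 // bump_le1. Qed.

Definition bump c e (e0 : 0 < e) : bc :=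
  exist _ (bump_fun c e) (conj (@bump_continuous c e) (bump_bounded c e0)).

Lemma mean_bump_le (nu : M1 R) c e (e0 : 0 < e) :
  ((mean nu (bump c e0))%:E <= (nu : probability R R) (ball c e))%E.
Proof.
rewrite mean_EFin -[leRHS]mul1e -integral_cst; last exact: measurable_ball.
rewrite [leRHS]integral_mkcond; apply: ge0_le_integral => //.
- by move=> x _; rewrite lee_fin bump_ge0.
- by apply/measurable_EFinP; exact: bc_measurable.
- by apply/(measurable_restrictT _ (measurable_ball _ _)); exact: measurable_cst.
move=> x _; rewrite patchE; case: ifPn => [_|/negP xb]; first by rewrite lee_fin bump_le1.
rewrite lee_fin ge_max lexx /= subr_le0 ler_pdivlMr // mul1r leNgt distrC.
by apply/negP => h; apply: xb; rewrite inE.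
Qed.

Lemma mean_bump_gt0 (mu : M1 R) c e (e0 : 0 < e) : supp mu c -> 0 < mean mu (bump c e0).
Proof.
move=> cS; have e2 : 0 < e / 2 by rewrite divr_gt0.
have mb : (0 < (mu : probability R R) (ball c (e / 2)))%E.
  by apply: cS; [exact: ball_open|exact: ballxx].
rewrite -lte_fin mean_EFin.
apply: (@lt_le_trans _ _ ((2^-1)%:E * (mu : probability R R) (ball c (e / 2)))%E).
  by rewrite mule_gt0 // lte_fin invr_gt0.
rewrite -integral_cst; last exact: measurable_ball.
rewrite integral_mkcond; apply: ge0_le_integral => //.
- by move=> x _; apply: erestrict_ge0 => y _; rewrite lee_fin invr_ge0.
- by apply/(measurable_restrictT _ (measurable_ball _ _)); exact: measurable_cst.
- by apply/measurable_EFinP; exact: bc_measurable.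
move=> x _; rewrite patchE; case: ifPn => [|_]; last by rewrite lee_fin bump_ge0.
rewrite inE /ball /= distrC => h; rewrite lee_fin le_max; apply/orP; right.
by rewrite lerBrDr -lerBrDl ler_pdivrMr //; lra.
Qed.

Lemma mean_continuous (f : bc) : continuous (fun nu : M1 R => mean nu f).
Proof.
move=> nu; have h : nbhs nu --> nu by [].
exact: (proj1 (M1_cvgP nu (nbhs_filter nu)) h f).
Qed.

Lemma supp_neighbourhood (mu : M1 R) (s : seq R) (e : R) : 0 < e ->
  (forall x, x \in s -> supp mu x) ->
  exists (G : set (M1 R)) (dl : R), [/\ open G, G mu, 0 < dl &
    forall nu, G nu -> forall x, x \in s -> (dl%:E < (nu : probability R R) (ball x e))%E].
Proof.
move=> e0; elim: s => [_|x s ih sS].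
  by exists setT, 1; split => //; exact: openT.
have [|G [dl [oG Gmu d0 GP]]] := ih; first by move=> y ys; apply: sS; rewrite inE ys orbT.
have m0 : 0 < mean mu (bump x e0) by apply: mean_bump_gt0; apply: sS; rewrite inE eqxx.
set m := mean mu _ in m0.
pose G' := [set nu : M1 R | m / 2 < mean nu (bump x e0)].
have oG' : open G'.
  have -> : G' = (fun nu : M1 R => mean nu (bump x e0)) @^-1` [set y | m / 2 < y] by [].
  apply: open_comp; last exact: open_gt.
  move=> nu _; exact: mean_continuous.
exists (G `&` G'), (Num.min dl (m / 2)); split.
- exact: openI.
- by split => //; rewrite /G' /= -/m; lra.
- by rewrite lt_min d0 divr_gt0.
move=> nu [Gnu G'nu] y; rewrite inE => /predU1P[->|ys].
  apply: lt_le_trans (mean_bump_le nu x e0); rewrite lte_fin.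
  by apply: le_lt_trans G'nu; rewrite ge_min lexx orbT.
apply: le_lt_trans (GP _ Gnu _ ys); rewrite lee_fin.
by rewrite ge_min lexx.
Qed.

End support.

Section finite_subfamilies.
Context {R : realType}.

Lemma finite_set_uniq (T : choiceType) (A : set T) : finite_set A ->
  exists2 s : seq T, uniq s & A = [set` s].
Proof.
move=> /finite_seqP[s ->]; exists (undup s); first exact: undup_uniq.
by apply/seteqP; split => x /=; rewrite mem_undup.
Qed.

Lemma infinite_set_uniq (T : choiceType) (A : set T) (n : nat) : infinite_set A ->
  exists s : seq T, [/\ uniq s, (n <= size s)%N & forall x, x \in s -> A x].
Proof.
move=> /(@infinite_set_fset _ _ n)[B BA Bn]; exists (finmap.enum_fset B); split => //.
Qed.

Lemma counting_seq (T : choiceType) (s : seq T) : uniq s ->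
  counting [set` s] = (size s)%:R%:E :> \bar R.
Proof.
move=> us; rewrite /counting asboolT; last exact: finite_seq.
congr (_%:R%:E); apply: perm_size; apply: uniq_perm => //.
move=> x; rewrite in_fset_set; last exact: finite_seq.
by apply/idP/idP; rewrite inE.
Qed.

Lemma counting_infinite (T : choiceType) (A : set T) : infinite_set A ->
  counting A = +oo%E :> \bar R.
Proof. by move=> iA; rewrite /counting asboolF. Qed.

Lemma counting_ge_seq (T : choiceType) (A : set T) (s : seq T) : uniq s ->
  (forall x, x \in s -> A x) -> ((size s)%:R%:E <= counting A :> \bar R)%E.
Proof.
move=> us sA; have [/finite_set_uniq[t ut tE]|iA] := pselect (finite_set A); last first.
  by rewrite counting_infinite ?leey.
rewrite tE counting_seq // lee_fin ler_nat; apply: uniq_leq_size => // x /sA.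
by rewrite tE.
Qed.

Lemma esum_ge_seq (T : choiceType) (A : set T) (s : seq T) (F : T -> R) : uniq s ->
  (forall x, x \in s -> A x) -> ((\sum_(x <- s) F x)%:E <= \esum_(x in A) (F x)%:E)%E.
Proof.
move=> us sA; apply: esum_ge; exists [set` s].
  by split; [exact: finite_seq|move=> x /= /sA].
by rewrite -(fsbig_seq _ _ us) sumEFin.
Qed.

Lemma esum_gt_seq (T : choiceType) (A : set T) (F : T -> R) (a : \bar R) :
  (a < \esum_(x in A) (F x)%:E)%E ->
  exists s : seq T, [/\ uniq s, forall x, x \in s -> A x & (a < (\sum_(x <- s) F x)%:E)%E].
Proof.
move=> /ereal_sup_gt[_ [X [/finite_set_uniq[s us ->] sA] <-]].
rewrite -(fsbig_seq _ _ us) sumEFin => h; exists s; split => // x xs.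
Qed.

Lemma seq_pos_lb (l : seq R) : (forall x, x \in l -> 0 < x) ->
  exists2 e : R, 0 < e & forall x, x \in l -> 2 * e < x.
Proof.
elim: l => [_|y l ih h]; first by exists 1.
have [|e e0 he] := ih; first by move=> x xl; apply: h; rewrite inE xl orbT.
have y0 : 0 < y by apply: h; rewrite inE eqxx.
exists (Num.min e (y / 3)); first by rewrite lt_min e0 divr_gt0.
move=> x; rewrite inE => /predU1P[->|xl].
  have : Num.min e (y / 3) <= y / 3 by rewrite ge_min lexx orbT.
  by lra.
apply: le_lt_trans (he x xl); rewrite ler_pM2l // ge_min lexx //.
Qed.

End finite_subfamilies.

Section rate_function.
Context {R : realType}.
Variable xi : \bar R.
Hypothesis xi0 : (0 <= xi)%E.
Implicit Types (mu : M1 R) (s : seq R).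

Definition cost s : \bar R :=
  ((size s).-1%:R%:E * xi + (2^-1 * \sum_(x <- s) x ^+ 2)%:E)%E.

Lemma sumsq_ge0 s : 0 <= \sum_(x <- s) x ^+ 2.
Proof. by apply: sumr_ge0 => x _; exact: sqr_ge0. Qed.

Lemma cost_le_rate s mu : uniq s -> s != [::] -> (forall x, x \in s -> supp mu x) ->
  (cost s <= ldp_rate xi mu)%E.
Proof.
move=> us sn0 sS; rewrite /ldp_rate; case: asboolP => [cS|_]; last exact: leey.
apply: leeD; last first.
  rewrite EFinM; apply: lee_wpmul2l; first by rewrite lee_fin invr_ge0.
  exact: esum_ge_seq.
apply: lee_wpmul2r => //.
have := @counting_ge_seq R _ _ _ us sS.
case: s sn0 {us sS} => //= x s _; case: (counting (supp mu)) => [c| |] //=.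
  by rewrite !lee_fin -natr1 => h; rewrite lerBrDr.
by rewrite ?leey ?leeNy_eq.
Qed.

Lemma cost_ge s : s != [::] -> ((2^-1 * \sum_(x <- s) x ^+ 2)%:E <= cost s)%E.
Proof. by move=> _; rewrite /cost leeDr // mule_ge0. Qed.

Lemma cost_many s (n : nat) (a : R) : (0 < xi)%E -> (n < size s)%N -> (0 < n)%N ->
  (a%:E < n%:R%:E * xi)%E -> (a%:E < cost s)%E.
Proof.
move=> xi_gt0 ns n0 h; apply: lt_le_trans h _; rewrite /cost.
rewrite -[leLHS]adde0; apply: leeD; last by rewrite lee_fin mulr_ge0 ?invr_ge0 ?sumsq_ge0.
by apply: lee_wpmul2r => //; rewrite lee_fin ler_nat; case: (size s) ns.
Qed.

Lemma infinite_supp_cost mu (a : R) : (0 < xi)%E -> infinite_set (supp mu) ->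
  exists s, [/\ uniq s, s != [::], forall x, x \in s -> supp mu x & (a%:E < cost s)%E].
Proof.
move=> xi_gt0 iS.
have [n [n0 an]] : exists n : nat, (0 < n)%N /\ (a%:E < n%:R%:E * xi)%E.
  move: xi_gt0; case: xi => [z| |] //; last by exists 1%N; rewrite mul1e ltry.
  rewrite lte_fin => z0; exists (Num.truncn (`|a| / z)).+1; split => //.
  rewrite -EFinM lte_fin -ltr_pdivrMr //.
  apply: le_lt_trans (truncnS_gt _); rewrite ler_wpM2r ?invr_ge0 ?(ltW z0) //.
  exact: ler_norm.
have [s [us ns sS]] := infinite_set_uniq n.+1 iS.
exists s; split => //; first by case: (s) ns.
exact: cost_many an.
Qed.

Lemma finite_supp_rate mu s : uniq s -> supp mu = [set` s] -> ldp_rate xi mu = cost s.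
Proof.
move=> us sE; have sn0 : s != [::].
  have [x] := supp_neq0 mu; rewrite sE; by case: (s).
rewrite /ldp_rate asboolT; last by rewrite sE; exact/finite_set_countable/finite_seq.
rewrite sE counting_seq // /cost; congr (_ * _ + _)%E.
  by case: (s) sn0 => //= x s' _; rewrite -natr1 -EFinB addrK.
rewrite esum_fset; [|exact: finite_seq|by move=> x _; rewrite lee_fin sqr_ge0].
by rewrite -(fsbig_seq _ _ us) sumEFin -EFinM.
Qed.

Lemma uncountable_sumsq mu (a : R) : ~ countable (supp mu) ->
  exists s, [/\ uniq s, s != [::], forall x, x \in s -> supp mu x & a < 2^-1 * \sum_(x <- s) x ^+ 2].
Proof.
move=> nc.
have [m im] : exists m : nat, infinite_set (supp mu `&` [set x | m.+1%:R^-1 < `|x|]).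
  apply: contrapT => /forallNP h; apply: nc.
  apply: (@sub_countable _ _ _ (\bigcup_m ([set 0] `|` (supp mu `&` [set x | m.+1%:R^-1 < `|x|])))).
    apply: subset_card_le => x Sx.
    have [->|x0] := eqVneq x 0; first by exists 0%N => //; left.
    exists (Num.truncn (`|x|^-1)) => //; right; split => //=.
    by rewrite invf_plt ?posrE ?normr_gt0 // truncnS_gt.
  apply: bigcup_countable => // m _; apply: finite_set_countable; rewrite finite_setU.
  by split; [exact: finite_set1|apply: contrapT; exact: h].
pose n := (Num.truncn (2 * `|a| * m.+1%:R ^+ 2)).+1.
have [s [us ns sS]] := infinite_set_uniq n im.
exists s; split => //; first by case: (s) ns.
  by move=> x /sS[].
have : \sum_(x <- s) (m.+1%:R^-1 ^+ 2 : R) <= \sum_(x <- s) x ^+ 2.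
  rewrite big_seq [leRHS]big_seq; apply: ler_sum => x /sS[_ /= hx].
  by rewrite -[leRHS]real_normK ?num_real // lerXn2r ?nnegrE ?(ltW hx).
rewrite big_const_seq count_predT iter_addr_0 -[X in X <= _ -> _]mulr_natr => h.
have m2 : 0 < m.+1%:R ^+ 2 :> R by rewrite exprn_gt0.
have h2 : 2 * `|a| * m.+1%:R ^+ 2 < (size s)%:R.
  by apply: lt_le_trans (truncnS_gt _) _; rewrite ler_nat.
have h3 : 2 * `|a| < m.+1%:R^-1 ^+ 2 * (size s)%:R.
  by rewrite exprVn [ltRHS]mulrC ltr_pdivlMr.
by have := ler_norm a; have := lt_le_trans h3 h; lra.
Qed.

Lemma rate_gt mu (a : R) : (a%:E < ldp_rate xi mu)%E ->
  exists s, [/\ uniq s, s != [::], forall x, x \in s -> supp mu x & (a%:E < cost s)%E].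
Proof.
move=> ha.
have [/finite_set_uniq[s us sE]|iS] := pselect (finite_set (supp mu)).
  exists s; split => //.
  - by have [x] := supp_neq0 mu; rewrite sE; case: (s).
  - by move=> x; rewrite sE.
  - by rewrite -(finite_supp_rate us sE).
move: (xi0); rewrite le_eqVlt => /predU1P[xiE|xi_gt0]; last exact: infinite_supp_cost.
have costE s : cost s = (2^-1 * \sum_(x <- s) x ^+ 2)%:E by rewrite /cost -xiE mule0 add0e.
have [cS|/uncountable_sumsq h] := pselect (countable (supp mu)); last first.
  by have [s [? ? ? h2]] := h a; exists s; split => //; rewrite costE lte_fin.
move: ha; rewrite /ldp_rate asboolT // -xiE mule0 add0e => ha.
have : ((2 * a)%:E < \esum_(x in supp mu) (x ^+ 2)%:E)%E.
  rewrite EFinM; move: ha; case: (\esum_(x in supp mu) _)%E => [z| |].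
  - by rewrite -!EFinM !lte_fin; lra.
  - by rewrite ltry.
  - by rewrite gt0_muleNy // lte_fin invr_gt0.
move=> /esum_gt_seq[s [us sS hs]].
have [x0 Sx0] := supp_neq0 mu.
have [sn|sn] := eqVneq s [::].
  exists [:: x0]; split => //; first by move=> x; rewrite inE => /eqP ->.
  rewrite costE lte_fin big_seq1; move: hs; rewrite sn big_nil lte_fin => hs.
  by have := sqr_ge0 x0; lra.
by exists s; split => //; rewrite costE lte_fin; move: hs; rewrite lte_fin; lra.
Qed.

(* the cost after every atom has moved by at most e *)
Definition cost_near s (e : R) : \bar R :=
  ((size s).-1%:R%:E * xi + (2^-1 * \sum_(x <- s) (Num.max 0 (`|x| - e)) ^+ 2)%:E)%E.

Lemma cost_near_gt s (a : R) : uniq s -> (a%:E < cost s)%E ->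
  exists2 e : R, 0 < e & (a%:E < cost_near s e)%E /\
    forall x y, x \in s -> y \in s -> x != y -> 2 * e < `|x - y|.
Proof.
move=> us ha.
have [e1 e10 h1] : exists2 e : R, 0 < e & forall e', 0 < e' <= e -> (a%:E < cost_near s e')%E.
  have [[k kE]|knf] := pselect (exists k, (size s).-1%:R%:E * xi = k%:E)%E; last first.
    exists 1 => // e' _; rewrite /cost_near.
    have -> : ((size s).-1%:R%:E * xi = +oo)%E.
      have : (0 <= (size s).-1%:R%:E * xi)%E by rewrite mule_ge0.
      by move: knf; case: (_ * xi)%E => // k [] //; exists k.
    by rewrite addye // ltry.
  move: ha; rewrite /cost kE -EFinD lte_fin => ha.
  pose F e := k + 2^-1 * \sum_(x <- s) (Num.max 0 (`|x| - e)) ^+ 2.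
  have F0 : F 0 = k + 2^-1 * \sum_(x <- s) x ^+ 2.
    congr (_ + _ * _); apply: eq_bigr => x _.
    by rewrite subr0 max_r // real_normK ?num_real.
  have cF : continuous F.
    move=> e; apply: cvgD; first exact: cvg_cst.
    apply: cvgM; first exact: cvg_cst.
    elim: s {us ha kE F F0} => [|x t ih].
      by rewrite big_nil; under eq_fun do rewrite big_nil; exact: cvg_cst.
    rewrite big_cons; under eq_fun do rewrite big_cons.
    apply: cvgD => //.
    have cm : (fun e => Num.max 0 (`|x| - e)) x0 @[x0 --> e] --> Num.max 0 (`|x| - e).
      apply: (@continuous_max _ _ (cst 0) (fun e => `|x| - e)); first exact: cvg_cst.
      by apply: cvgB; [exact: cvg_cst|exact: cvg_id].
    by rewrite expr2; under eq_fun do rewrite expr2; apply: cvgM.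
  have := cF 0 => /cvgrPdist_lt /(_ (F 0 - a)); rewrite subr_gt0 F0 => /(_ ha).
  rewrite nearE => -[d /= d0 hd]; exists (d / 2); first by rewrite divr_gt0.
  move=> e' /andP[e'0 e'd]; rewrite /cost_near kE -EFinD lte_fin -/(F e').
  have /hd : ball 0 d e' by rewrite /ball /= sub0r normrN gtr0_norm //; lra.
  by move=> /=; move=> /ltr_normlP[]; lra.
have [e2 e20 h2] : exists2 e : R, 0 < e & forall x y, x \in s -> y \in s -> x != y -> 2 * e < `|x - y|.
  pose P := [seq p <- [seq (x, y) | x <- s, y <- s] | p.1 != p.2].
  have PP x y : x \in s -> y \in s -> x != y -> `|x - y| \in [seq `|p.1 - p.2| | p <- P].
    move=> xs ys xy; apply/mapP; exists (x, y) => //.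
    by rewrite mem_filter xy /=; apply/allpairsP; exists (x, y).
  have [|e e0 he] := seq_pos_lb (l := [seq `|p.1 - p.2| | p <- P]).
    by move=> z /mapP[p]; rewrite mem_filter => /andP[pn _] ->; rewrite normr_gt0 subr_eq0.
  by exists e => // x y xs ys xy; exact: he (PP _ _ xs ys xy).
exists (Num.min e1 e2); first by rewrite lt_min e10.
split; first by apply: h1; rewrite lt_min e10 e20 ge_min lexx.
move=> x y xs ys xy; apply: le_lt_trans (h2 x y xs ys xy).
by rewrite ler_pM2l // ge_min lexx orbT.
Qed.

(* every measure close to mu charges each ball, hence costs at least cost_near *)
Lemma cost_near_le_rate (nu : M1 R) s e : 0 < e -> s != [::] -> uniq s ->
  (forall x y, x \in s -> y \in s -> x != y -> 2 * e < `|x - y|) ->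
  (forall x, x \in s -> (0 < (nu : probability R R) (ball x e))%E) ->
  (cost_near s e <= ldp_rate xi nu)%E.
Proof.
move=> e0 sn0 us sep nus.
have /choice[g gP] : forall x, exists y, x \in s -> ball x e y /\ supp nu y.
  move=> x; have [xs|xs] := boolP (x \in s); last by exists 0.
  by have [y xy Sy] := supp_meets (ball_open _ _) (nus x xs); exists y.
have gd x : x \in s -> `|x - g x| < e by move=> /gP[].
have ug : uniq (map g s).
  rewrite map_inj_in_uniq // => x y xs ys gE; apply/eqP; apply: contraT => xy.
  have := sep x y xs ys xy; rewrite ltNge => /negP h; exfalso; apply: h.
  have -> : x - y = (x - g x) - (y - g y) by rewrite gE; ring.
  by apply: le_trans (ler_normB _ _) _; have := gd x xs; have := gd y ys; lra.
apply: le_trans (cost_le_rate ug _ _).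
- rewrite /cost_near /cost size_map; apply: leeD => //; rewrite lee_fin ler_wpM2l ?invr_ge0 //.
  rewrite big_map [leLHS]big_seq [leRHS]big_seq; apply: ler_sum => x xs.
  rewrite -[leRHS]real_normK ?num_real // lerXn2r ?nnegrE ?le_max ?lexx //.
  rewrite ge_max normr_ge0 /=.
  have := ler_normD (g x) (x - g x); rewrite addrC subrK => h.
  by have := gd x xs; lra.
- by case: (s) sn0.
- by move=> y /mapP[x xs ->]; case: (gP x xs).
Qed.

Lemma rate_neighbourhood (mu : M1 R) (a : R) : (a%:E < ldp_rate xi mu)%E ->
  exists s e dl (G : set (M1 R)),
    [/\ uniq s, s != [::], 0 < e, 0 < dl & open G] /\ G mu /\
    (a%:E < cost_near s e)%E /\
    (forall x y, x \in s -> y \in s -> x != y -> 2 * e < `|x - y|) /\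
    (forall nu, G nu -> forall x, x \in s -> (dl%:E < (nu : probability R R) (ball x e))%E).
Proof.
move=> /rate_gt[s [us sn0 sS hs]].
have [e e0 [he sep]] := cost_near_gt us hs.
have [G [dl [oG Gmu d0 GP]]] := supp_neighbourhood e0 sS.
by exists s, e, dl, G.
Qed.

Lemma rate_ge0 (mu : M1 R) : (0 <= ldp_rate xi mu)%E.
Proof.
have [x Sx] := supp_neq0 mu.
apply: le_trans (@cost_le_rate [:: x] mu _ _ _) => //; last by move=> y; rewrite inE => /eqP ->.
by rewrite /cost /= mul0e add0e lee_fin mulr_ge0 ?invr_ge0 ?sumsq_ge0.
Qed.

Lemma rate_lsc : lower_semicontinuous (ldp_rate xi : M1 R -> \bar R).
Proof.
move=> mu a ha.
have [s [e [dl [G [[us sn0 e0 d0 oG] [Gmu [he [sep GP]]]]]]]] := rate_neighbourhood ha.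
exists G; first exact: open_nbhs_nbhs.
move=> nu Gnu; apply: lt_le_trans he _; apply: cost_near_le_rate => // x xs.
by apply: lt_trans (GP _ Gnu _ xs); rewrite lte_fin.
Qed.

End rate_function.

Section configurations.
Context {R : realType}.
Local Notation bc := (bounded_continuous R).

(* a configuration lists the pairs (weight, atom) *)
Definition good_conf (c : seq (R * R)) :=
  (forall p, p \in c -> 0 < p.1) /\ \sum_(p <- c) p.1 = 1.

Definition conf_measure (c : seq (R * R)) : M1 R :=
  weighted_dirac [tuple of map fst (in_tuple c)] [tuple of map snd (in_tuple c)].

Lemma conf_measureE c (A : set R) : good_conf c ->
  (conf_measure c : probability R R) A =
  (\sum_(k < size c) (tnth (in_tuple c) k).1%:E * \d_((tnth (in_tuple c) k).2) A)%E.
Proof.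
move=> [c0 c1]; rewrite /conf_measure weighted_diracE.
- by apply: eq_bigr => k _; rewrite !tnth_map.
- by move=> k; rewrite tnth_map ltW // c0 // mem_tnth.
- by rewrite -c1 [RHS]big_tnth; apply: eq_bigr => k _; rewrite tnth_map.
Qed.

Lemma conf_mean c (f : bc) : good_conf c -> mean (conf_measure c) f = \sum_(p <- c) p.1 * sval f p.2.
Proof.
move=> gc; have [c0 c1] := gc; rewrite [RHS]big_tnth.
apply: (@mean_atoms R (size c) (fun k => (tnth (in_tuple c) k).1) (fun k => (tnth (in_tuple c) k).2)).
- by move=> k; rewrite ltW // c0 // mem_tnth.
- by move=> A _; exact: conf_measureE.
Qed.

Lemma measure_finite_set (mu : {measure set R -> \bar R}) (s : seq R) (A : set R) : uniq s ->
  measurable A -> mu (A `&` [set` s]) = (\sum_(x <- s) mu [set x] * \d_x A)%E.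
Proof.
move=> + mA; elim: s => [_|x s ih /= /andP[xs us]].
  by rewrite big_nil (_ : _ `&` _ = set0) ?measure0 //; apply/seteqP; split => // x [].
rewrite big_cons -ih //.
have -> : A `&` [set` x :: s] = (A `&` [set x]) `|` (A `&` [set` s]).
  apply/seteqP; split => y.
    by case=> Ay; rewrite /= in_cons => /predU1P[yx|ys]; [left|right].
  by case=> -[Ay ys]; split => //=; rewrite in_cons; [apply/orP; left; apply/eqP|apply/orP; right].
have ms : measurable [set` s] by apply: countable_measurable; [exact: measurable_set1|exact/finite_set_countable/finite_seq].
rewrite measureU; first last.
- apply/seteqP; split => // y [[_ ->] [_ /= h]]; by rewrite h in xs.
- exact: measurableI.
- by apply: measurableI => //; exact: measurable_set1.
congr (_ + _)%E; rewrite diracE; case: (boolP (x \in A)) => xA.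
  by rewrite mule1; congr (mu _); apply/seteqP; split => [y [_ ->]|y ->] //; split => //; exact: set_mem.
rewrite mule0 (_ : _ `&` _ = set0) ?measure0 //; apply/seteqP; split => // y [Ay yx].
by move: xA; rewrite -yx mem_set.
Qed.

Variable xi : \bar R.
Hypothesis xi0 : (0 <= xi)%E.

Lemma cost_mono (s s' : seq R) : ((size s).-1 <= (size s').-1)%N ->
  \sum_(x <- s) x ^+ 2 <= \sum_(x <- s') x ^+ 2 -> (cost xi s <= cost xi s')%E.
Proof.
move=> h1 h2; apply: leeD; last by rewrite lee_fin ler_wpM2l ?invr_ge0.
by apply: lee_wpmul2r => //; rewrite lee_fin ler_nat.
Qed.

Lemma finite_far_supp (mu : M1 R) (M r : R) : (ldp_rate xi mu <= M%:E)%E -> 0 < r ->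
  finite_set (supp mu `&` [set x | r < `|x|]).
Proof.
move=> hM r0; apply: contrapT => iS.
pose n := (Num.truncn (2 * `|M| / r ^+ 2)).+1.
have [s [us ns sS]] := infinite_set_uniq n iS.
have sn0 : s != [::] by case: (s) ns.
have := le_trans (cost_ge xi0 sn0) (le_trans (cost_le_rate xi0 us sn0 (fun x xs => proj1 (sS x xs))) hM).
rewrite lee_fin.
have : \sum_(x <- s) r ^+ 2 <= \sum_(x <- s) x ^+ 2.
  rewrite [leLHS]big_seq [leRHS]big_seq; apply: ler_sum => x /sS[_ /= hx].
  by rewrite -[leRHS]real_normK ?num_real // lerXn2r ?nnegrE ?(ltW hx) ?(ltW r0).
rewrite big_const_seq count_predT iter_addr_0 -[X in X <= _ -> _]mulr_natr => h h'.
have h2 : 2 * `|M| / r ^+ 2 < (size s)%:R.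
  by apply: lt_le_trans (truncnS_gt _) _; rewrite ler_nat.
move: h2; rewrite ltr_pdivrMr ?exprn_gt0 // [X in _ < X]mulrC => h2.
by have := lt_le_trans h2 h; have := ler_norm M; lra.
Qed.

Lemma conf_approx_one (mu : M1 R) (M r : R) : (ldp_rate xi mu <= M%:E)%E -> 0 < r ->
  exists c, [/\ good_conf c, (cost xi (map snd c) <= ldp_rate xi mu)%E &
    forall (f : bc) e, (forall x, `|x| <= r -> `|sval f x - sval f 0| <= e) ->
      `|mean mu f - mean (conf_measure c) f| <= e].
Proof.
move=> hM r0; have [s us sE] := finite_set_uniq (finite_far_supp hM r0).
have sS x : x \in s -> supp mu x.
  by move=> xs; have [] : (supp mu `&` [set x | r < `|x|]) x by rewrite sE.
have sr x : x \in s -> r < `|x|.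
  by move=> xs; have [] : (supp mu `&` [set x | r < `|x|]) x by rewrite sE.
have [N mS] := supp_compl_null mu.
have mfar : measurable [set x : R | r < `|x|].
  rewrite (_ : [set _ | _] = (fun x : R => `|x|) @^-1` `]r, +oo[%classic).
    rewrite -[X in measurable X]setTI; apply: (@normr_measurable R setT) => //; exact: measurable_itv.
  by apply/seteqP; split => x /=; rewrite in_itv /= andbT.
pose D := ~` [set x : R | r < `|x|].
have mD : measurable D by exact: measurableC.
pose P := (mu : probability R R).
pose q x := fine (P [set x]).
have qE x : P [set x] = (q x)%:E.
  by rewrite /q fineK //; apply: fin_num_measure; exact: measurable_set1.
have q0 x : 0 <= q x by rewrite -lee_fin -qE.
pose rho : {measure set R -> \bar R} := mrestr P mD.
have PE A : measurable A -> P A = (\sum_(x <- s) (q x)%:E * \d_x A + rho A)%E.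
  move=> mA; rewrite /rho /= /mrestr.
  have -> : (\sum_(x <- s) (q x)%:E * \d_x A)%E = P (A `&` [set` s]).
    by rewrite measure_finite_set //; apply: eq_bigr => x _; rewrite -qE.
  rewrite -sE.
  have mAf : measurable (A `&` (supp mu `&` [set x | r < `|x|])) by do ?apply: measurableI.
  have mAD : measurable (A `&` D) by apply: measurableI.
  rewrite -measureU //; last first.
    by apply/seteqP; split => // x [[_ [_ h]] [_ /(_ h)]].
  apply/eqP; rewrite eq_le; apply/andP; split; last first.
    apply: le_measure; rewrite ?inE //; first exact: measurableU.
    by move=> x [[]|[]].
  apply: (@le_trans _ _ (P ((A `&` (supp mu `&` [set x | r < `|x|]) `|` A `&` D) `|` ~` supp mu))).
    apply: le_measure; rewrite ?inE //; first by do 2?apply: measurableU => //; exact: measurableC.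
    move=> x Ax; have [Sx|] := pselect (supp mu x); last by right.
    by left; have [xr|xr] := pselect (r < `|x|); [left|right].
  apply: le_trans (measureU2 _ _ _) _; [exact: measurableU|exact: measurableC|].
  by rewrite [X in (_ + X)%E]N adde0.
pose t := 1 - \sum_(x <- s) q x.
have rhoT : rho setT = t%:E.
  have := PE setT measurableT; rewrite [X in X = _ -> _]probability_setT.
  under eq_bigr do rewrite diracT mule1.
  rewrite sumEFin /t; case: (rho setT) => [z| |] //= -[->]; congr EFin; ring.
have t0 : 0 <= t by rewrite -lee_fin -rhoT.
have PDt : P D = t%:E by rewrite -rhoT /rho /= /mrestr setTI.
have approx (f : bc) e : (forall x, `|x| <= r -> `|sval f x - sval f 0| <= e) ->
    `|mean mu f - sval f 0 - \sum_(x <- s) q x * (sval f x - sval f 0)| <= e.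
  move=> he; have e0 : 0 <= e by have := he 0; rewrite normr0 subrr normr0; apply; exact: ltW.
  have := @mean_atoms_approx R mu f (size s) (fun k => q (nth 0 s k)) (nth 0 s) rho r e (fun k => q0 _).
  rewrite -(big_mkord xpredT (fun k => q (nth 0 s k) * (sval f (nth 0 s k) - sval f 0))).
  rewrite -(big_mkord xpredT (fun k => q (nth 0 s k))).
  rewrite -(big_nth 0 xpredT (fun x => q x * (sval f x - sval f 0))) -(big_nth 0 xpredT q) -/t => h.
  apply: le_trans (h _ _ he) _.
  - move=> A mA; rewrite [LHS]PE //; congr (_ + _)%E.
    by rewrite (big_nth 0) big_mkord.
  - by rewrite /rho /= /mrestr setICr measure0.
  - by rewrite -[leRHS]mulr1 ler_wpM2l // lerBlDr lerDl; apply: sumr_ge0.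
pose c' := [seq (q x, x) | x <- s & 0 < q x].
pose c := (if 0 < t then [:: (t, 0)] else [::]) ++ c'.
have sumc (F : R -> R) : \sum_(p <- c) p.1 * F p.2 = t * F 0 + \sum_(x <- s) q x * F x.
  rewrite /c big_cat /=; congr (_ + _).
    case: ifPn => [_|]; first by rewrite big_seq1.
    rewrite -leNgt => t1; have -> : t = 0 by apply/eqP; rewrite eq_le t1.
    by rewrite big_nil mul0r.
  rewrite /c' big_map big_filter big_mkcond; apply: eq_bigr => x _; case: ifPn => //.
  rewrite -leNgt => h; have -> : q x = 0 by apply/eqP; rewrite eq_le h q0.
  by rewrite mul0r.
have gc : good_conf c.
  split.
    move=> p; rewrite mem_cat => /orP[|].
      by case: ifP => // t1; rewrite inE => /eqP ->.
    by move=> /mapP[x]; rewrite mem_filter => /andP[? _] ->.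
  have := sumc (fun=> 1); under eq_bigr do rewrite mulr1.
  by move=> ->; under eq_bigr do rewrite mulr1; rewrite mulr1 subrK.
have sn_t : t = 0 -> s != [::].
  by move=> tE; apply/eqP => sn; move: tE; rewrite /t sn big_nil subr0 => /eqP; rewrite oner_eq0.
have sz' : (size c' <= size s)%N by rewrite size_map size_filter count_size.
have sq' : \sum_(x <- map snd c') x ^+ 2 <= \sum_(x <- s) x ^+ 2.
  rewrite big_map big_map big_filter big_mkcond; apply: ler_sum => x _.
  by case: ifP => //; rewrite sqr_ge0.
exists c; split => //; last first.
  move=> f e he; rewrite conf_mean // sumc.
  have -> : t * sval f 0 + \sum_(x <- s) q x * sval f x = sval f 0 + \sum_(x <- s) q x * (sval f x - sval f 0).
    under [in RHS]eq_bigr do rewrite mulrBr.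
    by rewrite sumrB -mulr_suml /t; ring.
  by rewrite opprD addrA; exact: approx.
have [tp|] := boolP (0 < t); last first.
  rewrite -leNgt => t1; have tE : t = 0 by apply/eqP; rewrite eq_le t1.
  have cE : c = c' by rewrite /c tE ltxx.
  apply: le_trans (cost_le_rate xi0 us (sn_t tE) sS); rewrite cE.
  apply: cost_mono => //; rewrite -!subn1; apply: leq_sub2r.
  by rewrite [leqLHS]size_map; exact: sz'.
have cE : c = (t, 0) :: c' by rewrite /c tp.
have [y Dy Sy] : exists2 y, D y & supp mu y.
  apply/not_exists2P => h; have : (P D <= P (~` supp mu))%E.
    apply: le_measure; rewrite ?inE //; first exact: measurableC.
    by move=> x Dx Sx; case: (h x).
  by rewrite [leRHS]N PDt lee_fin leNgt tp.
have ys : y \notin s by apply/negP => /sr h; apply: Dy.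
apply: le_trans (@cost_le_rate _ _ xi0 (y :: s) mu _ _ _) => //.
- rewrite cE /=; apply: cost_mono; first by rewrite /= size_map.
  by rewrite /= !big_cons expr0n /= add0r (le_trans sq') // lerDr sqr_ge0.
- by rewrite /= ys us.
- by move=> x; rewrite inE => /predU1P[->//|/sS].
Qed.

Lemma conf_approx (mu : M1 R) (M : R) : (ldp_rate xi mu <= M%:E)%E ->
  exists c : nat -> seq (R * R),
    [/\ forall m, good_conf (c m), forall m, (cost xi (map snd (c m)) <= ldp_rate xi mu)%E &
       (fun m => conf_measure (c m)) @ \oo --> mu].
Proof.
move=> hM; pose r (m : nat) : R := m.+1%:R^-1.
have r0 m : 0 < r m by rewrite invr_gt0.
have /choice[c cP] : forall m, exists c, [/\ good_conf c, (cost xi (map snd c) <= ldp_rate xi mu)%E &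
    forall (f : bc) e, (forall x, `|x| <= r m -> `|sval f x - sval f 0| <= e) ->
      `|mean mu f - mean (conf_measure c) f| <= e].
  by move=> m; exact: conf_approx_one hM (r0 m).
exists c; split; [by move=> m; case: (cP m)|by move=> m; case: (cP m)|].
apply/M1_cvgP => f; apply/cvgrPdist_le => e e0.
have [N hN] := @osc_small R r (fun k => ltW (r0 k)) (@cvg_harmonic R) f e e0.
exists N => // m /= Nm; have [_ _] := cP m; apply => x xm; apply: hN.
by apply: le_trans xm _; rewrite lef_pV2 ?posrE // ler_nat.
Qed.

(* radii whose squares dominate those of any configuration of total square at most 2 M *)
Definition radius (M : R) (k : nat) : R := Num.sqrt (2 * M / Num.sqrt k.+1%:R).

Lemma radius_ge0 M k : 0 <= radius M k. Proof. exact: sqrtr_ge0. Qed.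

Lemma radius_sqr M k : 0 <= M -> radius M k ^+ 2 = 2 * M / Num.sqrt k.+1%:R.
Proof. by move=> M0; rewrite sqr_sqrtr // divr_ge0 ?sqrtr_ge0 // mulr_ge0. Qed.

Lemma radius_dec M m k : 0 <= M -> (m <= k)%N -> radius M k <= radius M m.
Proof.
move=> M0 mk; rewrite ler_wsqrtr // ler_wpM2l ?mulr_ge0 // lef_pV2 ?posrE ?sqrtr_gt0 //.
by rewrite ler_wsqrtr // ler_nat.
Qed.

Lemma radius_cvg M : 0 <= M -> radius M @ \oo --> 0.
Proof.
move=> M0.
have S0 : Num.sqrt x @[x --> (0 : R)] --> (0 : R).
  by have := @sqrt_continuous R 0; rewrite /continuous_at sqrtr0.
have h1 : (fun k : nat => Num.sqrt (k.+1%:R^-1 : R)) @ \oo --> (0 : R).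
  exact: (cvg_comp _ Num.sqrt (@cvg_harmonic R) S0).
have h2 : (fun k : nat => 2 * M * Num.sqrt (k.+1%:R^-1 : R)) @ \oo --> (2 * M * 0 : R).
  by apply: cvgM => //; exact: cvg_cst.
rewrite mulr0 in h2.
have := cvg_comp _ Num.sqrt h2 S0.
rewrite (_ : _ \o _ = radius M) //.
by apply/funext => k; rewrite /= /radius sqrtrV.
Qed.

Lemma radius_compact M : 0 <= M -> compact (shrinking (radius M)).
Proof.
move=> M0; apply: shrinking_compact; [exact: radius_ge0| |exact: radius_cvg].
by move=> m k; exact: radius_dec.
Qed.

Lemma conf_shrinking (c : seq (R * R)) (M : R) : 0 <= M -> good_conf c ->
  (cost xi (map snd c) <= M%:E)%E -> shrinking (radius M) (conf_measure c).
Proof.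
move=> M0 gc hc; have [c0 c1] := gc.
have cn0 : map snd c != [::].
  by case: (c) c1 => //; rewrite big_nil => /eqP; rewrite eq_sym oner_eq0.
have hs : \sum_(p <- c) p.2 ^+ 2 <= 2 * M.
  have := le_trans (cost_ge xi0 cn0) hc; rewrite lee_fin big_map; lra.
apply: (@finite_shrinking R (radius M) (size c) (fun k => (tnth (in_tuple c) k).1) (fun k => (tnth (in_tuple c) k).2)).
- exact: radius_ge0.
- by move=> m k; exact: radius_dec.
- by move=> k; rewrite ltW // c0 // mem_tnth.
- by rewrite -c1 [RHS]big_tnth.
- move=> k; rewrite leqNgt; apply/negP => hk.
  set S := [set j | _]%SET in hk.
  have [j jS] : exists j, j \in S by apply/set0Pn; rewrite -card_gt0; exact: leq_ltn_trans hk.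
  have sq j' : j' \in S -> radius M k ^+ 2 < (tnth (in_tuple c) j').2 ^+ 2.
    rewrite inE => hj; rewrite -[ltRHS]real_normK ?num_real // ltr_pXn2r ?nnegrE ?radius_ge0 //.
  have h1 : \sum_(j in S) radius M k ^+ 2 < 2 * M.
    apply: lt_le_trans hs; rewrite [ltRHS]big_tnth [ltRHS](bigID (mem S)) /= -[ltLHS]addr0; apply: ltr_leD.
      rewrite (bigD1 j) //= [ltRHS](bigD1 j) //=; apply: ltr_leD; first exact: sq.
      by apply: ler_sum => i /andP[/sq /ltW].
    by apply: sumr_ge0 => i _; exact: sqr_ge0.
  have sk : 0 < Num.sqrt k.+1%:R :> R by rewrite sqrtr_gt0.
  move: h1; rewrite sumr_const radius_sqr // -[ltLHS]mulr_natr => h1.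
  have skS : Num.sqrt k.+1%:R <= k.+1%:R :> R.
    rewrite -[leRHS]sqr_sqrtr // expr2 ler_peMl // ?sqrtr_ge0 //.
    by rewrite -[leLHS]sqrtr1 ler_wsqrtr // ler1n.
  have : 2 * M <= 2 * M / Num.sqrt k.+1%:R * #|S|%:R.
    rewrite -mulrA ler_peMr ?mulr_ge0 // mulrC ler_pdivlMr // mul1r.
    by apply: le_trans skS _; rewrite ler_nat.
  by rewrite leNgt h1.
- by move=> *; exact: conf_measureE.
Qed.

Lemma goodness (M : R) : 0 <= M -> compact [set mu : M1 R | (ldp_rate xi mu <= M%:E)%E].
Proof.
move=> M0; apply: (subclosed_compact _ (radius_compact M0)).
  have /lower_semicontinuousP/(_ M) oM := rate_lsc xi0.
  rewrite (_ : [set _ | _] = ~` [set mu | (M%:E < ldp_rate xi mu)%E]); first exact: open_closedC.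
  by apply/seteqP; split => mu /=; [move/le_lt_trans => h h'; have := h _ h'; rewrite ltxx|move/negP; rewrite -leNgt].
move=> mu hM; have [c [gc hc cmu]] := conf_approx hM.
apply: (@shrinking_cvg R (radius M) (radius_ge0 M) (fun m k => @radius_dec M m k M0) (radius_cvg M0)
  (fun m => conf_measure (c m)) mu _ cmu).
by move=> m; apply: conf_shrinking => //; exact: le_trans (hc m) hM.
Qed.

End configurations.

Section one_size.
Context {R : realType} {d : measure_display} {T : measurableType d} (P : probability T R).

Lemma measure_le_sum (I : eqType) (r : seq I) (A : I -> set T) (E : set T) :
  measurable E -> (forall i, measurable (A i)) ->
  (forall t, E t -> exists2 i, i \in r & A i t) -> (P E <= \sum_(i <- r) P (A i))%E.
Proof.
move=> + mA; elim: r E => [|i r ih] E mE hE.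
  by rewrite (_ : E = set0) ?measure0 ?big_nil //; apply/seteqP; split => // t /hE[].
rewrite big_cons.
apply: (@le_trans _ _ (P (A i `|` (E `\` A i)))).
  apply: le_measure; rewrite ?inE //; first by apply: measurableU => //; exact: measurableD.
  by move=> t Et; have [h|h] := pselect (A i t); [left|right].
apply: le_trans (measureU2 _ _ _) _ => //; first exact: measurableD.
rewrite leeD2l //; apply: ih => [|t [/hE[j]]]; first exact: measurableD.
by rewrite inE => /predU1P[-> //|jr Aj _]; exists j.
Qed.

Variables (k C : nat) (b Z : R).
Local Notation n := k.+2.
Hypotheses (b0 : 0 < b) (b2 : b < 2) (Z0 : 0 < Z) (bC : n%:R * b <= C%:R).
Variables lam w : {mfun T >-> n.-tuple R}.
Hypothesis lamE : has_density P lam (beta_ensemble_density Z b (n:=n)).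
Hypothesis wE : has_dirichlet_law P w (b / 2).
Hypothesis lamw : independent P lam w.

Definition points om : n.-tuple R := [tuple Num.sqrt b * tnth (lam om) i | i < n].
Definition spectral om : M1 R := weighted_dirac (w om) (points om).

Let a0 : 0 < b / 2. Proof. by rewrite divr_gt0. Qed.
Let a1 : b / 2 < 1. Proof. by rewrite ltr_pdivrMr // mul1r. Qed.

Let mpre (X : {mfun T >-> n.-tuple R}) A : measurable A -> measurable (X @^-1` A).
Proof. by move=> mA; rewrite -[X in measurable X]setTI; exact: measurable_funP. Qed.

Lemma density_total :
  (\int[lebesgue_tuple R n]_y (beta_ensemble_density Z b (n:=n) y)%:E = 1)%E.
Proof. by rewrite -lamE //; exact: probability_setT. Qed.

Lemma off_simplex_null : P (w @^-1` ~` @open_simplex R k) = 0%E.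
Proof.
have mS : measurable (w @^-1` @open_simplex R k) by apply: mpre; exact: measurable_open_simplex.
rewrite -preimage_setC probability_setC //.
suff -> : P (w @^-1` @open_simplex R k) = 1%E by rewrite subee.
apply/eqP; rewrite eq_le probability_le1 //=.
have := law_simplex (D := distribution P w) wE measurableT.
by rewrite setTI probability_setT.
Qed.

Definition far_points m (iota : 'I_m -> 'I_n) (ro : 'I_m -> R) : set T :=
  [set om | forall j, ro j <= `|tnth (points om) (iota j)|].

Let far_pointsE m (iota : 'I_m -> 'I_n) (ro : 'I_m -> R) : injective iota ->
  far_points iota ro = lam @^-1`
    [set y : n.-tuple R | forall i, i \in codom iota ->
       \sum_(j < m | iota j == i) ro j <= `|Num.sqrt b * tnth y i|].
Proof.
move=> inj_i; apply/seteqP; split => om h => [i /codomP[j ->]|j].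
  rewrite (eq_bigl (pred1 j)); last by move=> j'; rewrite inj_eq.
  by rewrite big_pred1_eq; have := h j; rewrite tnth_mktuple.
have := h (iota j) (codom_f _ _).
rewrite (eq_bigl (pred1 j)); last by move=> j'; rewrite inj_eq.
by rewrite big_pred1_eq tnth_mktuple.
Qed.

Let measurable_far_tuple (S : seq 'I_n) r :
  measurable [set y : n.-tuple R | forall i, i \in S -> (r i <= `|Num.sqrt b * tnth y i|)%R].
Proof.
by apply: (@measurable_all R n S (fun j => [set x : R | r j <= `|Num.sqrt b * x|])) => j; exact: measurable_far.
Qed.

Lemma measurable_far_points m (iota : 'I_m -> 'I_n) ro : injective iota -> measurable (far_points iota ro).
Proof. by move=> inj_i; rewrite far_pointsE //; exact: mpre. Qed.

Lemma prob_far_points m (iota : 'I_m -> 'I_n) ro : injective iota -> (forall j, 0 <= ro j) ->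
  (P (far_points iota ro) <=
   (\prod_(j < m) (far_cost n C * expR (- (n.-1%:R * ro j ^+ 2 / 2))))%:E)%E.
Proof.
move=> inj_i ro0; rewrite far_pointsE //.
pose r i := \sum_(j < m | iota j == i) ro j.
have r0 i : 0 <= r i by apply: sumr_ge0.
have uS : uniq (codom iota) by rewrite map_inj_uniq // enum_uniq.
have := positions_far (ltn0Sn _) b0 (ltW Z0) bC uS r0.
rewrite density_total mule1 -lamE //.
move=> /le_trans; apply; rewrite lee_fin big_map big_enum /=.
rewrite le_eqVlt; apply/orP; left; apply/eqP; apply: eq_bigr => j _.
rewrite /r (eq_bigl (pred1 j)); last by move=> j'; rewrite inj_eq.
by rewrite big_pred1_eq.
Qed.

Lemma prob_far_heavy m (iota : 'I_m.+1 -> 'I_n) ro dl : injective iota -> (forall j, 0 <= ro j) -> 0 < dl ->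
  (P (far_points iota ro `&` w @^-1` all_above dl [set iota j | j : 'I_m.+1]%SET) <=
   ((b / 2 / dl ^+ 3) ^+ m * \prod_(j < m.+1) (far_cost n C * expR (- (n.-1%:R * ro j ^+ 2 / 2))))%:E)%E.
Proof.
move=> inj_i ro0 d0; rewrite mulrC EFinM [in leLHS]far_pointsE // lamw //; last exact: measurable_all_above.
rewrite -far_pointsE //; apply: lee_pmul => //; first exact: prob_far_points.
have cS : #|[set iota j | j : 'I_m.+1]%SET| = m.+1.
  by rewrite card_imset // card_ord.
exact: (law_all_above a0 a1 (D := distribution P w) wE d0 cS).
Qed.

(* the indices carrying the balls around the points of s are distinct as those balls are disjoint *)
Lemma prob_near_support m (s : 'I_m.+1 -> R) e dl (E : set T) :
  0 < e -> 0 < dl -> (forall i j, i != j -> 2 * e < `|s i - s j|) -> measurable E ->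
  (forall om, E om -> forall j, (dl%:E < (spectral om : probability R R) (ball (s j) e))%E) ->
  (P E <= (n%:R ^+ m.+1 * ((b / 2 / (dl / n%:R) ^+ 3) ^+ m *
     \prod_(j < m.+1) (far_cost n C * expR (- (n.-1%:R * (Num.max 0 (`|s j| - e)) ^+ 2 / 2)))))%:E)%E.
Proof.
move=> e0 d0 sep mE hE.
pose ro j := Num.max 0 (`|s j| - e).
have dn : 0 < dl / n%:R by rewrite divr_gt0.
pose A (i : option {ffun 'I_m.+1 -> 'I_n}) := match i with
  | None => w @^-1` ~` @open_simplex R k
  | Some f => if injectiveb f then far_points f ro `&` w @^-1` all_above (dl / n%:R) [set f j | j : 'I_m.+1]%SET
      else set0 end.
have mA i : measurable (A i).
  case: i => [f|] /=; last by apply: mpre; apply: measurableC; exact: measurable_open_simplex.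
  case: ifPn => // /injectiveP inj; apply: measurableI; first exact: measurable_far_points.
  by apply: mpre; exact: measurable_all_above.
apply: le_trans (measure_le_sum (r := None :: map Some (enum {ffun 'I_m.+1 -> 'I_n})) mE mA _) _.
  move=> om Eom; have [sw|sw] := pselect (open_simplex (w om)); last by exists None; rewrite ?inE.
  have [w0 w1] := sw.
  have /choice[f fP] : forall j, exists i, dl / n%:R < tnth (w om) i /\ ball (s j) e (tnth (points om) i).
    move=> j; apply: contrapT => hno; have := hE _ Eom j.
    rewrite weighted_diracE //; last by move=> i; exact: ltW.
    apply/negP; rewrite -leNgt.
    have -> : dl%:E = (\sum_(i < n) (dl / n%:R)%:E)%E.
      by rewrite sumEFin sumr_const card_ord -[X in _ = X%:E]mulr_natr divfK // pnatr_eq0.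
    apply: lee_sum => i _; rewrite diracE.
    have [|hb] := boolP (_ \in _); last by rewrite mule0 lee_fin ltW.
    rewrite inE => hb; rewrite mule1 lee_fin leNgt; apply/negP => hi.
    by apply: hno; exists i.
  have inj : injective f.
    move=> i j fij; apply/eqP; apply/negPn/negP => /sep; apply/negP; rewrite -leNgt.
    have [_ h1] := fP i; have [_ h2] := fP j; rewrite fij in h1.
    move: h1 h2; rewrite /ball /= => h1 h2.
    have -> : s i - s j = (s i - tnth (points om) (f j)) - (s j - tnth (points om) (f j)) by ring.
    by apply: le_trans (ler_normB _ _) _; rewrite mulrDl mul1r; apply: lerD; exact: ltW.
  exists (Some [ffun j => f j]).
    by rewrite inE /= map_f // mem_enum.
  have inj' : injective [ffun j => f j] by move=> i j; rewrite !ffunE; exact: inj.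
  rewrite /A; case: injectiveP => // _; split => [j|i /imsetP[j _ ->]]; rewrite ffunE; last by have [] := fP j.
  have [_] := fP j; rewrite /ball /= => hb.
  rewrite /ro ge_max normr_ge0 /=.
  have := ler_normB (s j) (s j - tnth (points om) (f j)); rewrite opprB addrC subrK => h.
  have := lerB_dist (s j) (tnth (points om) (f j)); lra.
rewrite big_cons big_map /A off_simplex_null add0e big_enum /=.
have q0 : 0 <= (b / 2 / (dl / n%:R) ^+ 3) ^+ m *
     \prod_(j < m.+1) (far_cost n C * expR (- (n.-1%:R * ro j ^+ 2 / 2))).
  apply: mulr_ge0; first by rewrite exprn_ge0 // divr_ge0 ?exprn_ge0 // ltW.
  by apply: prodr_ge0 => j _; rewrite mulr_ge0 ?expR_ge0 // far_cost_ge0.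
apply: (@le_trans _ _ (\sum_(f : {ffun 'I_m.+1 -> 'I_n}) ((b / 2 / (dl / n%:R) ^+ 3) ^+ m *
     \prod_(j < m.+1) (far_cost n C * expR (- (n.-1%:R * ro j ^+ 2 / 2))))%:E)%E).
  apply: lee_sum => f _; case: ifPn => [/injectiveP inj|_]; last by rewrite measure0 lee_fin.
  by apply: prob_far_heavy => // j; rewrite /ro le_max lexx.
by rewrite sumEFin sumr_const card_ffun !card_ord -[X in (X%:E <= _)%E]mulr_natl natrX.
Qed.

(* points outnumbering the radii, or weights off the simplex *)
Definition crowded (r : nat -> R) : set T :=
  [set om | exists q, (q < #|[set j | (r q < `|tnth (points om) j|)%R]%SET|)%N] `|` w @^-1` ~` @open_simplex R k.

Lemma not_crowded_shrinking (r : nat -> R) om :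
  (forall i, 0 <= r i) -> (forall i j, (i <= j)%N -> r j <= r i) ->
  ~ crowded r om -> shrinking r (spectral om).
Proof.
move=> r0 rdec /not_orP[h1 /contrapT[w0 w1]].
apply: (@finite_shrinking R r n (tnth (w om)) (tnth (points om))) => //.
- by move=> j; exact: ltW.
- by move=> q; rewrite leqNgt; apply/negP => hq; apply: h1; exists q.
- by move=> A mA; rewrite weighted_diracE // => j; exact: ltW.
Qed.

Definition many_far (q : nat) (ro : R) : set T :=
  \bigcup_(f in [set f : {ffun 'I_q.+1 -> 'I_n} | injective f]) far_points f (fun=> ro).

Lemma measurable_many_far q ro : measurable (many_far q ro).
Proof.
apply: fin_bigcup_measurable; first exact: finite_finset.
by move=> f; exact: measurable_far_points.
Qed.

Lemma prob_many_far q ro : 0 <= ro ->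
  (P (many_far q ro) <= ((n%:R * (far_cost n C * expR (- (n.-1%:R * ro ^+ 2 / 2)))) ^+ q.+1)%:E)%E.
Proof.
move=> ro0.
pose A (f : {ffun 'I_q.+1 -> 'I_n}) := if injectiveb f then far_points f (fun=> ro) else set0.
have mA f : measurable (A f).
  by rewrite /A; case: ifPn => // /injectiveP inj; exact: measurable_far_points.
apply: le_trans (measure_le_sum (r := enum {ffun 'I_q.+1 -> 'I_n}) (measurable_many_far q ro) mA _) _.
  by move=> om [f inj hf]; exists f; rewrite ?mem_enum // /A; case: injectiveP.
rewrite big_enum /=.
pose Q := (far_cost n C * expR (- (n.-1%:R * ro ^+ 2 / 2))) ^+ q.+1.
have Q0 : 0 <= Q by rewrite exprn_ge0 // mulr_ge0 ?expR_ge0 // far_cost_ge0.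
apply: (@le_trans _ _ (\sum_(f : {ffun 'I_q.+1 -> 'I_n}) Q%:E)%E).
  apply: lee_sum => f _; rewrite /A; case: ifPn => [/injectiveP inj|_]; last by rewrite measure0 lee_fin.
  by apply: le_trans (prob_far_points inj (fun=> ro0)) _; rewrite prodr_const card_ord.
by rewrite sumEFin sumr_const card_ffun !card_ord -[X in (X%:E <= _)%E]mulr_natl natrX exprMn.
Qed.

Lemma prob_crowded (r : nat -> R) (B : set T) : (forall i, 0 <= r i) -> measurable B -> B `<=` crowded r ->
  (P B <= (\sum_(q < n) (n%:R * (far_cost n C * expR (- (n.-1%:R * r q ^+ 2 / 2)))) ^+ q.+1)%:E)%E.
Proof.
move=> r0 mB hB.
pose A (i : option 'I_n) := match i with
  | None => w @^-1` ~` @open_simplex R k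
  | Some q => many_far q (r q) end.
have mA i : measurable (A i).
  case: i => [f|] /=; last by apply: mpre; apply: measurableC; exact: measurable_open_simplex.
  exact: measurable_many_far.
apply: le_trans (measure_le_sum (r := None :: map Some (enum 'I_n)) mB mA _) _.
  move=> om /hB [[q hq]|sw]; last by exists None; rewrite ?inE.
  set S := [set j | _]%SET in hq.
  have qn : (q < n)%N by apply: leq_trans hq _; rewrite -[leqRHS](card_ord n) max_card.
  pose f (j : 'I_q.+1) := enum_val (widen_ord hq j).
  have inj : injective f by move=> i j /enum_val_inj /(congr1 val) /= /val_inj.
  exists (Some (Ordinal qn)); first by rewrite inE /= map_f // mem_enum.
  exists [ffun j => f j]; first by move=> i j; rewrite !ffunE; exact: inj.
  by move=> j; rewrite ffunE; have := enum_valP (widen_ord hq j); rewrite inE => /ltW.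
rewrite big_cons big_map /A off_simplex_null add0e big_enum /= -sumEFin.
by apply: lee_sum => q _; exact: prob_many_far.
Qed.

Lemma prob_near_conf (p l : nat -> R) M (eps th : R) (E : set T) :
  0 < eps -> eps < 1 -> 0 < th -> (M <= k.+1)%N -> (forall j, (j < M)%N -> eps <= p j) ->
  th <= 1 - eps - \sum_(j < M) p j -> measurable E ->
  (forall om, open_simplex (w om) -> near_weights p eps M (w om) ->
    `|tnth (points om) ord_max - l M| < eps ->
    (forall j : 'I_k.+1, (j < M)%N -> `|tnth (points om) (lift ord_max j) - l j| < eps) -> E om) ->
  (1 <= (n%:R * (((eps / n%:R) `^ (- b)) ^+ k.+1 * (4 / (th * (b / 2) * eps)) ^+ M *
          \prod_(j < M.+1) (near_cost n C (l j) eps)^-1))%:E * P E)%E.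
Proof.
move=> e0 e1 t0 Mk pe thp mE hE.
pose al (i : 'I_n) := if i == ord_max then l M else l i.
pose S := rcons (map (lift ord_max) [seq j : 'I_k.+1 <- enum 'I_k.+1 | (j < M)%N]) ord_max : seq 'I_n.
have uS : uniq S.
  rewrite rcons_uniq; apply/andP; split.
    by apply/negP => /mapP[j _] /eqP; rewrite (negbTE (neq_lift _ _)).
  rewrite map_inj_uniq; last exact: lift_inj.
  by apply: filter_uniq; exact: enum_uniq.
have liftE (j : 'I_k.+1) : (lift (@ord_max k.+1) j : nat) = j by exact: lift_max.
have Sprod (F : R -> R) : \prod_(i <- S) F (al i) = \prod_(j < M.+1) F (l j).
  rewrite /S big_rcons /= big_map big_filter big_ord_recr /= /al eqxx; congr (_ * _).
  rewrite big_enum_cond (big_ord_widen _ (fun j => F (l j)) Mk); apply: eq_bigr => j _.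
  by rewrite eq_sym (negbTE (neq_lift _ _)) liftE.
pose A := [set y : n.-tuple R | forall i, i \in S -> (`|Num.sqrt b * tnth y i - al i| < eps)%R].
pose B := near_weights p eps M `&` @open_simplex R k.
have mA : measurable A.
  by apply: (@measurable_all R n S (fun j => [set x : R | `|Num.sqrt b * x - al j| < eps])) => j; exact: measurable_near.
have mB : measurable B by apply: measurableI; [exact: measurable_near_weights|exact: measurable_open_simplex].
have hA := positions_near (ltn0Sn _) b0 (ltW Z0) bC al uS e0.
rewrite density_total -lamE // (Sprod (fun x => (near_cost n C x eps)^-1)) in hA.
have hB := law_near_weights a0 a1 (D := distribution P w) wE e0 e1 t0 Mk pe thp.
have aE : 2 * (b / 2) = b by rewrite mulrC divfK.
rewrite aE in hB.
set K1 := _ * _ in hB; set K2 := \prod_(_ < _) _ in hA.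
have K20 : 0 <= K2 by apply: prodr_ge0 => j _; rewrite invr_ge0 ltW // near_cost_gt0.
have K10 : 0 <= K1.
  by rewrite mulr_ge0 ?exprn_ge0 ?powR_ge0 // divr_ge0 // !mulr_ge0 // ltW.
have hE' : lam @^-1` A `&` w @^-1` B `<=` E.
  move=> om [hAom [hw sw]]; apply: hE => //.
    have := hAom ord_max; rewrite /S mem_rcons inE eqxx /= => /(_ isT).
    by rewrite /al eqxx tnth_mktuple.
  move=> j jM; have := hAom (lift ord_max j).
  rewrite /S mem_rcons inE map_f ?orbT; last by rewrite mem_filter jM mem_enum.
  by rewrite tnth_mktuple /al eq_sym (negbTE (neq_lift _ _)) liftE => /(_ isT).
have PE : (P (lam @^-1` A) * P (w @^-1` B) <= P E)%E.
  rewrite -lamw //; apply: le_measure; rewrite ?inE //.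
  by apply: measurableI; exact: mpre.
have hB' : (1 <= (n%:R * K1)%:E * P (w @^-1` B))%E.
  rewrite EFinM -muleA; apply: le_trans (lee_wpmul2l _ hB); last by rewrite lee_fin.
  by rewrite -EFinM divff // pnatr_eq0.
have := lee_pmul lee01 lee01 hA hB'; rewrite mule1 => /le_trans; apply.
rewrite muleACA -EFinM.
have -> : K2 * (n%:R * K1) = n%:R * (K1 * K2) by ring.
apply: lee_wpmul2l => //; rewrite lee_fin; apply: mulr_ge0 => //; exact: mulr_ge0.
Qed.

End one_size.

Section slow_sequences.
Context {R : realType}.
Implicit Types q : nat -> R.

Definition slow q := forall dl, 0 < dl -> \forall n \near \oo, q n <= expR (dl * Num.sqrt n%:R).

Lemma slow_le q q' : (\forall n \near \oo, q n <= q' n) -> slow q' -> slow q.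
Proof.
move=> h hs dl d0; have := hs dl d0; move: h; apply: filterS2 => n h1 h2; exact: le_trans h1 h2.
Qed.

Lemma slow_cst (c : R) : slow (fun=> c).
Proof.
move=> dl d0; near=> n.
apply: le_trans (expR_ge1Dx _).
have : `|c| / dl <= Num.sqrt n%:R.
  rewrite -[leLHS]ger0_norm ?divr_ge0 ?(ltW d0) // -sqrtr_sqr ler_wsqrtr //.
  by near: n; exact: nbhs_infty_ger.
rewrite ler_pdivrMr // mulrC => h; have := ler_norm c; lra.
Unshelve. all: by end_near. Qed.

Lemma slowM q q' : (forall n, 0 <= q n) -> (forall n, 0 <= q' n) -> slow q -> slow q' -> slow (fun n => q n * q' n).
Proof.
move=> q0 q0' h h' dl d0.
have d2 : 0 < dl / 2 by rewrite divr_gt0.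
have := h' _ d2; have := h _ d2; apply: filterS2 => n h1 h2.
have -> : dl * Num.sqrt n%:R = dl / 2 * Num.sqrt n%:R + dl / 2 * Num.sqrt n%:R by field.
by rewrite expRD ler_pM.
Qed.

Lemma slowD q q' : slow q -> slow q' -> slow (fun n => q n + q' n).
Proof.
move=> h h' dl d0.
have d2 : 0 < dl / 2 by rewrite divr_gt0.
have := @slow_cst 2 _ d2; have := h' _ d2; have := h _ d2; apply: filterS3 => n h1 h2 h3.
have -> : dl * Num.sqrt n%:R = dl / 2 * Num.sqrt n%:R + dl / 2 * Num.sqrt n%:R by field.
rewrite expRD; apply: le_trans (ler_wpM2r (expR_ge0 _) h3).
by rewrite mulrDl mul1r lerD.
Qed.

Lemma slow_nat : slow (fun n => n%:R).
Proof.
move=> dl d0.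
have d2 : 0 < dl / 2 by rewrite divr_gt0.
have := @slow_cst ((4 / dl) ^+ 2) _ d2; apply: filterS => n h.
set y := Num.sqrt n%:R in h *.
have y0 : 0 <= y by exact: sqrtr_ge0.
have -> : n%:R = y ^+ 2 by rewrite sqr_sqrtr.
have -> : dl * y = dl / 2 * y + dl / 2 * y by field.
rewrite expRD; apply: le_trans (ler_wpM2r (expR_ge0 _) h).
have -> : dl / 2 * y = dl / 4 * y + dl / 4 * y by field.
have i0 : 0 <= 4 / dl by rewrite divr_ge0 // ltW.
have := expR_ge1Dx (dl / 4 * y); rewrite expRD => /(ler_wpM2l i0) h2.
have h3 : y <= 4 / dl * expR (dl / 4 * y).
  apply: le_trans h2; have -> : 4 / dl * (1 + dl / 4 * y) = 4 / dl + y by field; rewrite gt_eqF.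
  by rewrite lerDr.
by rewrite -[expR _ * expR _]expr2 -exprMn lerXn2r ?nnegrE ?(le_trans y0).
Qed.

Lemma slowX q m : (forall n, 0 <= q n) -> slow q -> slow (fun n => q n ^+ m).
Proof.
move=> q0 h; elim: m => [|m ih]; first exact: slow_cst.
by under eq_fun do rewrite exprS; apply: slowM => // n; exact: exprn_ge0.
Qed.

Lemma slow_prod m (q : 'I_m -> nat -> R) : (forall j n, 0 <= q j n) -> (forall j, slow (q j)) ->
  slow (fun n => \prod_(j < m) q j n).
Proof.
move=> q0 h; elim: m q q0 h => [|m ih] q q0 h.
  by under eq_fun do rewrite big_ord0; exact: slow_cst.
under eq_fun do rewrite big_ord_recr /=.
by apply: slowM => //; [move=> n; exact: prodr_ge0|apply: ih => j].
Qed.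

Lemma slow_expn q (dl : R) : slow q -> 0 < dl -> \forall n \near \oo, q n <= expR (n%:R * dl).
Proof.
move=> h d0; have := h dl d0; apply: filterS => n /le_trans; apply.
rewrite ler_expR mulrC ler_wpM2r ?(ltW d0) //.
case: n => [|n]; first by rewrite sqrtr0.
rewrite -[leRHS]sqr_sqrtr // expr2 ler_peMl // ?sqrtr_ge0 //.
by rewrite -[leLHS]sqrtr1 ler_wsqrtr // ler1n.
Qed.

Lemma slow_far_cost C : slow (fun n => far_cost n C : R).
Proof.
have g0 := ltW (@gauss_bound_gt0 R C).
rewrite /far_cost; apply: slowM; [by move=> n; rewrite !mulr_ge0 ?exprn_ge0 ?mulr_ge0|by move=> n; exact: expR_ge0| |exact: slow_cst].
apply: slowM; [by move=> n; rewrite mulr_ge0|by move=> n; rewrite exprn_ge0 ?mulr_ge0 ?exprn_ge0| |].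
  by apply: slowM => //; [exact: slow_cst|exact: slow_nat].
apply: slowX; first by move=> n; rewrite mulr_ge0 ?exprn_ge0.
apply: slowM => //; first exact: slow_cst.
by apply: slowX => //; exact: slow_nat.
Qed.

Lemma crowd_rate (C : nat) (M : R) : 0 < M ->
  \forall n \near \oo, \sum_(q < n) (n%:R * (far_cost n C * expR (- (n.-1%:R * radius M q ^+ 2 / 2)))) ^+ q.+1
    <= expR (- (n%:R * (M / 8))).
Proof.
move=> M0.
have sq : slow (fun n => n%:R * far_cost n C : R).
  by apply: slowM => //; [move=> n; exact: far_cost_ge0|exact: slow_nat|exact: slow_far_cost].
have M4 : 0 < M / 4 by rewrite divr_gt0.
have M8 : 0 < M / 8 by rewrite divr_gt0.
have := nbhs_infty_gt 1; have := slow_expn slow_nat M8; have := sq _ M4.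
apply: filterS3 => n h1 h2 n1.
have term (q : 'I_n) : (n%:R * (far_cost n C * expR (- (n.-1%:R * radius M q ^+ 2 / 2)))) ^+ q.+1 <= expR (- (n%:R * (M / 4))).
  have sk : 0 < Num.sqrt q.+1%:R :> R by rewrite sqrtr_gt0.
  set y := Num.sqrt q.+1%:R in sk.
  have yE : q.+1%:R = y ^+ 2 by rewrite sqr_sqrtr.
  have y1 : 1 <= y by rewrite -[leLHS]sqrtr1 ler_wsqrtr // ler1n.
  set t := Num.sqrt n%:R in h1.
  have tE : n%:R = t ^+ 2 by rewrite sqr_sqrtr.
  have yt : y <= t by rewrite ler_wsqrtr // ler_nat.
  have nE : n%:R = n.-1%:R + 1 :> R by rewrite natr1 prednK // ltnW.
  have n2 : n%:R <= 2 * n.-1%:R :> R.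
    by rewrite -natrM ler_nat; case: (n) n1 => // n' h /=; lia.
  rewrite mulrA radius_sqr ?(ltW M0) // -/y.
  apply: (@le_trans _ _ ((expR (M / 4 * t) * expR (- (n.-1%:R * (2 * M / y) / 2))) ^+ q.+1)).
    rewrite lerXn2r ?nnegrE ?mulr_ge0 ?expR_ge0 ?far_cost_ge0 //.
    by rewrite ler_wpM2r ?expR_ge0.
  rewrite -expRD -expRM_natl ler_expR yE.
  have -> : y ^+ 2 * (M / 4 * t + - (n.-1%:R * (2 * M / y) / 2)) = y * (M / 4 * (y * t) - n.-1%:R * M).
    by field; rewrite gt_eqF.
  have h3 : y * t <= n%:R by rewrite tE expr2 ler_pM2r // (lt_le_trans sk).
  have h4 : M / 4 * (y * t) - n.-1%:R * M <= - (n%:R * (M / 4)).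
    have : M / 4 * (y * t) <= M / 4 * n%:R by rewrite ler_pM2l.
    have : n%:R * M <= 2 * n.-1%:R * M by rewrite ler_pM2r.
    lra.
  apply: le_trans (ler_wpM2l (ltW sk) h4) _.
  by rewrite mulrN lerN2 ler_peMl // mulr_ge0 // ltW.
apply: (@le_trans _ _ (\sum_(q < n) expR (- (n%:R * (M / 4))))); first by apply: ler_sum => q _; exact: term.
rewrite sumr_const card_ord -[leLHS]mulr_natl.
apply: le_trans (ler_wpM2r (expR_ge0 _) h2) _.
rewrite -expRD ler_expR le_eqVlt; apply/orP; left; apply/eqP; lra.
Qed.

End slow_sequences.

Section rates.
Context {R : realType}.
Variables (beta : nat -> R) (xi : \bar R) (C : nat).
Hypothesis beta0 : forall n, (0 < n)%N -> 0 < beta n.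
Hypothesis xi0 : (0 <= xi)%E.
Hypothesis betaC : \forall n \near \oo, n%:R * beta n <= C%:R.
Hypothesis xi_lim : (fun n => (- (n%:R^-1 * ln (beta n)))%:E) @ \oo --> xi.

Lemma beta_le (x : R) : (x%:E < xi)%E -> \forall n \near \oo, beta n <= expR (- (n%:R * x)).
Proof.
move=> hx; have := xi_lim (open_ereal_gt' hx); have := nbhs_infty_gt 0.
apply: filterS2 => n n0 /=; rewrite lte_fin => h.
have n0' : 0 < n%:R :> R by rewrite ltr0n.
rewrite -[beta n]lnK ?posrE ?beta0 // ler_expR.
move: h; rewrite -mulrN mulrC ltr_pdivlMr // mulrC => h; lra.
Qed.

Lemma beta_ge (x : R) : (xi < x%:E)%E -> \forall n \near \oo, expR (- (n%:R * x)) <= beta n.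
Proof.
move=> hx; have := xi_lim (open_ereal_lt' hx); have := nbhs_infty_gt 0.
apply: filterS2 => n n0 /=; rewrite lte_fin => h.
have n0' : 0 < n%:R :> R by rewrite ltr0n.
rewrite -[beta n]lnK ?posrE ?beta0 // ler_expR.
move: h; rewrite -mulrN mulrC ltr_pdivrMr // mulrC => h; lra.
Qed.

Lemma beta_lt2 : \forall n \near \oo, beta n < 2.
Proof.
have := betaC; have := nbhs_infty_gt C; apply: filterS2 => n Cn h.
have n0' : 0 < n%:R :> R by rewrite ltr0n (leq_ltn_trans _ Cn).
have : beta n < 1 by rewrite -(ltr_pM2l n0') mulr1 (le_lt_trans h) // ltr_nat.
lra.
Qed.

Lemma beta_expn_le m (a s : R) : (a%:E < m%:R%:E * xi + s%:E)%E ->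
  exists x : R, a < m%:R * x + s /\ \forall n \near \oo, beta n ^+ m <= expR (- (n%:R * (m%:R * x))).
Proof.
case: m => [|m] ha.
  exists 0; rewrite mul0r; split; first by move: ha; rewrite mul0e add0e lte_fin add0r.
  by near=> n; rewrite expr0 mulr0 oppr0 expR0.
have [x hx xxi] : exists2 x : R, a < m.+1%:R * x + s & (x%:E < xi)%E.
  have m0 : 0 < m.+1%:R :> R by [].
  move: (xi) ha => [y| |] ha //.
  - exists (y - (m.+1%:R * y + s - a) / (2 * m.+1%:R)); last first.
      rewrite lte_fin ltrBlDr ltrDl divr_gt0 ?mulr_gt0 // subr_gt0.
      by move: ha; rewrite -EFinM -EFinD lte_fin.
    move: ha; rewrite -EFinM -EFinD lte_fin.
    have -> : m.+1%:R * (y - (m.+1%:R * y + s - a) / (2 * m.+1%:R)) = m.+1%:R * y - (m.+1%:R * y + s - a) / 2.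
      by field.
    lra.
  - exists ((a - s + 1) / m.+1%:R); last by rewrite ltry.
    by rewrite mulrC divfK ?gt_eqF //; lra.
  - by move: ha; rewrite gt0_muleNy ?lte_fin // addNye.
exists x; split => //; have := beta_le xxi; have := nbhs_infty_gt 0.
apply: filterS2 => n n0 h.
have -> : - (n%:R * (m.+1%:R * x)) = m.+1%:R * (- (n%:R * x)) by ring.
by rewrite expRM_natl lerXn2r ?nnegrE ?expR_ge0 ?(ltW (beta0 n0)).
Unshelve. all: by end_near. Qed.

Lemma upper_rate m (ro : 'I_m.+1 -> R) (dl a : R) : 0 < dl ->
  (a%:E < m%:R%:E * xi + (2^-1 * \sum_j ro j ^+ 2)%:E)%E ->
  \forall n \near \oo, n%:R ^+ m.+1 * ((beta n / 2 / (dl / n%:R) ^+ 3) ^+ m *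
     \prod_(j < m.+1) (far_cost n C * expR (- (n.-1%:R * ro j ^+ 2 / 2)))) <= expR (- (n%:R * a)).
Proof.
move=> d0; set s := 2^-1 * _ => ha.
have [x [hx hb]] := beta_expn_le ha.
pose q n : R := n%:R ^+ m.+1 * ((2 * dl ^+ 3)^-1 ^+ m * (n%:R ^+ 3) ^+ m *
  \prod_(j < m.+1) (far_cost n C * expR (ro j ^+ 2 / 2))).
have sq : slow q.
  have c0 : 0 <= (2 * dl ^+ 3)^-1 by rewrite invr_ge0 mulr_ge0 // exprn_ge0 // ltW.
  have p0 n : 0 <= \prod_(j < m.+1) (far_cost n C * expR (ro j ^+ 2 / 2)).
    by apply: prodr_ge0 => j _; rewrite mulr_ge0 ?expR_ge0 // far_cost_ge0.
  apply: slowM; [by move=> n; exact: exprn_ge0|by move=> n; rewrite !mulr_ge0 ?exprn_ge0|by apply: slowX => //; exact: slow_nat|].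
  apply: slowM; [by move=> n; rewrite mulr_ge0 ?exprn_ge0|by []| |].
    apply: slowM; [by move=> n; rewrite exprn_ge0|by move=> n; rewrite !exprn_ge0|exact: slow_cst|].
    apply: slowX; first by move=> n; exact: exprn_ge0.
    by apply: slowX => //; exact: slow_nat.
  apply: slow_prod => j; first by move=> n; rewrite mulr_ge0 ?expR_ge0 // far_cost_ge0.
  apply: slowM; [by move=> n; exact: far_cost_ge0|by move=> n; exact: expR_ge0|exact: slow_far_cost|exact: slow_cst].
have e0 : 0 < m%:R * x + s - a by rewrite subr_gt0.
have := nbhs_infty_gt 0; have := hb; have := slow_expn sq e0.
apply: filterS3 => n h1 h2 n0.
have n0' : 0 < n%:R :> R by rewrite ltr0n.
have E : n%:R ^+ m.+1 * ((beta n / 2 / (dl / n%:R) ^+ 3) ^+ m *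
     \prod_(j < m.+1) (far_cost n C * expR (- (n.-1%:R * ro j ^+ 2 / 2)))) =
  q n * beta n ^+ m * expR (- (n%:R * s)).
  have -> : beta n / 2 / (dl / n%:R) ^+ 3 = (2 * dl ^+ 3)^-1 * n%:R ^+ 3 * beta n.
    by field; rewrite !gt_eqF.
  rewrite /q exprMn exprMn.
  have -> : \prod_(j < m.+1) (far_cost n C * expR (- (n.-1%:R * ro j ^+ 2 / 2))) =
    \prod_(j < m.+1) (far_cost n C * expR (ro j ^+ 2 / 2)) * expR (- (n%:R * s)).
    have -> : - (n%:R * s) = \sum_(j < m.+1) (- (n%:R * ro j ^+ 2 / 2)).
      by rewrite sumrN /s mulr_sumr mulr_sumr; congr (- _); apply: eq_bigr => j _; field.
    rewrite expR_sum -big_split /=; apply: eq_bigr => j _.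
    rewrite -[RHS]mulrA -expRD; congr (_ * expR _).
    by rewrite -[in RHS](prednK n0) -[n.-1.+1%:R]natr1; field.
  ring.
rewrite E; apply: (@le_trans _ _ (expR (n%:R * (m%:R * x + s - a)) * expR (- (n%:R * (m%:R * x))) * expR (- (n%:R * s)))).
  apply: ler_wpM2r; first exact: expR_ge0.
  apply: ler_pM => //; last by rewrite exprn_ge0 // ltW // beta0.
  rewrite /q !mulr_ge0 ?exprn_ge0 ?invr_ge0 ?mulr_ge0 ?exprn_ge0 ?(ltW d0) //.
  by apply: prodr_ge0 => j _; rewrite mulr_ge0 ?expR_ge0 // far_cost_ge0.
by rewrite -!expRD ler_expR le_eqVlt; apply/orP; left; apply/eqP; ring.
Qed.

Lemma beta_inv_expn_le m (a s : R) : (m%:R%:E * xi + s%:E < a%:E)%E ->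
  exists x : R, m%:R * x + s < a /\ \forall n \near \oo, (beta n)^-1 ^+ m <= expR (n%:R * (m%:R * x)).
Proof.
case: m => [|m] ha.
  exists 0; rewrite mul0r; split; first by move: ha; rewrite mul0e add0e lte_fin add0r.
  by near=> n; rewrite expr0 mulr0 expR0.
have m0 : 0 < m.+1%:R :> R by [].
have [x hx xxi] : exists2 x : R, m.+1%:R * x + s < a & (xi < x%:E)%E.
  move: (xi) ha xi0 => [y| |] ha // _; last by move: ha; rewrite gt0_muley ?lte_fin // addye.
  exists (y + (a - (m.+1%:R * y + s)) / (2 * m.+1%:R)); last first.
    rewrite lte_fin ltrDl divr_gt0 ?mulr_gt0 // subr_gt0.
    by move: ha; rewrite -EFinM -EFinD lte_fin.
  move: ha; rewrite -EFinM -EFinD lte_fin.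
  have -> : m.+1%:R * (y + (a - (m.+1%:R * y + s)) / (2 * m.+1%:R)) = m.+1%:R * y + (a - (m.+1%:R * y + s)) / 2.
    by field.
  lra.
exists x; split => //; have := beta_ge xxi; have := nbhs_infty_gt 0.
apply: filterS2 => n n0 h.
have -> : n%:R * (m.+1%:R * x) = m.+1%:R * (n%:R * x) by ring.
rewrite expRM_natl lerXn2r ?nnegrE ?expR_ge0 ?invr_ge0 ?(ltW (beta0 n0)) //.
by rewrite -[leRHS]invrK -expRN lef_pV2 ?posrE ?expR_gt0 // beta0.
Unshelve. all: by end_near. Qed.

Lemma lower_rate (l : nat -> R) M (eps th a : R) : 0 < eps -> eps < 1 -> 0 < th ->
  (M%:R%:E * xi + (2^-1 * \sum_(j < M.+1) (`|l j| + eps) ^+ 2)%:E < a%:E)%E ->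
  \forall n \near \oo, n%:R * (((eps / n%:R) `^ (- beta n)) ^+ n.-1 * (4 / (th * (beta n / 2) * eps)) ^+ M *
          \prod_(j < M.+1) (near_cost n C (l j) eps)^-1) <= expR (n%:R * a).
Proof.
move=> e0 e1 t0; set s := 2^-1 * _ => ha.
have [x [hx hb]] := beta_inv_expn_le ha.
have g0 := @gauss_bound_gt0 R C.
pose u j n : R := eps^-1 * (1 + (1 + (`|l j| + eps)) * (2 * n%:R) / eps) ^+ C * gauss_bound C.
have A0 j : 0 <= 1 + (`|l j| + eps) by rewrite !addr_ge0 // ltW.
have u0 j n : 0 <= u j n.
  rewrite /u !mulr_ge0 ?invr_ge0 ?exprn_ge0 ?(ltW e0) ?(ltW g0) // addr_ge0 // divr_ge0 ?(ltW e0) //.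
  by rewrite mulr_ge0 // mulr_ge0.
pose q n : R := n%:R * ((n%:R / eps) ^+ C * (8 / (th * eps)) ^+ M * \prod_(j < M.+1) u j n).
have c0 : 0 <= 8 / (th * eps) by rewrite divr_ge0 // mulr_ge0 // ltW.
have i0 n : 0 <= n%:R / eps by rewrite divr_ge0 // ltW.
have sq : slow q.
  apply: slowM => //; [|exact: slow_nat|].
    by move=> n; rewrite !mulr_ge0 ?exprn_ge0 //; apply: prodr_ge0.
  apply: slowM; [by move=> n; rewrite mulr_ge0 ?exprn_ge0|by move=> n; apply: prodr_ge0| |].
    apply: slowM; [by move=> n; rewrite exprn_ge0|by move=> n; rewrite exprn_ge0| |exact: slow_cst].
    apply: slowX => //; apply: slowM => //; [by move=> n; rewrite invr_ge0 ltW|exact: slow_nat|exact: slow_cst].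
  apply: slow_prod => // j.
  have v0 n : 0 <= 1 + (1 + (`|l j| + eps)) * (2 * n%:R) / eps.
    by rewrite addr_ge0 // divr_ge0 ?(ltW e0) // mulr_ge0 // mulr_ge0.
  apply: slowM; [|by move=> n; exact: ltW| |exact: slow_cst].
    by move=> n; rewrite mulr_ge0 ?invr_ge0 ?exprn_ge0 ?(ltW e0).
  apply: slowM; [by move=> n; rewrite invr_ge0 ltW|by move=> n; rewrite exprn_ge0|exact: slow_cst|].
  apply: slowX => //; apply: slowD; first exact: slow_cst.
  apply: slowM; [by move=> n; rewrite mulr_ge0 // mulr_ge0|by move=> n; rewrite invr_ge0 ltW| |exact: slow_cst].
  apply: slowM => //; first exact: slow_cst.
  by apply: slowM => //; [exact: slow_cst|exact: slow_nat].
have d0 : 0 < a - (M%:R * x + s) by rewrite subr_gt0.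
have := betaC; have := nbhs_infty_gt 0; have := hb; have := slow_expn sq d0.
move=> F1 F2 F3 F4; near=> n.
have n0 : (0 < n)%N by near: n.
have h1 : q n <= expR (n%:R * (a - (M%:R * x + s))) by near: n.
have h2 : (beta n)^-1 ^+ M <= expR (n%:R * (M%:R * x)) by near: n.
have h3 : n%:R * beta n <= C%:R by near: n.
have b0 := beta0 n0.
have n0' : 0 < n%:R :> R by rewrite ltr0n.
have pw : ((eps / n%:R) `^ (- beta n)) ^+ n.-1 <= (n%:R / eps) ^+ C.
  have ne : eps / n%:R != 0 by rewrite gt_eqF // divr_gt0.
  rewrite /powR (negbTE ne) -expRM_natl.
  have -> : ln (eps / n%:R) = - ln (n%:R / eps).
    by rewrite -lnV ?posrE ?divr_gt0 // invf_div.
  have L0 : 0 <= ln (n%:R / eps).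
    by rewrite ln_ge0 // ler_pdivlMr // mul1r (le_trans (ltW e1)) // ler1n.
  rewrite -[X in X ^+ C]lnK ?posrE ?divr_gt0 // -expRM_natl ler_expR mulrNN mulrA.
  apply: ler_wpM2r => //; apply: le_trans h3; apply: ler_wpM2r; first exact: ltW.
  by rewrite ler_nat leq_pred.
have nc j : (near_cost n C (l j) eps)^-1 = u j n * expR (n%:R * (`|l j| + eps) ^+ 2 / 2).
  rewrite /near_cost /u expRN; field.
  rewrite !gt_eqF ?expR_gt0 // exprn_gt0 // ltr_pwDl // divr_ge0 ?(ltW e0) // mulr_ge0 // mulr_ge0 //.
have -> : 4 / (th * (beta n / 2) * eps) = 8 / (th * eps) * (beta n)^-1 by field; rewrite !gt_eqF.
have -> : \prod_(j < M.+1) (near_cost n C (l j) eps)^-1 = \prod_(j < M.+1) u j n * expR (n%:R * s).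
  have -> : n%:R * s = \sum_(j < M.+1) (n%:R * (`|l j| + eps) ^+ 2 / 2).
    by rewrite /s mulr_sumr mulr_sumr; apply: eq_bigr => j _; field.
  by rewrite expR_sum -big_split /=; apply: eq_bigr => j _; exact: nc.
rewrite exprMn.
have U0 : 0 <= \prod_(j < M.+1) u j n by apply: prodr_ge0.
apply: (@le_trans _ _ (q n * (beta n)^-1 ^+ M * expR (n%:R * s))).
  rewrite [leRHS](_ : _ = n%:R * ((n%:R / eps) ^+ C * ((8 / (th * eps)) ^+ M * (beta n)^-1 ^+ M) *
     (\prod_(j < M.+1) u j n * expR (n%:R * s)))); last by rewrite /q; ring.
  apply: ler_wpM2l => //; apply: ler_wpM2r; first by rewrite mulr_ge0 ?expR_ge0.
  apply: ler_wpM2r => //; first by rewrite mulr_ge0 ?exprn_ge0 // invr_ge0 ltW.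
apply: (@le_trans _ _ (expR (n%:R * (a - (M%:R * x + s))) * expR (n%:R * (M%:R * x)) * expR (n%:R * s))).
  apply: ler_wpM2r; first exact: expR_ge0.
  apply: ler_pM => //; last by rewrite exprn_ge0 // invr_ge0 ltW.
  by rewrite /q !mulr_ge0 ?exprn_ge0.
by rewrite -!expRD ler_expR le_eqVlt; apply/orP; left; apply/eqP; ring.
Unshelve. all: by end_near. Qed.

End rates.

Lemma cvg_sumr (R : realType) (T I : Type) (F : set_system T) (r : seq I) (u : I -> T -> R) (l : I -> R) :
  Filter F -> (forall i, u i @ F --> l i) ->
  (fun t => \sum_(i <- r) u i t) @ F --> \sum_(i <- r) l i.
Proof. by move=> FF ul; apply: cvg_big => //; exact: add_continuous. Qed.

Section open_preimages.
Context {R : realType}.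
Local Notation bc := (bounded_continuous R).

Lemma measurable_open_coords d (T : measurableType d) (I : finType) (X : I -> T -> R) (A : set (I -> R)) :
  (forall i, measurable_fun setT (X i)) ->
  (forall x, A x -> exists2 e, 0 < e & forall y, (forall i, `|y i - x i| < e) -> A y) ->
  measurable [set om | A (fun i => X i om)].
Proof.
move=> mX oA.
pose box (t : {ffun I -> rat} * nat) := [set y : I -> R | forall i, `|y i - ratr (t.1 i)| < t.2.+1%:R^-1].
pose B t : set T := if `[< box t `<=` A >] then [set om | box t (fun i => X i om)] else set0.
have -> : [set om | A (fun i => X i om)] = \bigcup_t B t.
  apply/seteqP; split => om /=; last first.
    by case=> t _; rewrite /B; case: asboolP => // h; exact: h.
  move=> /[dup] Aom /oA[e e0 hA].
  pose m := Num.truncn (2 / e).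
  have mE : 2 / e < m.+1%:R by exact: truncnS_gt.
  have me : m.+1%:R^-1 < e / 2.
    by rewrite -[ltRHS]invrK ltf_pV2 ?posrE ?invr_gt0 ?divr_gt0 // invf_div.
  have /choice[g gP] : forall i, exists q : rat, `|X i om - ratr q| < m.+1%:R^-1.
    move=> i; have : X i om - m.+1%:R^-1 < X i om + m.+1%:R^-1.
      by rewrite ltrD2l gtrN // invr_gt0.
    move=> /rat_in_itvoo[q]; rewrite in_itv /= => /andP[h1 h2]; exists q.
    by rewrite distrC ltr_distl h1 h2.
  exists ([ffun i => g i], m) => //; rewrite /B; case: asboolP => [_ i|[]]; first by rewrite ffunE.
  move=> y hy; apply: hA => i; have := hy i; have := gP i; rewrite /= ffunE => h1 h2.
  have -> : y i - X i om = (y i - ratr (g i)) - (X i om - ratr (g i)) by ring.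
  by apply: le_lt_trans (ler_normB _ _) _; rewrite [ltRHS]splitr ltrD // ?(lt_trans _ me).
apply: countable_bigcupT_measurable; first exact: countableP.
move=> t; rewrite /B; case: asboolP => // _.
rewrite (_ : [set om | _] = \bigcap_(i in [set: I]) [set om | `|X i om - ratr (t.1 i)| < t.2.+1%:R^-1]).
  apply: fin_bigcap_measurable => // i _.
  rewrite (_ : [set _ | _] = (fun om => `|X i om - ratr (t.1 i)|) @^-1` `]-oo, t.2.+1%:R^-1[%classic); last first.
    by apply/seteqP; split => om /=; rewrite in_itv.
  rewrite -[X in measurable X]setTI.
  have mm : measurable_fun setT (fun om => `|X i om - ratr (t.1 i)|).
    apply: (measurableT_comp (@normr_measurable R _)); apply: measurable_funB => //.
  by apply: mm => //; exact: measurable_itv.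
by apply/seteqP; split => om h i; [move=> _; exact: h|exact: h].
Qed.

Lemma open_mean_eq (U : set (M1 R)) (mu nu : M1 R) : open U ->
  (forall f : bc, mean mu f = mean nu f) -> U mu -> U nu.
Proof.
move=> oU E Umu.
have : (fun _ : nat => nu) @ \oo --> mu.
  by apply/M1_cvgP => f; rewrite E; exact: cvg_cst.
move=> /(_ U (open_nbhs_nbhs (conj oU Umu))) [N _ /(_ N)] /=; exact.
Qed.

Lemma weighted_dirac_degenerate n (w x : n.-tuple R) (f : bc) : \sum_(k < n) `|tnth w k| = 0 ->
  mean (weighted_dirac w x) f = sval f 0.
Proof.
move=> W0.
have E B : msum (weighted_atom w x) n B = (\sum_(k < n) (`|tnth w k|)%:E * \d_(tnth x k) B)%E.
  by rewrite /msum; apply: eq_bigr => k _; rewrite /= /mscale /= -!tnth_nth.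
have ET : msum (weighted_atom w x) n setT = 0%E.
  by rewrite E; under eq_bigr do rewrite diracT mule1; rewrite sumEFin W0.
rewrite (@mean_atoms R 1 (fun=> 1) (fun=> 0)) ?big_ord1 ?mul1r //.
move=> A mA; rewrite big_ord1 mul1e.
have NE (m : {measure set R -> \bar R}) (P : probability R R) :
    m setT = 0%E -> mnormalize m P A = P A by move=> mW; rewrite /mnormalize mW eqxx.
exact: NE.
Qed.

Lemma weighted_dirac_cvg n (ws xs : nat -> n.-tuple R) (w x : n.-tuple R) :
  0 < \sum_(k < n) `|tnth w k| ->
  (forall k, (fun m => tnth (ws m) k) @ \oo --> tnth w k) ->
  (forall k, (fun m => tnth (xs m) k) @ \oo --> tnth x k) ->
  (fun m => weighted_dirac (ws m) (xs m)) @ \oo --> weighted_dirac w x.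
Proof.
move=> W0 wc xc; apply/M1_cvgP => f; rewrite weighted_dirac_mean //.
have c1 : (fun m => \sum_(k < n) `|tnth (ws m) k|) @ \oo --> \sum_(k < n) `|tnth w k|.
  by apply: cvg_sumr => k; apply: cvg_norm; exact: wc.
have c2 : (fun m => \sum_(k < n) `|tnth (ws m) k| * sval f (tnth (xs m) k)) @ \oo -->
    \sum_(k < n) `|tnth w k| * sval f (tnth x k).
  apply: cvg_sumr => k; apply: cvgM; first by apply: cvg_norm; exact: wc.
  apply: (cvg_comp _ (sval f) (xc k)); exact: (proj1 (svalP f)).
have c3 : (fun m => (\sum_(k < n) `|tnth (ws m) k| * sval f (tnth (xs m) k)) / \sum_(k < n) `|tnth (ws m) k|) @ \oo -->
    (\sum_(k < n) `|tnth w k| * sval f (tnth x k)) / \sum_(k < n) `|tnth w k|.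
  by apply: cvgM => //; apply: cvgV => //; rewrite gt_eqF.
have F : \forall m \near \oo, (\sum_(k < n) `|tnth (ws m) k| * sval f (tnth (xs m) k)) / \sum_(k < n) `|tnth (ws m) k| =
    mean (weighted_dirac (ws m) (xs m)) f.
  have F0 : \forall m \near \oo, 0 < \sum_(k < n) `|tnth (ws m) k| by exact: cvgr_gt c1 _ W0.
  by apply: filterS F0 => m Wm; rewrite weighted_dirac_mean.
exact: cvg_trans (near_eq_cvg F) c3.
Qed.

Lemma measurable_weighted_dirac d (T : measurableType d) n (W X : T -> n.-tuple R) (U : set (M1 R)) :
  measurable_fun setT W -> measurable_fun setT X -> open U ->
  measurable [set om | U (weighted_dirac (W om) (X om))].
Proof.
move=> mW mX oU.
pose Y (i : 'I_n + 'I_n) om := match i with inl k => tnth (W om) k | inr k => tnth (X om) k end.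
pose wt (y : 'I_n + 'I_n -> R) : n.-tuple R := [tuple y (inl k) | k < n].
pose xt (y : 'I_n + 'I_n -> R) : n.-tuple R := [tuple y (inr k) | k < n].
have mY i : measurable_fun setT (Y i).
  by case: i => k; apply: (measurableT_comp (measurable_tnth _)).
have wtE om : wt (fun i => Y i om) = W om by apply: eq_from_tnth => k; rewrite tnth_mktuple.
have xtE om : xt (fun i => Y i om) = X om by apply: eq_from_tnth => k; rewrite tnth_mktuple.
pose A := [set y : 'I_n + 'I_n -> R | 0 < \sum_(k < n) `|tnth (wt y) k| /\ U (weighted_dirac (wt y) (xt y))].
pose B := [set om | \sum_(k < n) `|tnth (W om) k| = 0 /\ U (weighted_dirac (W om) (X om))].
rewrite (_ : [set om | _] = [set om | A (fun i => Y i om)] `|` B); last first.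
  apply/seteqP; split => om /=; rewrite /A /B /= wtE xtE; last by case=> -[].
  move=> Uom; have := sumr_ge0 (index_enum 'I_n) (fun k (_ : xpredT k) => normr_ge0 (tnth (W om) k)).
  by rewrite le_eqVlt => /predU1P[<-|]; [right|left].
apply: measurableU.
  apply: measurable_open_coords => // y [y0 Uy].
  apply: contrapT => hno.
  have /choice[z zP] : forall m : nat, exists z, (forall i, `|z i - y i| < m.+1%:R^-1) /\ ~ A z.
    move=> m; apply: contrapT => hz; apply: hno; exists m.+1%:R^-1; first by rewrite invr_gt0.
    by move=> z zy; apply: contrapT => nA; apply: hz; exists z.
  have zc i : (fun m => z m i) @ \oo --> y i.
    apply/cvgrPdist_lt => e e0; 
    have F0 : \forall m \near \oo, `|m.+1%:R^-1 : R| < e.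
      by apply: cvgr0_norm_lt e0; exact: cvg_harmonic.
    apply: filterS F0 => m; rewrite ger0_norm ?invr_ge0 // distrC; apply: lt_trans.
    by have [+ _] := zP m; apply.
  have c1 : (fun m => weighted_dirac (wt (z m)) (xt (z m))) @ \oo --> weighted_dirac (wt y) (xt y).
    apply: weighted_dirac_cvg => // k.
      by under eq_fun do rewrite tnth_mktuple; rewrite tnth_mktuple; exact: zc.
    by under eq_fun do rewrite tnth_mktuple; rewrite tnth_mktuple; exact: zc.
  have c2 : (fun m => \sum_(k < n) `|tnth (wt (z m)) k|) @ \oo --> \sum_(k < n) `|tnth (wt y) k|.
    apply: cvg_sumr => k; apply: cvg_norm.
    by under eq_fun do rewrite tnth_mktuple; rewrite tnth_mktuple; exact: zc.
  have F1 : \forall m \near \oo, U (weighted_dirac (wt (z m)) (xt (z m))) := c1 _ (open_nbhs_nbhs (conj oU Uy)).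
  have F2 : \forall m \near \oo, 0 < \sum_(k < n) `|tnth (wt (z m)) k| by exact: cvgr_gt c2 _ y0.
  have [m [h1 h2]] := filter_ex (filterI F1 F2).
  by have [_] := zP m; apply.
have mZ : measurable [set om | \sum_(k < n) `|tnth (W om) k| = 0].
  have ms : measurable_fun setT (fun om => \sum_(k < n) `|tnth (W om) k|).
    apply: measurable_sum => k; apply: (measurableT_comp (@normr_measurable R _)).
    by apply: (measurableT_comp (measurable_tnth _)).
  rewrite (_ : [set _ | _] = (fun om => \sum_(k < n) `|tnth (W om) k|) @^-1` [set 0]) //.
  by rewrite -[X in measurable X]setTI; apply: ms => //; exact: measurable_set1.
have [[om0 [h0 U0]]|hB] := pselect (exists om, B om); last first.
  by rewrite (_ : B = set0) //; apply/seteqP; split => // om Bom; apply: hB; exists om.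
rewrite (_ : B = [set om | \sum_(k < n) `|tnth (W om) k| = 0]) //.
apply/seteqP; split => om; first by case.
move=> h; split => //; apply: open_mean_eq oU _ U0 => f.
by rewrite !weighted_dirac_degenerate.
Qed.

Lemma near_conf_open (p l : nat -> R) M (mu : M1 R) (G : set (M1 R)) :
  (forall f : bc, mean mu f = \sum_(j < M) p j * sval f (l j) + (1 - \sum_(j < M) p j) * sval f (l M)) ->
  open G -> G mu ->
  exists2 e, 0 < e & forall eps, 0 < eps <= e -> forall k (w x : k.+2.-tuple R), (M <= k.+1)%N ->
    open_simplex w -> near_weights p eps M w -> `|tnth x ord_max - l M| < eps ->
    (forall j : 'I_k.+1, (j < M)%N -> `|tnth x (lift ord_max j) - l j| < eps) -> G (weighted_dirac w x).
Proof.
move=> muE oG Gmu; apply: contrapT => hno.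
pose data := (R * {k : nat & (k.+2.-tuple R * k.+2.-tuple R)%type})%type.
pose bad (m : nat) (D : data) := let: (eps, existT k (w, x)) := D in
  [/\ 0 < eps <= m.+1%:R^-1, (M <= k.+1)%N, open_simplex w, near_weights p eps M w & 
     [/\ `|tnth x ord_max - l M| < eps,
    (forall j : 'I_k.+1, (j < M)%N -> `|tnth x (lift ord_max j) - l j| < eps) & ~ G (weighted_dirac w x)]].
have /choice[D DP] : forall m, exists D, bad m D.
  move=> m; apply: contrapT => hD; apply: hno; exists m.+1%:R^-1; first by rewrite invr_gt0.
  move=> eps he k w x Mk sw nw hx hxs; apply: contrapT => nG; apply: hD.
  by exists (eps, existT _ k (w, x)).
pose sz m := projT1 (D m).2.
pose ws m : (sz m).+2.-tuple R := (projT2 (D m).2).1.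
pose xs m : (sz m).+2.-tuple R := (projT2 (D m).2).2.
pose ep m := (D m).1.
have DP' m : [/\ 0 < ep m <= m.+1%:R^-1, (M <= (sz m).+1)%N, open_simplex (ws m), near_weights p (ep m) M (ws m) & 
     [/\ `|tnth (xs m) ord_max - l M| < ep m,
    (forall j : 'I_(sz m).+1, (j < M)%N -> `|tnth (xs m) (lift ord_max j) - l j| < ep m) & ~ G (weighted_dirac (ws m) (xs m))]].
  by have := DP m; rewrite /ep /ws /xs /sz; case: (D m) => e [k [w x]].
suff : (fun m => weighted_dirac (ws m) (xs m)) @ \oo --> mu.
  move=> /(_ G (open_nbhs_nbhs (conj oG Gmu))) [N _ /(_ N)] /= /(_ (leqnn _)).
  by have [_ _ _ _ [_ _]] := DP' N.
apply/M1_cvgP => f; rewrite muE.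
have epc : ep @ \oo --> 0.
  apply: (squeeze_cvgr _ (cvg_cst 0) (@cvg_harmonic R)).
  by apply: nearW => m; have [/andP[h1 h2] _ _ _ _] := DP' m; rewrite /= h2 ltW.
have epl e : 0 < e -> \forall m \near \oo, ep m <= e.
  move=> e0; have F0 : \forall m \near \oo, `|ep m| <= e by exact: cvgr0_norm_le.
  by apply: filterS F0 => m; apply: le_trans; exact: ler_norm.
pose Ws m j := tnth (ws m) (lift ord_max (inord j)).
pose Xs m j := tnth (xs m) (lift ord_max (inord j)).
have inE' m (j : 'I_M) : (inord j : 'I_(sz m).+1) = j :> nat.
  by have [_ h _ _ _] := DP' m; rewrite inordK // (leq_trans (ltn_ord j)).
have Wc (j : 'I_M) : (fun m => Ws m j) @ \oo --> p j.
  apply/cvgrPdist_le => e e0; apply: filterS (epl e e0) => m; have [/andP[h1 h2] _ _ [hw _] _] := DP' m.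
  move=> he; have := hw (inord j); rewrite inE' => /(_ (ltn_ord j)).
  rewrite -/(Ws m j) => /andP[h3 h4]; rewrite ger0_norm; lra.
have Xc (j : 'I_M) : (fun m => Xs m j) @ \oo --> l j.
  apply/cvgrPdist_le => e e0; apply: filterS (epl e e0) => m; have [/andP[h1 h2] _ _ _ [_ hx _]] := DP' m.
  move=> he; have := hx (inord j); rewrite inE' => /(_ (ltn_ord j)).
  by rewrite distrC => /ltW /le_trans; apply.
have XMc : (fun m => tnth (xs m) ord_max) @ \oo --> l M.
  apply/cvgrPdist_le => e e0; apply: filterS (epl e e0) => m; have [/andP[h1 h2] _ _ _ [hx _ _]] := DP' m.
  move=> he.
  by rewrite distrC; move/ltW: hx => /le_trans; apply.
have bigM m (F : nat -> R) : \sum_(j : 'I_(sz m).+1 | (j < M)%N) F j = \sum_(j < M) F j.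
  by have [_ h _ _ _] := DP' m; rewrite (big_ord_widen _ F h).
have split m (F : 'I_(sz m).+2 -> R) : \sum_i F i = F ord_max + \sum_(j < M) F (lift ord_max (inord j))
     + \sum_(j : 'I_(sz m).+1 | ~~ (j < M)%N) F (lift ord_max j).
  rewrite (bigD1_ord ord_max) //= (bigID (fun j : 'I_(sz m).+1 => (j < M)%N)) /= addrA; congr (_ + _ + _).
  rewrite -(bigM m (fun j => F (lift ord_max (inord j)))).
  by apply: eq_bigr => j _; rewrite inord_val.
have w1 m : \sum_i tnth (ws m) i = 1 by have [_ _ []] := DP' m.
have wpos m i : 0 < tnth (ws m) i by have [_ _ []] := DP' m.
pose q := 1 - \sum_(j < M) p j.
pose rest m := \sum_(j : 'I_(sz m).+1 | ~~ (j < M)%N) tnth (ws m) (lift ord_max j).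
have rest0 m : 0 <= rest m by apply: sumr_ge0 => j _; exact: ltW.
have SWc : (fun m => \sum_(j < M) Ws m j) @ \oo --> \sum_(j < M) p j by apply: cvg_sumr.
have wsE m : tnth (ws m) ord_max = 1 - \sum_(j < M) Ws m j - rest m.
  by have := split m (tnth (ws m)); rewrite w1 -/(rest m) => ->; ring.
have WMc : (fun m => tnth (ws m) ord_max) @ \oo --> q.
  have c1 : (fun m => 1 - \sum_(j < M) Ws m j) @ \oo --> q by apply: cvgB => //; exact: cvg_cst.
  have c2 : (fun m => 1 - ep m - \sum_(j < M) p j) @ \oo --> q.
    have -> : q = 1 - 0 - \sum_(j < M) p j by rewrite subr0.
    apply: cvgB; last exact: cvg_cst.
    by apply: cvgB => //; exact: cvg_cst.
  apply: squeeze_cvgr c2 c1; apply: nearW => m.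
  have [_ _ _ [_ /= h] _] := DP' m; rewrite (ltW h) /= wsE.
  by have := rest0 m; lra.
have restc : rest @ \oo --> 0.
  have E : rest = (fun m => 1 - \sum_(j < M) Ws m j - tnth (ws m) ord_max).
    by apply/funext => m; rewrite wsE; ring.
  rewrite E -[X in _ --> X](subrr q); apply: cvgB => //.
  by apply: cvgB => //; exact: cvg_cst.
have [B B0 hB] := bc_bound f.
pose main m := \sum_(j < M) Ws m j * sval f (Xs m j) + tnth (ws m) ord_max * sval f (tnth (xs m) ord_max).
have mainc : main @ \oo --> \sum_(j < M) p j * sval f (l j) + q * sval f (l M).
  have fc (u : nat -> R) y : u @ \oo --> y -> (fun m => sval f (u m)) @ \oo --> sval f y.
    by move=> uy; apply: (cvg_comp _ (sval f) uy); exact: (proj1 (svalP f)).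
  apply: cvgD; last by apply: cvgM => //; exact: fc.
  by apply: cvg_sumr => j; apply: cvgM => //; exact: fc.
have diffc : (fun m => mean (weighted_dirac (ws m) (xs m)) f - main m) @ \oo --> 0.
  apply: norm_cvg0.
  have c0 : (fun m => rest m * B) @ \oo --> 0.
    by rewrite -[X in _ --> X](mul0r B); apply: cvgM => //; exact: cvg_cst.
  apply: squeeze_cvgr (cvg_cst 0) c0; apply: nearW => m; rewrite normr_ge0 /=.
  have wn i : `|tnth (ws m) i| = tnth (ws m) i by rewrite gtr0_norm.
  rewrite weighted_dirac_mean; last by under eq_bigr do rewrite wn; rewrite w1.
  under eq_bigr do rewrite wn. under [X in _ / X]eq_bigr do rewrite wn.
  rewrite w1 divr1 split.
  have -> : forall x y z : R, x + y + z - (y + x) = z by move=> *; ring.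
  apply: le_trans (ler_norm_sum _ _ _) _; rewrite /rest mulr_suml; apply: ler_sum => j _.
  by rewrite normrM wn ler_wpM2l // ltW.
have h : (fun m => main m + (mean (weighted_dirac (ws m) (xs m)) f - main m)) @ \oo -->
    \sum_(j < M) p j * sval f (l j) + q * sval f (l M).
  have hh := cvgD mainc diffc; rewrite addr0 in hh. exact: hh.
have F0 : \forall m \near \oo, main m + (mean (weighted_dirac (ws m) (xs m)) f - main m) = mean (weighted_dirac (ws m) (xs m)) f.
  by near=> m; rewrite addrC subrK.
have h' := cvg_trans (near_eq_cvg F0) h.
exact: h'.
Unshelve. all: by end_near. Qed.

End open_preimages.

Section exponential_bounds.
Context {R : realType}.
Implicit Types x y : \bar R.

Lemma le_opp_ereal x y : (forall a : R, (a%:E < x)%E -> (y <= (- a)%:E)%E) -> (y <= - x)%E.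
Proof.
case: x => [r| |] h; last by rewrite leey.
  apply/lee_addgt0Pr => e e0; have := h (r - e); rewrite lte_fin gtrBl => /(_ e0).
  by rewrite -EFinN -EFinD opprB addrC.
case: y h => [z| |] h //.
  by have := h (1 - z)%R (ltry _); rewrite lee_fin => h1; exfalso; lra.
by have := h 0%R (ltry _).
Qed.

Lemma opp_le_ereal x y : (forall a : R, (x < a%:E)%E -> ((- a)%:E <= y)%E) -> (- x <= y)%E.
Proof.
case: x => [r| |] h; last 2 first.
- by rewrite leNye.
- case: y h => [z| |] h //; last by have := h 0%R (ltNyr _).
  by have := h (- z - 1)%R (ltNyr _); rewrite lee_fin => h1; exfalso; lra.
apply/lee_addgt0Pr => e e0; have := h (r + e)%R; rewrite lte_fin ltrDl => /(_ e0) h'.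
rewrite -EFinN -leeBlDr // -EFinB.
by apply: le_trans h'; rewrite lee_fin opprD.
Qed.

Variables (X : ptopologicalType) (d : nat -> measure_display) (T : forall n, measurableType (d n)).
Variables (P : forall n, probability (T n) R) (Y : forall n, T n -> X).

Let lne_expR (a : R) (n : nat) : (0 < n)%N -> ((n%:R^-1)%:E * lne (expR (- (n%:R * a)))%:E)%E = (- a)%:E.
Proof.
move=> n0; rewrite -/(expeR (- (n%:R * a))%:E) expeRK -EFinM; congr EFin.
by rewrite mulrN mulKf // pnatr_eq0 -lt0n.
Qed.

Lemma limsup_log_prob (A : set X) (a : R) :
  (\forall n \near \oo, (P n (@Y n @^-1` A) <= (expR (- (n%:R * a)))%:E)%E) ->
  (limn_esup (log_prob P Y A) <= (- a)%:E)%E.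
Proof.
move=> h; apply: (@le_trans _ _ (ereal_sup [set log_prob P Y A n | n in [set n | (log_prob P Y A n <= (- a)%:E)%E]])).
  apply: ereal_inf_lbound; eexists; last reflexivity.
  have := nbhs_infty_gt 0; move: h; apply: filterS2 => n h n0 /=.
  rewrite -(lne_expR a n0) /log_prob; apply: lee_wpmul2l; first by rewrite lee_fin.
  by rewrite lee_lne // in_itv /= ?leey ?andbT ?lee_fin ?expR_ge0 ?measure_ge0.
by apply: ub_ereal_sup => _ [n hn <-].
Qed.

Lemma liminf_log_prob (A : set X) (a : R) :
  (\forall n \near \oo, ((expR (- (n%:R * a)))%:E <= P n (@Y n @^-1` A))%E) ->
  ((- a)%:E <= limn_einf (log_prob P Y A))%E.
Proof.
move=> h; rewrite /limn_einf leeNr.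
apply: (@le_trans _ _ (ereal_sup [set (- log_prob P Y A n)%E | n in [set n | ((- a)%:E <= log_prob P Y A n)%E]])).
  apply: ereal_inf_lbound; eexists; last reflexivity.
  have := nbhs_infty_gt 0; move: h; apply: filterS2 => n h n0 /=.
  rewrite -(lne_expR a n0) /log_prob; apply: lee_wpmul2l; first by rewrite lee_fin.
  by rewrite lee_lne // in_itv /= ?leey ?andbT ?lee_fin ?expR_ge0 ?measure_ge0.
by apply: ub_ereal_sup => _ [n hn <-]; rewrite leeN2.
Qed.

Lemma ldp_speed_n_criterion (I : X -> \bar R) : random_elements Y -> rate_function I ->
  (forall (F : set X) (a : R), closed F -> (a%:E < ereal_inf (I @` F))%E ->
     \forall n \near \oo, (P n (@Y n @^-1` F) <= (expR (- (n%:R * a)))%:E)%E) ->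
  (forall (G : set X) (a : R) (x : X), open G -> G x -> (I x < a%:E)%E ->
     \forall n \near \oo, ((expR (- (n%:R * a)))%:E <= P n (@Y n @^-1` G))%E) ->
  ldp_speed_n P Y I.
Proof.
move=> mY rI hF hG; split => // [F cF|G oG].
  apply: le_opp_ereal => a ha; by apply: limsup_log_prob; exact: hF.
apply: opp_le_ereal => a ha; apply: liminf_log_prob.
have [_ [x Gx <-] hx] := ereal_inf_lt ha.
exact: hG Gx hx.
Qed.

End exponential_bounds.

Section spectral_ldp.
Context {R : realType}.
Local Notation bc := (bounded_continuous R).
Variables (beta : nat -> R) (c : R) (xi : \bar R).
Hypothesis beta0 : forall n, (0 < n)%N -> 0 < beta n.
Hypothesis beta_lim : (fun n => n%:R * beta n) @ \oo --> 2 * c.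
Hypothesis xi0 : (0 <= xi)%E.
Hypothesis xi_lim : (fun n => (- (n%:R^-1 * ln (beta n)))%:E) @ \oo --> xi.
Variables (d : nat -> measure_display) (Omega : forall n, measurableType (d n)).
Variables (P : forall n, probability (Omega n) R).
Variables (lambda w : forall n, {mfun (Omega n) >-> n.-tuple R}).
Variable Z : nat -> R.
Hypothesis Z0 : forall n, (0 < n)%N -> 0 < Z n.
Hypothesis lambda_law : forall n, (0 < n)%N ->
  has_density (P n) (lambda n) (beta_ensemble_density (Z n) (beta n) (n := n)).
Hypothesis w_law : forall n, (0 < n)%N -> has_dirichlet_law (P n) (w n) (beta n / 2).
Hypothesis indep : forall n, (0 < n)%N -> independent (P n) (lambda n) (w n).

Let Y n (omega : Omega n) : M1 R :=
  weighted_dirac (w n omega) [tuple Num.sqrt (beta n) * tnth (lambda n omega) k | k < n].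

Let mY n (U : set (M1 R)) : open U -> measurable (@Y n @^-1` U).
Proof.
apply: measurable_weighted_dirac; first exact: measurable_funP.
apply: measurable_tuple_fun => k; under eq_fun do rewrite tnth_mktuple.
by apply: measurable_funM => //; apply: (measurableT_comp (measurable_tnth _)); exact: measurable_funP.
Qed.

Lemma spectral_random_elements : random_elements Y.
Proof.
move=> n n0; apply: (@measurability _ _ _ (borel (M1 R)) setT (@Y n) (@open (M1 R))) => // _ [U oU <-].
by rewrite setTI; exact: mY.
Qed.

Lemma eventually_bounded : exists C : nat, \forall n \near \oo, n%:R * beta n <= C%:R.
Proof.
exists (Num.truncn (2 * c)).+1.
have h : 2 * c < (Num.truncn (2 * c)).+1%:R by exact: truncnS_gt.
have F0 : \forall n \near \oo, n%:R * beta n < (Num.truncn (2 * c)).+1%:R by exact: cvgr_lt beta_lim _ h.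
by apply: filterS F0 => n /ltW.
Qed.

Lemma near_seq (T : eqType) (s : seq T) (Q : T -> nat -> Prop) :
  (forall x, x \in s -> \forall n \near \oo, Q x n) -> \forall n \near \oo, forall x, x \in s -> Q x n.
Proof.
elim: s => [|x s ih] h; first by apply: nearW => n x.
have h1 := h x (mem_head _ _).
have h2 := ih (fun y ys => h y (mem_behead (s := x :: s) ys)).
apply: filterS2 h1 h2 => n q1 q2 y; rewrite inE => /predU1P[->//|]; exact: q2.
Qed.

Lemma local_upper (mu : M1 R) (a : R) : (a%:E < ldp_rate xi mu)%E ->
  exists G : set (M1 R), [/\ open G, G mu &
    \forall n \near \oo, (P n (@Y n @^-1` G) <= (expR (- (n%:R * a)))%:E)%E].
Proof.
move=> /(rate_neighbourhood xi0)[s [e [dl [G [[us sn0 e0 d0 oG] [Gmu [he [sep GP]]]]]]]].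
exists G; split => //.
have [C betaC] := eventually_bounded.
have [m sm] : exists m, size s = m.+1 by case: (s) sn0 => // x s' _; exists (size s').
pose t (j : 'I_m.+1) := nth 0 s j.
have ts j : t j \in s by rewrite mem_nth // sm.
have tsep i j : i != j -> 2 * e < `|t i - t j|.
  by move=> ij; apply: sep => //; rewrite nth_uniq ?sm.
pose ro (j : 'I_m.+1) := Num.max 0 (`|t j| - e).
have ha : (a%:E < m%:R%:E * xi + (2^-1 * \sum_j ro j ^+ 2)%:E)%E.
  by move: he; rewrite /cost_near sm (big_nth 0) sm big_mkord.
have F1 := upper_rate C beta0 xi_lim d0 ha.
have F2 := beta_lt2 betaC.
have F3 := nbhs_infty_gt 1.
apply: filterS2 (filterI F1 F2) (filterI F3 betaC) => n [[hn b2] [n1 bC]].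
case: n n1 b2 bC hn => [|[|k]] // _ b2 bC hn.
have E := prob_near_support (beta0 (ltn0Sn _)) b2 (Z0 (ltn0Sn _)) bC (lambda_law (ltn0Sn _))
  (w_law (ltn0Sn _)) (indep (ltn0Sn _)) e0 d0 tsep.
have {}E := E _ (mY _ oG).
apply: le_trans (E _) _; first by move=> om Gom j; exact: GP.
by rewrite lee_fin.
Qed.

(* covering the compact part of F by finitely many of the neighbourhoods above *)
Lemma spectral_upper_cover (F : set (M1 R)) (a : R) : closed F -> (forall mu, F mu -> (a%:E < ldp_rate xi mu)%E) ->
  exists K : nat, \forall n \near \oo, (P n (@Y n @^-1` F) <= (K%:R * expR (- (n%:R * a)))%:E)%E.
Proof.
move=> cF hF.
pose M : R := 8 * (`|a| + 1).
have M0 : 0 < M by rewrite mulr_gt0 // ltr_wpDl.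
have Ma : a <= M / 8 by have := ler_norm a; rewrite /M; lra.
have /choice[G hG] : forall mu, exists G : set (M1 R), open G /\ (F mu -> G mu /\
    \forall n \near \oo, (P n (@Y n @^-1` G) <= (expR (- (n%:R * a)))%:E)%E).
  move=> mu; have [Fmu|Fmu] := pselect (F mu); last by exists setT; split => //; exact: openT.
  by have [G [oG Gmu hG]] := local_upper (hF _ Fmu); exists G.
have cK := compact_closedI (radius_compact (ltW M0)) cF.
rewrite compact_cover in cK.
have covF : shrinking (radius M) `&` F `<=` cover F G.
  by move=> mu [_ Fmu]; exists mu => //; have [_ /(_ Fmu)[]] := hG mu.
have oG mu : F mu -> open (G mu) by move=> _; exact: (proj1 (hG mu)).
have [D DF cov] := cK _ F G oG covF.
pose s : seq (M1 R) := finmap.enum_fset D.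
have sF mu : mu \in s -> F mu by move=> /DF; rewrite inE.
have F0 : \forall n \near \oo, forall mu, mu \in s -> (P n (@Y n @^-1` G mu) <= (expR (- (n%:R * a)))%:E)%E.
  by apply: near_seq => mu /sF Fmu; have [_ /(_ Fmu)[]] := hG mu.
have [C betaC] := eventually_bounded.
have F1 := crowd_rate C M0.
have F2 := nbhs_infty_gt 1.
exists (size s).+1; apply: filterS2 (filterI F0 F1) (filterI F2 betaC) => n h1 h2.
have hs := proj1 h1; have hc := proj2 h1; have n1 := proj1 h2; have bC := proj2 h2.
move: h1 h2 => _ _.
pose A (i : option (M1 R)) := match i with
  | None => (@Y n @^-1` F) `\` [set om | exists2 mu, mu \in s & G mu (Y om)]
  | Some mu => @Y n @^-1` G mu end.
have mF : measurable (@Y n @^-1` F).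
  rewrite -[F]setCK -preimage_setC; apply: measurableC; apply: mY; exact: closed_openC.
have mG mu : measurable (@Y n @^-1` G mu) by apply: mY; have [] := hG mu.
have mU (s' : seq (M1 R)) : measurable [set om | exists2 mu, mu \in s' & G mu (@Y n om)].
  elim: s' => [|mu s' ih].
    by rewrite (_ : [set _ | _] = set0) //; apply/seteqP; split => // om [].
  rewrite (_ : [set _ | _] = (@Y n @^-1` G mu) `|` [set om | exists2 mu, mu \in s' & G mu (@Y n om)]).
    exact: measurableU.
  apply/seteqP; split => om.
    by case=> nu; rewrite inE => /predU1P[->|]; [left|right; exists nu].
  by case=> [h|[nu nus h]]; [exists mu; rewrite ?mem_head|exists nu; rewrite // inE nus orbT].
have mA i : measurable (A i) by case: i => [mu|] //=; exact: measurableD.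
apply: le_trans (measure_le_sum (P n) (r := None :: map Some s) mF mA _) _.
  move=> om Fom; have [h|h] := pselect (exists2 mu, mu \in s & G mu (Y om)).
    by have [mu mus Gmu] := h; exists (Some mu); rewrite // inE /= map_f.
  by exists None; rewrite ?mem_head.
rewrite big_cons big_map.
have -> : (size s).+1%:R * expR (- (n%:R * a)) = expR (- (n%:R * a)) + \sum_(mu <- s) expR (- (n%:R * a)).
  set E := expR _.
  by rewrite big_const_seq count_predT iter_addr_0 -[E *+ _]mulr_natl -natr1 mulrDl mul1r addrC.
rewrite EFinD -sumEFin; apply: leeD; last first.
  by rewrite big_seq [leRHS]big_seq; apply: lee_sum => mu /hs.
have mB : measurable (@Y n @^-1` F `\` [set om | exists2 mu, mu \in s & G mu (Y om)]) by exact: (mA None).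
rewrite /A; clear A mA mF mG mU.
case: n n1 hs bC hc mB => [|[|k]] // _ hs bC hc mB.
apply: le_trans (prob_crowded (r := radius M) (beta0 (ltn0Sn _)) (Z0 (ltn0Sn _)) bC (lambda_law (ltn0Sn _))
  (w_law (ltn0Sn _)) _ mB _) _.
- by move=> i; exact: radius_ge0.
- move=> om [Fom nom]; apply: contrapT => ncr; apply: nom.
  have := not_crowded_shrinking (radius_ge0 M) (fun m j => @radius_dec _ M m j (ltW M0)) ncr.
  by move=> sh; have [mu muD Gmu] := cov _ (conj sh Fom); exists mu.
- by rewrite lee_fin; apply: le_trans hc _; rewrite ler_expR lerN2 ler_wpM2l.
Qed.

Lemma spectral_upper (F : set (M1 R)) (a : R) : closed F ->
  (a%:E < ereal_inf (ldp_rate xi @` F))%E ->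
  \forall n \near \oo, (P n (@Y n @^-1` F) <= (expR (- (n%:R * a)))%:E)%E.
Proof.
move=> cF ha.
have [a' aa' ha'] : exists2 a' : R, a < a' & (a'%:E < ereal_inf (ldp_rate xi @` F))%E.
  case: ereal_inf ha => [r| |] //.
    by rewrite lte_fin => ar; exists ((a + r) / 2); rewrite ?lte_fin ?midf_lt.
  by move=> _; exists (a + 1); rewrite ?ltry // ltrDl.
have [mu Fmu|K hK] := @spectral_upper_cover F a' cF _.
  by apply: lt_le_trans ha' _; apply: ereal_inf_lbound; exists mu.
have d0 : 0 < a' - a by rewrite subr_gt0.
have := slow_expn (@slow_cst R K%:R) d0; move: hK.
apply: filterS2 => n h1 h2; apply: le_trans h1 _; rewrite lee_fin.
apply: le_trans (ler_wpM2r (expR_ge0 _) h2) _.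
by rewrite -expRD ler_expR le_eqVlt; apply/orP; left; apply/eqP; ring.
Qed.

Lemma spectral_lower (G : set (M1 R)) (a : R) (mu : M1 R) : open G -> G mu -> (ldp_rate xi mu < a%:E)%E ->
  \forall n \near \oo, ((expR (- (n%:R * a)))%:E <= P n (@Y n @^-1` G))%E.
Proof.
move=> oG Gmu ha.
have [cf [gc hc cmu]] := conf_approx xi0 (ltW ha).
have [N _ /(_ N (leqnn _)) /= GN] : \forall m \near \oo, G (conf_measure (cf m)) := cmu _ (open_nbhs_nbhs (conj oG Gmu)).
move: (gc N) (le_lt_trans (hc N) ha) GN; set t := cf N => {gc hc cmu} gt ct Gt.
have [t0 t1] := gt.
have [M sM] : exists M, size t = M.+1.
  by case: (t) t1 => [|x t' _]; [rewrite big_nil => /eqP; rewrite eq_sym oner_eq0|exists (size t')].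
pose p j := (nth (0, 0) t j).1.
pose l j := (nth (0, 0) t j).2.
pose s0 := 2^-1 * \sum_(j < M.+1) l j ^+ 2.
have p0 j : (j < M.+1)%N -> 0 < p j by move=> jM; apply: t0; rewrite mem_nth // sM.
have psum : \sum_(j < M) p j + p M = 1.
  by rewrite -t1 (big_nth (0, 0)) sM big_mkord big_ord_recr.
have costE : (M%:R%:E * xi + s0%:E < a%:E)%E.
  move: ct; rewrite /cost size_map sM (_ : 2^-1 * _ = s0) //.
  by rewrite /s0 big_map (big_nth (0, 0)) sM big_mkord.
have muE (f : bc) : mean (conf_measure t) f = \sum_(j < M) p j * sval f (l j) + (1 - \sum_(j < M) p j) * sval f (l M).
  rewrite conf_mean // (big_nth (0, 0)) sM big_mkord big_ord_recr /=; congr (_ + _ * _).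
  by rewrite -psum addrC addKr.
have [e e0 he] := near_conf_open muE oG Gt.
have [dlt dlt0 hdlt] : exists2 dlt, 0 < dlt & (M%:R%:E * xi + (s0 + dlt)%:E < a%:E)%E.
  move: costE; case: (M%:R%:E * xi)%E => [z| |] //=.
    rewrite -EFinD lte_fin => h; exists ((a - (z + s0)) / 2); first by rewrite divr_gt0 // subr_gt0.
    by rewrite -EFinD lte_fin; lra.
  by move=> _; exists 1; rewrite ?addNye ?ltNyr.
pose S := \sum_(j < M.+1) (2 * `|l j| + 1).
have S0 : 0 <= S by apply: sumr_ge0 => j _; rewrite addr_ge0 // mulr_ge0.
have tpos : forall x, x \in [:: e, 1, dlt / (S + 1) & map fst t] -> 0 < x.
  move=> x; rewrite !inE => /or4P[/eqP ->|/eqP ->|/eqP ->|/mapP[y yt ->]] //; last exact: t0.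
  by rewrite divr_gt0 // ltr_wpDl.
have [q q0 hq] := seq_pos_lb tpos.
have qe : 2 * q < e by apply: hq; rewrite mem_head.
have q1 : 2 * q < 1 by apply: hq; rewrite !inE eqxx orbT.
have qd : 2 * q < dlt / (S + 1) by apply: hq; rewrite !inE eqxx !orbT.
have qp j : (j < M.+1)%N -> 2 * q < p j.
  move=> jM; have h : p j \in map fst t by apply: map_f; rewrite mem_nth // sM.
  by apply: hq; rewrite !in_cons h !orbT.
have hcost : (M%:R%:E * xi + (2^-1 * \sum_(j < M.+1) (`|l j| + q) ^+ 2)%:E < a%:E)%E.
  apply: le_lt_trans hdlt; apply: leeD2l; rewrite lee_fin.
  have h1 : \sum_(j < M.+1) (`|l j| + q) ^+ 2 <= \sum_(j < M.+1) l j ^+ 2 + q * S.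
    rewrite /S mulr_sumr -big_split /=; apply: ler_sum => j _.
    rewrite -[l j ^+ 2]real_normK ?num_real // sqrrD.
    have : q ^+ 2 <= q by rewrite expr2 ger_pMr //; lra.
    by rewrite mulr2n; lra.
  have h2 : q * S <= dlt.
    move: qd; rewrite ltr_pdivlMr ?ltr_wpDl // mulrDr mulr1 => h2.
    have : 0 <= q * S by rewrite mulr_ge0 // ltW.
    by lra.
  by rewrite /s0; lra.
have thp : q <= 1 - q - \sum_(j < M) p j by have := qp M (ltnSn _); lra.
have pe j : (j < M)%N -> q <= p j by move=> jM; have := qp j (ltnW jM); lra.
have [C betaC] := eventually_bounded.
have q1' : q < 1 by lra.
have F1 := lower_rate beta0 xi0 betaC xi_lim q0 q1' q0 hcost.
have F2 := beta_lt2 betaC.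
have F3 := nbhs_infty_gt M.+1.
apply: filterS2 (filterI F1 F2) (filterI F3 betaC) => n h1 h2.
have hn := proj1 h1; have b2 := proj2 h1; have nM := proj1 h2; have bC := proj2 h2.
move: h1 h2 => _ _.
case: n nM b2 bC hn => [|[|k]] //= nM b2 bC hn.
have Mk : (M <= k.+1)%N by rewrite -ltnS ltnW.
have E := prob_near_conf (beta0 (ltn0Sn _)) b2 (Z0 (ltn0Sn _)) bC (lambda_law (ltn0Sn _))
  (w_law (ltn0Sn _)) (indep (ltn0Sn _)) (l := l) q0 q1' q0 Mk pe thp (mY _ oG).
have {}E : (1 <= (expR (k.+2%:R * a))%:E * P k.+2 (@Y k.+2 @^-1` G))%E.
  apply: (le_trans (E _)); last by apply: lee_wpmul2r => //; rewrite lee_fin.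
  by move=> om sw nw hM hl; apply: (he q) => //; rewrite q0 /=; lra.
have x0 : (0 <= (expR (- (k.+2%:R * a)))%:E)%E by rewrite lee_fin expR_ge0.
by have := lee_wpmul2l x0 E; rewrite mule1 muleA -EFinM -expRD addNr expR0 mul1e.
Qed.

End spectral_ldp.

Unset Implicit Arguments.
Set Strict Implicit.
Theorem theorem1 (R : realType) (beta : nat -> R) (c : R) (xi : \bar R)
    (beta_gt0 : forall n, (0 < n)%N -> 0 < beta n)
    (c_ge0 : 0 <= c)
    (beta_lim : (fun n => n%:R * beta n) @ \oo --> 2 * c)
    (xi_ge0 : (0 <= xi)%E)
    (xi_lim : (fun n => (- (n%:R^-1 * ln (beta n)))%:E) @ \oo --> xi)
    (d : nat -> measure_display) (Omega : forall n, measurableType (d n))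
    (P : forall n, probability (Omega n) R)
    (lambda : forall n, {RV (P n) >-> n.-tuple R})
    (w : forall n, {RV (P n) >-> n.-tuple R})
    (Z : nat -> R)
    (Z_gt0 : forall n, (0 < n)%N -> 0 < Z n)
    (lambda_law : forall n, (0 < n)%N ->
       has_density (P n) (lambda n) (beta_ensemble_density (Z n) (beta n) (n := n)))
    (w_law : forall n, (0 < n)%N ->
       has_dirichlet_law (P n) (w n) (beta n / 2))
    (lambda_w_indep : forall n, (0 < n)%N ->
       independent (P n) (lambda n) (w n)) :
  let mu n (omega : Omega n) : M1 R :=
    weighted_dirac (w n omega)
      [tuple Num.sqrt (beta n) * tnth (lambda n omega) k | k < n] in
  ldp_speed_n P mu (ldp_rate xi) /\ good_rate_function (ldp_rate xi).

Proof.
move=> mu.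
have rI : rate_function (ldp_rate xi : M1 R -> \bar R).
  by split; [move=> nu; exact: rate_ge0|exact: rate_lsc].
split; last by split => // M M0; exact: goodness.
apply: ldp_speed_n_criterion => //.
- exact: spectral_random_elements.
- by move=> F a cF; exact: (spectral_upper beta_gt0 beta_lim xi_ge0 xi_lim Z_gt0 lambda_law w_law lambda_w_indep).
- by move=> G a nu; exact: (spectral_lower beta_gt0 beta_lim xi_ge0 xi_lim Z_gt0 lambda_law w_law lambda_w_indep).
Qed.
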